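(* Consider the equation $w_{1,2}+w_{0,2}w_{0,3}=0$ for $w=w(z_1,z_2)$, with $w_{k,l}:=\partial^{k+l}w/\partial z_1^k\partial z_2^l$. A differential function $f$ depending only on $z_1,z_2$ and the parametric derivatives $w_{k,l}$ ($k\in\mathbb N_0$, $l\in\{0,1,2\}$) is a cosymmetry of this equation if and only if it is a linear combination of the differential functions \[ \varrho,\quad \alpha,\quad w_{0,2}\gamma-z_2\hat{\mathrm D}_1\gamma,\quad w_{0,1}-\tfrac12z_1(w_{0,2})^2,\quad \big(w_{0,1}-\tfrac12z_1(w_{0,2})^2\big)w_{0,2}-z_2\zeta^{10}, \] \[ \big(w_{0,1}-\tfrac12z_1(w_{0,2})^2\big)\theta^0+z_1z_2\zeta^{10},\quad z_1(w_{1,0}-z_2\zeta^{10})+z_2w_{0,1}-w_{0,0}+\tfrac1{12}z_1^2(w_{0,2})^3-\tfrac14z_2^2w_{0,2}, \] \[ w_{1,0}-z_2\zeta^{10}+\tfrac16z_1(w_{0,2})^3,\quad \big(z_1(w_{1,0}-z_2\zeta^{10})+z_2w_{0,1}-w_{0,0}+\tfrac1{12}z_1^2(w_{0,2})^3-\tfrac14z_2^2w_{0,2}\big)\theta^0+z_1^{2}z_2\zeta^{20}, \] \[ \big(z_1(w_{1,0}-z_2\zeta^{10})+z_2w_{0,1}-w_{0,0}+\tfrac1{12}z_1^2(w_{0,2})^3-\tfrac14z_2^2w_{0,2}\big)w_{0,2}-z_1z_2\zeta^{20}, \] \[ z_2(w_{1,0}-z_2\zeta^{10})+(z_2w_{0,1}-w_{0,0})w_{0,2}-\tfrac16z_2^2(w_{0,2})^2,\quad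 (w_{1,0}-z_2\zeta^{10})w_{0,2}+\tfrac16z_1(w_{0,2})^4-z_2\zeta^{20}, \] where $\varrho$ is an arbitrary function of $w_{0,2}$ and finitely many $\theta^k$, and $\alpha$ and $\gamma$ are arbitrary $z_2$-integrals of the equation.
   Context: $\mathrm D_1,\mathrm D_2$ are total derivatives with respect to $z_1,z_2$; $\hat{\mathrm D}_1,\hat{\mathrm D}_2$ are their restrictions to the solution manifold of the equation (acting on functions of $z_1,z_2$ and parametric derivatives $w_{k,l}$, $l\le2$, with principal derivatives $w_{k,l}$, $l\geqslant3$, eliminated via the equation and its differential consequences). Set $I^1:=w_{1,1}+\frac12(w_{0,2})^2$, $I^2:=w_{2,0}-\frac13(w_{0,2})^3-z_2\mathrm D_1I^1$, $\zeta^{ik}:=\mathrm D_1^kI^i$, and $\theta^k:=\big(\frac{w_{0,2}}{w_{1,2}}\hat{\mathrm D}_2\big)^k(z_2-w_{0,2}z_1)$, $k\in\mathbb N_0$. A $z_2$-integral is a differential function $\gamma$ of $z_1,z_2$ and parametric derivatives with $\hat{\mathrm D}_2\gamma=0$; these are exactly the smooth functions of $z_1$ and finitely many $\zeta^{ik}$. A cosymmetry is a differential function annihilated on solutions by the formal adjoint of the linearization of the equation, i.e. $\hat{\mathrm D}_2^2\big(\hat{\mathrm D}_1+w_{0,2}\hat{\mathrm D}_2\big)f=0$. *)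

(* Defs.v *)
From HB Require Import structures.
From mathcomp Require Import all_boot all_order all_algebra.
From mathcomp Require Import all_classical all_reals all_analysis.
Set Implicit Arguments. Unset Strict Implicit. Unset Printing Implicit Defensive.
Import Order.TTheory GRing.Theory Num.Theory numFieldNormedType.Exports.
Local Open Scope classical_set_scope.
Local Open Scope ring_scope.

(* Jet coordinates on the solution manifold of w_{1,2} + w_{0,2} w_{0,3} = 0:
   z1 = inl false, z2 = inl true, w_{k,l} = inr (k, l) with l in {0,1,2}. *)
Definition var := (bool + (nat * 'I_3))%type.
Definition vz1 : var := inl false.
Definition vz2 : var := inl true.
Definition vw (k l : nat) : var := inr (k, inord l).

Section Jets.
Variable R : realType.

Definition J : topologicalType := prod_topology (fun _ : var => (R : topologicalType)).

Definition z1 (p : J) : R := p vz1.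
Definition z2 (p : J) : R := p vz2.
Definition w (k l : nat) (p : J) : R := p (vw k l).

Definition upd (p : J) (v : var) (t : R) : J :=
  fun u => if u == v then t else p u.

Definition pd (v : var) (f : J -> R) : J -> R :=
  fun p => derive1 (fun t => f (upd p v t)) (p v).

Definition iterpd (vs : seq var) (f : J -> R) : J -> R := foldr pd f vs.

Definition diff_fun (O : set J) (f : J -> R) : Prop :=
  (exists S : seq var, forall p q, O p -> O q ->
      (forall v, v \in S -> p v = q v) -> f p = f q) /\
  (forall (vs : seq var) (v : var) (p : J), O p ->
      derivable (fun t => iterpd vs f (upd p v t)) (p v) 1) /\
  (forall (vs : seq var) (p : J), O p -> {for p, continuous (iterpd vs f)}).

(* total derivative D_1 (= \hat D_1 on functions of parametric derivatives) *)
Definition D1 (f : J -> R) : J -> R :=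
  fun p => pd vz1 f p +
    limn (fun N => \sum_(0 <= k < N)
      (\sum_(l < 3) p (inr (k.+1, l) : var) * pd (inr (k, l) : var) f p)).

(* principal derivatives w_{k,3} expressed through the equation:
   w_{0,3} = - w_{1,2} / w_{0,2}, w_{k,3} = \hat D_1^k w_{0,3} *)
Definition w3 (k : nat) : J -> R :=
  iter k D1 (fun p => - w 1 2 p / w 0 2 p).

Definition D2 (f : J -> R) : J -> R :=
  fun p => pd vz2 f p +
    limn (fun N => \sum_(0 <= k < N)
      (w k 1 p * pd (vw k 0) f p + w k 2 p * pd (vw k 1) f p
       + w3 k p * pd (vw k 2) f p)).

(* region of jet space where the equation can be solved for w_{0,3}
   and where the theta^k are defined *)
Definition Dom : set J := [set p | w 0 2 p != 0 /\ w 1 2 p != 0].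

Definition cosymmetry (O : set J) (f : J -> R) : Prop :=
  forall p, O p -> D2 (D2 (fun q => D1 f q + w 0 2 q * D2 f q)) p = 0.

Definition I1 : J -> R := fun p => w 1 1 p + (w 0 2 p) ^+ 2 / 2.
Definition I2 : J -> R :=
  fun p => w 2 0 p - (w 0 2 p) ^+ 3 / 3 - z2 p * D1 I1 p.
Definition zeta (i k : nat) : J -> R :=
  iter k D1 (if i == 1%N then I1 else I2).

Definition theta (k : nat) : J -> R :=
  iter k (fun g q => w 0 2 q / w 1 2 q * D2 g q) (fun q => z2 q - w 0 2 q * z1 q).

Definition z2_integral (V : set J) (g : J -> R) : Prop :=
  diff_fun V g /\ forall p, V p -> D2 g p = 0.

Definition rho_fun (V : set J) (g : J -> R) : Prop :=
  diff_fun V g /\ exists (n : nat) (F : R -> 'rV[R]_n -> R),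
    forall p, V p -> g p = F (w 0 2 p) (\row_(k < n) theta k p).

Definition cA : J -> R := fun p => w 0 1 p - z1 p * (w 0 2 p) ^+ 2 / 2.
Definition cB : J -> R := fun p => w 1 0 p - z2 p * zeta 1 0 p.
Definition cC : J -> R := fun p =>
  z1 p * cB p + z2 p * w 0 1 p - w 0 0 p
  + (z1 p) ^+ 2 * (w 0 2 p) ^+ 3 / 12 - (z2 p) ^+ 2 * w 0 2 p / 4.

Definition explicit_gens : seq (J -> R) :=
  [:: cA;
      (fun p => cA p * w 0 2 p - z2 p * zeta 1 0 p);
      (fun p => cA p * theta 0 p + z1 p * z2 p * zeta 1 0 p);
      cC;
      (fun p => cB p + z1 p * (w 0 2 p) ^+ 3 / 6);
      (fun p => cC p * theta 0 p + (z1 p) ^+ 2 * z2 p * zeta 2 0 p);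
      (fun p => cC p * w 0 2 p - z1 p * z2 p * zeta 2 0 p);
      (fun p => z2 p * cB p + (z2 p * w 0 1 p - w 0 0 p) * w 0 2 p
                - (z2 p) ^+ 2 * (w 0 2 p) ^+ 2 / 6);
      (fun p => cB p * w 0 2 p + z1 p * (w 0 2 p) ^+ 4 / 6 - z2 p * zeta 2 0 p)].

Definition generator (V : set J) (g : J -> R) : Prop :=
  rho_fun V g \/ z2_integral V g \/
  (exists gam, z2_integral V gam /\
     g = (fun p => w 0 2 p * gam p - z2 p * D1 gam p)) \/
  (exists i, (i < size explicit_gens)%N /\ g = nth (fun _ => 0) explicit_gens i).

Definition lin_comb_on (V : set J) (f : J -> R) : Prop :=
  exists (n : nat) (c : 'I_n -> R) (g : 'I_n -> J -> R),
    (forall i, generator V (g i)) /\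
    forall p, V p -> f p = \sum_(i < n) c i * g i p.

End Jets.

(* Main.v *)
Require Import Defs.
From HB Require Import structures.
From mathcomp Require Import all_boot all_order all_algebra.
From mathcomp Require Import all_classical all_reals all_analysis.
From mathcomp Require Import ring lra zify.
Import Order.TTheory GRing.Theory Num.Theory numFieldNormedType.Exports.
Set Implicit Arguments. Unset Strict Implicit. Unset Printing Implicit Defensive.
Local Open Scope classical_set_scope.
Local Open Scope ring_scope.

(* Put E = D_1 + w_{0,2} D_2. A function f is a cosymmetry iff E f = alpha z_2 + beta for some
   z_2-integrals alpha and beta. On jets there are coordinates in which everything is explicit:
   x = z_1, the parameters u = w_{0,2}, theta^0, theta^1, ..., and two sequences y_0, y_1, ... and
   c_0, c_1, ... (y_{k+1} = zeta^{1k}, c_{k+2} = zeta^{2k}) in which E is the total derivative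
   d/dx + sum y_{k+1} d/dy_k + sum c_{k+1} d/dc_k, while z_2 = theta^0 + u x. Iterated brackets of D_2
   show that z_2-integrals depend only on x and the zeta^{ik}; and E g = 0 forces g to depend on the
   parameters only. Differentiating E f = alpha (theta^0 + u x) + beta with respect to theta^0 and u
   and then freezing the parameters gives functions P, Q, S of x, y, c with E P = alpha,
   E Q = x alpha and E S = beta. With T = x P - Q one has E T = P and
   f = z_2 E T - u T + S + rho, where E rho = 0. As E (E T) = alpha and E S = beta do not involve
   y_0, c_0, c_1, the functions T and S are z_2-integrals up to the explicit polynomials

     T = (a x + b) y_0 + (c x + d) c_0 + (- c x^2 + r x + s) c_1,
     S = k_0 y_0 + k_1 (c_0 - x c_1) + k_2 c_1,

   whose nine coefficients correspond to the nine explicit generators.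
   The inverse of the coordinate change rests on the hodograph transformation, which turns the
   theta^k into linear expressions in the derivatives of z_1 with respect to w_{0,2}. *)

(** * Differential calculus on the jet space *)

(** E is differentiation along the characteristics of the equation: it annihilates w_{0,2}, sends
    z_1 to 1 and z_2 to w_{0,2}. Hence theta^0 = z_2 - w_{0,2} z_1 is constant along E, and so is
    every theta^k, because the field (w_{0,2}/w_{1,2}) D_2 commutes with E. The obstacle is that an
    equation E P = alpha in infinitely many smooth variables cannot be solved by a formula.
    Primitives are read off from f itself: E commutes with the parameter derivatives, so these
    derivatives of f are already primitives, and freezing the parameters removes the dependence on
    them that would spoil the later steps. Vanishing partial derivatives force constancy only on a
    connected piece, and every argument moves one coordinate at a time; the analysis therefore takes
    place on boxes, and the linear combination is found only near each point. Since a differential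
    function involves finitely many coordinates, each induction on the jet order starts above its
    support and descends. *)

Section Calculus.
Variable R : realType.
Local Notation J := (J R).
Implicit Types (f g : J -> R) (p q : J) (v : var) (S : seq var) (O : set J).

(** Only the coordinates in the finite list are constrained, as for basic open sets of the product
    topology. Boxes are stable under mixing coordinates of two members and convex in each
    coordinate, which keeps mean value points inside. *)
Definition box S (e : R) p : set J :=
  [set q | forall v, v \in S -> `|q v - p v| < e].

Lemma box_center S e p : 0 < e -> box S e p p.
Proof. by move=> e0 v _; rewrite subrr normr0. Qed.

Lemma box_sub S S' e e' p : {subset S' <= S} -> e <= e' ->
  box S e p `<=` box S' e' p.
Proof. by move=> sS ee q Bq v /sS/Bq/lt_le_trans; apply. Qed.

Lemma nbhs_proj v p (A : set R) : nbhs (p v) A -> nbhs p [set q : J | A (q v)].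
Proof.
move=> An.
exact: (@proj_continuous var (fun=> (R : topologicalType)) v p A An).
Qed.

(** For the direct implication, the sets containing a box around [p] form a filter that converges to
    [p] along every projection. The product topology is the supremum of the topologies induced by
    the projections, so this filter converges to [p]. *)
Lemma nbhs_boxP p (A : set J) :
  nbhs p A <-> exists S e, 0 < e /\ box S e p `<=` A.
Proof.
split; last first.
  move=> [S [e [e0 sub]]]; apply: filterS sub _.
  elim: S => [|v S IH]; first by apply: filterS filterT.
  have nv : nbhs p [set q : J | `|q v - p v| < e].
    apply: (nbhs_proj (A := [set r | `|r - p v| < e])).
    by apply/nbhs_ballP; exists e => //= r; rewrite /ball/= distrC.
  apply: filterS (filterI nv IH) => q [q1 q2] u; rewrite inE => /predU1P[->//|].
  exact: q2.
pose F : set_system J := [set A | exists S e, 0 < e /\ box S e p `<=` A].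
have FF : Filter F.
  split.
  - by exists [::], 1.
  - move=> B C [S [e [e0 sB]]] [S' [e' [e'0 sC]]].
    exists (S ++ S'), (Num.min e e'); split; first by rewrite lt_min e0.
    move=> q Bq; split; [apply: sB|apply: sC]; apply: box_sub Bq.
    + by move=> v vS; rewrite mem_cat vS.
    + by rewrite ge_min lexx.
    + by move=> v vS; rewrite mem_cat vS orbT.
    + by rewrite ge_min lexx orbT.
  - by move=> B C sBC [S [e [e0 sB]]]; exists S, e; split=> //; apply: subset_trans sBC.
have := (@cvg_sup _ _ (fun i : var => Topological.class
    (initial_topology (fun f : (forall i, (R : topologicalType)) => f i))) F p FF).2.
move=> H nA; apply: H nA => i B [C [[D oD DC] Cp CB]].
have : nbhs (p i) D by apply: open_nbhs_nbhs; split=> //; move: Cp; rewrite -DC.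
move/nbhs_ballP => [e /= e0 eD]; exists [:: i], e; split=> // q /(_ i).
rewrite mem_head => /(_ isT) qi; apply: CB; rewrite -DC /=.
by apply: eD; rewrite /ball/= distrC.
Qed.

Lemma openP_box O p : open O -> O p -> exists S e, 0 < e /\ box S e p `<=` O.
Proof. by move=> oO Op; apply/nbhs_boxP; apply: open_nbhs_nbhs. Qed.

Lemma box_open S e p : open (box S e p).
Proof.
rewrite openE => q Bq; elim: S Bq => [|v S IH] Bq.
  by apply/nbhs_boxP; exists [::], 1; split=> // r _ v.
have /IH nS : box S e p q by move=> u uS; apply: Bq; rewrite inE uS orbT.
have qv : `|q v - p v| < e by apply: Bq; rewrite mem_head.
have nv : nbhs q [set r : J | `|r v - p v| < e].
  apply/nbhs_boxP; exists [:: v], (e - `|q v - p v|); rewrite subr_gt0; split=> //.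
  move=> r /(_ v); rewrite mem_head => /(_ isT) rv /=.
  have := ler_normD (r v - q v) (q v - p v); rewrite addrA subrK; lra.
apply: filterS (filterI nv nS) => r [r1 r2] u; rewrite inE => /predU1P[->//|].
exact: r2.
Qed.

Lemma cont_epsP g p :
  {for p, continuous g} <->
  forall e, 0 < e -> \forall q \near p, `|g q - g p| < e.
Proof.
split.
  move=> H e e0; apply: (H [set r | `|r - g p| < e]).
  by apply/nbhs_ballP; exists e => //= r; rewrite /ball/= distrC.
move=> H A /nbhs_ballP[e /= e0 eA]; have := H e e0; apply: filterS => q qe.
by apply: eA; rewrite /ball/= distrC.
Qed.

(** Multiplying out the difference quotient removes the division and the puncture at 0, so that
    increments of composite functions can be estimated directly. *)
Lemma is_derive_epsP (h : R -> R) (t l : R) :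
  is_derive t 1 h l <->
  forall e, 0 < e -> exists d, 0 < d /\
    forall s, `|s| < d -> `|h (t + s) - h t - l * s| <= e * `|s|.
Proof.
split=> [H e e0|H].
  have [dh hl] := H.
  move: (dh) => /cvg_ex[l' Hl']; have ll' : l' = l.
    by rewrite -hl /derive; apply/esym/cvg_lim.
  rewrite {l'}ll' in Hl'.
  move/cvgrPdist_le : Hl' => /(_ e e0) /=.
  rewrite near_withinE => /nbhs_ballP[d /= d0 Hd].
  exists d; split=> // s sd.
  have [->|s0] := eqVneq s 0; first by rewrite mulr0 addr0 subrr subr0 normr0 mulr0.
  have : ball (0:R) d s by rewrite /ball/= sub0r normrN.
  move=> /Hd /(_ s0); rewrite /shift/= [s *: 1]mulr1 [s + t]addrC => Hs.
  have -> : h (t + s) - h t - l * s = - ((l - s^-1 *: (h (t + s) - h t)) * s).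
    by rewrite /GRing.scale/=; field.
  by rewrite normrN normrM ler_wpM2r.
suff C : (fun x => x^-1 *: ((h \o shift t) (x *: 1) - h t)) @ 0^' --> l.
  by split; [apply/cvg_ex; exists l|rewrite /derive; apply/cvg_lim].
apply/cvgrPdist_le => e e0; rewrite near_withinE.
have [d [d0 Hd]] := H e e0; apply/nbhs_ballP; exists d => //= s.
rewrite /ball/= sub0r normrN => sd s0.
rewrite /shift/= [s *: 1]mulr1 [s + t]addrC.
have := Hd s sd.
have -> : h (t + s) - h t - l * s = - ((l - s^-1 *: (h (t + s) - h t)) * s).
  by rewrite /GRing.scale/=; field.
by rewrite normrN normrM ler_pM2r ?normr_gt0.
Qed.

Lemma is_derive_derive1 (h : R -> R) (t l : R) : is_derive t 1 h l -> derive1 h t = l.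
Proof. by move=> H; rewrite derive1E; apply: derive_val. Qed.

Lemma derivable_is_derive (h : R -> R) (t : R) : derivable h t 1 -> is_derive t 1 h (derive1 h t).
Proof. by move=> H; rewrite derive1E; apply/derivableP. Qed.

Lemma is_derive_near (h k : R -> R) (t l : R) :
  (exists d, 0 < d /\ forall s, `|s| < d -> h (t + s) = k (t + s)) ->
  is_derive t 1 h l -> is_derive t 1 k l.
Proof.
move=> [d [d0 E]] /is_derive_epsP H; apply/is_derive_epsP => e e0.
have [d' [d'0 H']] := H e e0.
exists (Num.min d d'); split; first by rewrite lt_min d0.
move=> s; rewrite lt_min => /andP[s1 s2]; have := H' s s2.
by rewrite E// -[t in h t]addr0 E ?addr0// normr0.
Qed.

Lemma derive1_near (h k : R -> R) (t : R) :
  (exists d, 0 < d /\ forall s, `|s| < d -> h (t + s) = k (t + s)) ->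
  derive1 h t = derive1 k t.
Proof.
move=> [d [d0 E]]; rewrite !derive1E; apply: near_eq_derive.
apply/nbhs_ballP; exists d => //= s; rewrite /ball/= => sd.
have := E (s - t); rewrite (_ : t + (s - t) = s); last by ring.
by apply; rewrite distrC.
Qed.

Lemma derivable_near (h k : R -> R) (t : R) :
  (exists d, 0 < d /\ forall s, `|s| < d -> h (t + s) = k (t + s)) ->
  derivable h t 1 -> derivable k t 1.
Proof. by move=> /is_derive_near H /derivable_is_derive/H[]. Qed.

Definition finsupp O f := exists S, forall p q, O p -> O q ->
  (forall v, v \in S -> p v = q v) -> f p = f q.

Definition C1 O f :=
  (forall v p, O p -> derivable (fun t => f (upd p v t)) (p v) 1) /\
  (forall v p, O p -> {for p, continuous (pd v f)}).

Lemma updE p v t : upd p v t v = t.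
Proof. by rewrite /upd eqxx. Qed.

Lemma upd_neq p v t u : u != v -> upd p v t u = p u.
Proof. by rewrite /upd => /negbTE ->. Qed.

Lemma upd_id p v : upd p v (p v) = p.
Proof. by apply/funext => u; rewrite /upd; case: eqP => // ->. Qed.

Lemma upd_upd p v s t : upd (upd p v s) v t = upd p v t.
Proof. by apply/funext => u; rewrite /upd; case: eqP. Qed.

Lemma updC p v s u t : u != v -> upd (upd p v s) u t = upd (upd p u t) v s.
Proof.
move=> uv; apply/funext => x; rewrite /upd; case: (eqVneq x u) => // ->.
by rewrite (negbTE uv).
Qed.

Lemma pd_is_derive f p v s :
  derivable (fun t => f (upd (upd p v s) v t)) (upd p v s v) 1 ->
  is_derive s 1 (fun t => f (upd p v t)) (pd v f (upd p v s)).
Proof.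
move=> /derivable_is_derive; rewrite /pd updE.
have -> : (fun t => f (upd (upd p v s) v t)) = (fun t => f (upd p v t)) :> (R -> R).
  by apply/funext => t; rewrite upd_upd.
by [].
Qed.

Lemma is_derive_affine (h : R -> R) (a b s l : R) :
  is_derive (a + s * b) 1 h l -> is_derive s 1 (fun t => h (a + t * b)) (l * b).
Proof.
move=> /is_derive_epsP H; apply/is_derive_epsP => e e0.
have b1 : 0 < `|b| + 1 by have := normr_ge0 b; lra.
have [d [d0 Hd]] := H (e / (`|b| + 1)) (divr_gt0 e0 b1).
exists (d / (`|b| + 1)); split; first exact: divr_gt0.
move=> x; rewrite ltr_pdivlMr// => xd.
have xb : `|x * b| < d.
  apply: le_lt_trans xd; rewrite normrM ler_wpM2l//; lra.
have := Hd _ xb; rewrite (_ : a + s * b + x * b = a + (s + x) * b); last by ring.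
rewrite (_ : l * (x * b) = l * b * x); last by ring.
move=> /le_trans; apply; rewrite normrM.
have -> : e / (`|b| + 1) * (`|x| * `|b|) = (e * `|x|) * (`|b| / (`|b| + 1)) by ring.
apply: ler_piMr; first by rewrite mulr_ge0// ltW.
by rewrite ler_pdivrMr//; lra.
Qed.

Lemma mvt_upd f q v s :
  (forall r : R, 0 <= r <= 1 ->
    derivable (fun t => f (upd (upd q v (q v + r * (s - q v))) v t))
      (upd q v (q v + r * (s - q v)) v) 1) ->
  exists r : R, 0 <= r <= 1 /\
    f (upd q v s) - f q = pd v f (upd q v (q v + r * (s - q v))) * (s - q v).
Proof.
move=> H.
pose g (r : R) := f (upd q v (q v + r * (s - q v))).
pose dg (r : R) := pd v f (upd q v (q v + r * (s - q v))) * (s - q v).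
have D (r : R) : 0 <= r <= 1 -> is_derive r 1 g (dg r).
  by move=> /H /pd_is_derive; exact: is_derive_affine.
have [||r r01 E] := @MVT_segment R g dg 0 1 ler01.
- by move=> x; rewrite in_itv/= => /andP[x0 x1]; apply: D; rewrite !ltW.
- by apply: derivable_within_continuous => x; rewrite in_itv/= => /D[].
exists r; rewrite in_itv/= in r01; split=> //.
move: E; rewrite /g /dg mul1r mul0r addr0 upd_id subr0 mulr1.
by rewrite (_ : q v + (s - q v) = s); last by ring.
Qed.

Lemma box_upd S e p q v s (r : R) : 0 <= r <= 1 -> box S e p q ->
  box S e p (upd q v s) -> box S e p (upd q v (q v + r * (s - q v))).
Proof.
move=> /andP[r0 r1] Bq Bs u uS.
have [uv|uv] := eqVneq u v; last by rewrite upd_neq//; exact: Bq.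
subst v; have := Bq u uS; have := Bs u uS; rewrite !updE.
move: (q u) (p u) => a b.
rewrite !ltr_norml => /andP[h1 h2] /andP[h3 h4].
have [->|r'] := eqVneq r 0; first by rewrite mul0r addr0 h3 h4.
have {r'}r0 : 0 < r by rewrite lt_neqAle eq_sym r'.
have k1 : 0 < r * (e - (s - b)) by rewrite mulr_gt0// subr_gt0.
have k2 : 0 < r * ((s - b) + e) by rewrite mulr_gt0//; lra.
have k3 : 0 <= (1 - r) * (e - (a - b)) by rewrite mulr_ge0//; lra.
have k4 : 0 <= (1 - r) * ((a - b) + e) by rewrite mulr_ge0//; lra.
by apply/andP; split; nra.
Qed.

Definition agree S p q := forall v, v \in S -> p v = q v.

Lemma near_in_seq (T : Type) (F : set_system T) {FF : Filter F} (A : eqType) (s : seq A)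
    (P : A -> set T) :
  (forall a, a \in s -> F (P a)) -> F [set x | forall a, a \in s -> P a x].
Proof.
elim: s => [|a s IH] H; first by apply: filterS filterT.
have H1 : F (P a) by apply: H; rewrite mem_head.
have H2 : F [set x | forall a, a \in s -> P a x].
  by apply: IH => b bs; apply: H; rewrite inE bs orbT.
apply: filterS (filterI H1 H2) => x [Px Qx] b; rewrite inE => /predU1P[->//|].
exact: Qx.
Qed.

Definition mix S q p : J := fun v => if v \in S then q v else p v.

(** Continuous partial derivatives suffice: pass from [p] to [q] one coordinate at a time and apply
    the mean value theorem at each move. The finite support bounds the number of moves. *)
Lemma frechet O f p S : open O -> O p -> C1 O f -> uniq S ->
  (forall q r, O q -> O r -> agree S q r -> f q = f r) ->
  forall e, 0 < e -> \forall q \near p,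
    `|f q - f p - \sum_(v <- S) pd v f p * (q v - p v)|
      <= e * \sum_(v <- S) `|q v - p v|.
Proof.
move=> oO Op [D C] uS sup e e0.
have nO : nbhs p O by apply: open_nbhs_nbhs.
have nC : nbhs p [set q | forall v, v \in S -> `|pd v f q - pd v f p| < e].
  apply: (near_in_seq (P := fun v => [set q : J | `|pd v f q - pd v f p| < e])).
  by move=> v _; have /cont_epsP/(_ e e0) := C v p Op.
have [T [d [d0 Bsub]]] := (nbhs_boxP p _).1 (filterI nO nC).
have Bd : nbhs p (box T d p) by apply: open_nbhs_nbhs; split; [exact: box_open|exact: box_center].
apply: filterS Bd => q Bq.
have Bmix s : box T d p (mix s q p).
  by move=> v vT; rewrite /mix; case: ifP => _; [exact: Bq|rewrite subrr normr0].
have -> : f q = f (mix S q p).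
  apply: sup; [by case: (Bsub _ Bq)|by case: (Bsub _ (Bmix S))|].
  by move=> v vS; rewrite /mix vS.
(* The list [s] holds the coordinates already moved from [p] to [q]; one more coordinate adds one
   term to each of the two sums. *)
suff main s : uniq s -> {subset s <= S} ->
    `|f (mix s q p) - f p - \sum_(v <- s) pd v f p * (q v - p v)|
      <= e * \sum_(v <- s) `|q v - p v| by exact: main.
elim: s => [|v s IH] us sS.
  rewrite !big_nil subr0 (_ : mix [::] q p = p) ?subrr ?normr0 ?mulr0//.
rewrite !big_cons.
move: us => /= /andP[vs us].
have {}IH := IH us (fun x xs => sS x (mem_behead (s := v :: s) xs)).
have mE : mix (v :: s) q p = upd (mix s q p) v (q v).
  by apply/funext => u; rewrite /mix /upd inE; case: eqP => [->|].
have mv : mix s q p v = p v by rewrite /mix (negbTE vs).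
have Bseg r : 0 <= r <= 1 ->
    box T d p (upd (mix s q p) v (mix s q p v + r * (q v - mix s q p v))).
  by move=> r01; apply: box_upd => //; rewrite -mE.
have [|r [r01 E]] := @mvt_upd f (mix s q p) v (q v).
  by move=> r r01; apply: D; case: (Bsub _ (Bseg r r01)).
have [_ /(_ v (sS v (mem_head _ _)))] := Bsub _ (Bseg r r01).
set xi := upd (mix s q p) v (mix s q p v + _) in E *.
rewrite mE mv in E * => xie.
set A := \sum_(j <- s) _ in IH *; set B := \sum_(j <- s) _ in IH *.
rewrite (_ : f (upd (mix s q p) v (q v)) = pd v f xi * (q v - p v) + f (mix s q p)); last first.
  by rewrite -E subrK.
rewrite (_ : _ - _ - _ = (pd v f xi - pd v f p) * (q v - p v) + (f (mix s q p) - f p - A)); last by ring.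
apply: le_trans (ler_normD _ _) _; rewrite [leRHS]mulrDr; apply: lerD => //.
by rewrite normrM ler_wpM2r// ltW.
Qed.

Lemma curve_near (c : R -> J) (t0 : R) (d : J) (A : set J) :
  (forall v, is_derive t0 1 (fun t => c t v) (d v)) -> nbhs (c t0) A ->
  exists x, 0 < x /\ forall h, `|h| < x -> A (c (t0 + h)).
Proof.
move=> H /nbhs_boxP[S [e [e0 sub]]].
suff : nbhs (0:R) [set h | forall v, v \in S -> `|c (t0 + h) v - c t0 v| < e].
  move=> /nbhs_ballP[x /= x0 Hx]; exists x; split=> // h hx; apply: sub.
  by apply: Hx; rewrite /ball/= sub0r normrN.
apply: (near_in_seq (P := fun v => [set h | `|c (t0 + h) v - c t0 v| < e])) => v _.
have [x [x0 Hx]] := (is_derive_epsP _ _ _).1 (H v) 1 ltr01.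
have K0 : 0 < `|d v| + 1 by have := normr_ge0 (d v); lra.
apply/nbhs_ballP; exists (Num.min x (e / (`|d v| + 1))) => /=.
  by rewrite lt_min x0 divr_gt0.
move=> h; rewrite /ball/= sub0r normrN lt_min ltr_pdivlMr// => /andP[hx he].
have := Hx h hx; rewrite mul1r => H1.
have := ler_normD (c (t0 + h) v - c t0 v - d v * h) (d v * h).
rewrite subrK normrM; lra.
Qed.

Lemma curve_lip (c : R -> J) (t0 : R) (d : J) S :
  (forall v, is_derive t0 1 (fun t => c t v) (d v)) ->
  exists x, 0 < x /\ forall h, `|h| < x ->
    \sum_(v <- S) `|c (t0 + h) v - c t0 v| <= \sum_(v <- S) (`|d v| + 1) * `|h|.
Proof.
move=> H; suff : nbhs (0:R) [set h | forall v, v \in S ->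
    `|c (t0 + h) v - c t0 v| <= (`|d v| + 1) * `|h|].
  move=> /nbhs_ballP[x /= x0 Hx]; exists x; split=> // h hx.
  rewrite big_seq [leRHS]big_seq; apply: ler_sum => v vS; apply: (Hx _ _ v vS).
  by rewrite /ball/= sub0r normrN.
apply: (near_in_seq (P := fun v => [set h |
    `|c (t0 + h) v - c t0 v| <= (`|d v| + 1) * `|h|])) => v _.
have [x [x0 Hx]] := (is_derive_epsP _ _ _).1 (H v) 1 ltr01.
apply/nbhs_ballP; exists x => //= h; rewrite /ball/= sub0r normrN => hx.
have := Hx h hx; rewrite mul1r => H1.
have := ler_normD (c (t0 + h) v - c t0 v - d v * h) (d v * h).
rewrite subrK normrM; lra.
Qed.

Lemma is_derive_sumr (I : Type) (s : seq I) (h : I -> R -> R) (t : R) (l : I -> R) :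
  (forall i, is_derive t 1 (h i) (l i)) ->
  is_derive t 1 (fun x => \sum_(i <- s) h i x) (\sum_(i <- s) l i).
Proof.
move=> H; elim: s => [|i s IH].
  rewrite big_nil (_ : (fun x => _) = cst 0); first exact: is_derive_cst.
  by apply/funext => x; rewrite big_nil.
rewrite big_cons (_ : (fun x => _) = h i \+ (fun x => \sum_(i <- s) h i x)).
  exact: is_deriveD.
by apply/funext => x; rewrite big_cons.
Qed.

Lemma chain_rule O f (c : R -> J) (t0 : R) (d : J) S : open O -> O (c t0) -> C1 O f ->
  uniq S -> (forall q r, O q -> O r -> agree S q r -> f q = f r) ->
  (forall v, is_derive t0 1 (fun t => c t v) (d v)) ->
  is_derive t0 1 (fun t => f (c t)) (\sum_(v <- S) pd v f (c t0) * d v).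
Proof.
move=> oO Oc Cf uS sup H.
pose lin t := \sum_(v <- S) pd v f (c t0) * c t v.
have Dlin : is_derive t0 1 lin (\sum_(v <- S) pd v f (c t0) * d v).
  apply: is_derive_sumr => v; exact: (@is_deriveZ _ _ _ _ (pd v f (c t0))).
suff D0 : is_derive t0 1 (fun t => f (c t) - lin t) 0.
  have := is_deriveD D0 Dlin; rewrite add0r.
  rewrite (_ : (fun t => f (c t) - lin t) + lin = (fun t => f (c t)))//.
  by apply/funext => t; rewrite /GRing.add/= subrK.
apply/is_derive_epsP => e e0.
(* [K] dominates the Lipschitz constants of the coordinates of the curve near [t0]; the final 1
   keeps it positive when [S] is empty. *)
pose K := \sum_(v <- S) (`|d v| + 1) + 1.
have K0 : 0 < K.
  by rewrite /K ltr_wpDl// sumr_ge0// => v _; have := normr_ge0 (d v); lra.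
have [x [x0 Hx]] := curve_near H (frechet oO Oc Cf uS sup (divr_gt0 e0 K0)).
have [y [y0 Hy]] := curve_lip S H.
exists (Num.min x y); split; first by rewrite lt_min x0.
move=> h; rewrite lt_min => /andP[hx hy]; rewrite mul0r subr0.
have -> : f (c (t0 + h)) - lin (t0 + h) - (f (c t0) - lin t0) =
    f (c (t0 + h)) - f (c t0) - \sum_(v <- S) pd v f (c t0) * (c (t0 + h) v - c t0 v).
  under eq_bigr do rewrite mulrBr; rewrite sumrB /lin; ring.
apply: le_trans (Hx h hx) _.
apply: (@le_trans _ _ (e / K * (\sum_(v <- S) (`|d v| + 1) * `|h|))).
  by rewrite ler_wpM2l ?Hy// ltW// divr_gt0.
rewrite -mulr_suml mulrA ler_wpM2r// mulrAC ler_pdivrMr// ler_wpM2l ?(ltW e0)//.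
by rewrite /K lerDl.
Qed.

End Calculus.

(** * Locality and coinduction for smooth functions, symmetry of second derivatives *)

Section Smooth.
Variable R : realType.
Local Notation J := (J R).
Implicit Types (f g : J -> R) (p q : J) (v : var) (S : seq var) (O : set J).

Lemma upd_line_is_derive p v (s : R) u :
  is_derive s 1 (fun t => upd p v t u) (if u == v then 1 else 0).
Proof.
rewrite /upd; case: (u == v); first exact: is_derive_id.
exact: is_derive_cst.
Qed.

Lemma upd_near p v (A : set J) : nbhs p A ->
  exists d, 0 < d /\ forall s, `|s| < d -> A (upd p v (p v + s)).
Proof.
move=> nA.
apply: (curve_near (c := upd p v) (d := fun u => if u == v then 1 else 0)).
  by move=> u; apply: upd_line_is_derive.
by rewrite upd_id.
Qed.

Lemma pd_near f g p v : (\forall q \near p, f q = g q) -> pd v f p = pd v g p.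
Proof. by move=> /upd_near H; apply: derive1_near; exact: H. Qed.

Lemma derivable_upd_near f g p v : (\forall q \near p, f q = g q) ->
  derivable (fun t => f (upd p v t)) (p v) 1 ->
  derivable (fun t => g (upd p v t)) (p v) 1.
Proof. by move=> /upd_near H; apply: derivable_near; exact: H. Qed.

Lemma cont_near f g p : (\forall q \near p, f q = g q) ->
  {for p, continuous f} -> {for p, continuous g}.
Proof.
move=> E /cont_epsP H; apply/cont_epsP => e e0.
have E0 := nbhs_singleton E.
by apply: filterS (filterI E (H e e0)) => q [/= <- ]; rewrite E0.
Qed.

Lemma open_near O f g p : open O -> O p -> (forall q, O q -> f q = g q) ->
  \forall q \near p, f q = g q.
Proof.
by move=> oO Op E; apply: filterS E _; apply: open_nbhs_nbhs.
Qed.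

Lemma supp_pd O f v S : open O -> v \in S ->
  (forall q r, O q -> O r -> agree S q r -> f q = f r) ->
  (forall q r, O q -> O r -> agree S q r -> pd v f q = pd v f r).
Proof.
move=> oO vS sup p q Op Oq A; rewrite /pd (A v vS); apply: derive1_near.
have [d [d0 Hd]] := upd_near v (open_nbhs_nbhs (conj oO Op)).
have [e [e0 He]] := upd_near v (open_nbhs_nbhs (conj oO Oq)).
exists (Num.min d e); split; first by rewrite lt_min d0.
move=> s; rewrite lt_min => /andP[sd se]; apply: sup; [|exact: He|].
  by rewrite -(A v vS); exact: Hd.
by move=> u uS; rewrite /upd; case: eqP => // _; exact: A.
Qed.

Lemma finsupp_pd O f v : open O -> finsupp O f -> finsupp O (pd v f).
Proof.
move=> oO [S HS]; exists (v :: S); apply: supp_pd => //; first exact: mem_head.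
by move=> q r Oq Or A; apply: HS => // u uS; apply: A; rewrite inE uS orbT.
Qed.

Lemma finsupp_uniq O f : finsupp O f -> exists S, uniq S /\
  forall q r, O q -> O r -> agree S q r -> f q = f r.
Proof.
move=> [S H]; exists (undup S); split; first exact: undup_uniq.
move=> q r Oq Or A; apply: H => // v vS; apply: A; by rewrite mem_undup.
Qed.

Lemma smooth_finsupp O f : diff_fun O f -> finsupp O f.
Proof. by case. Qed.

Lemma smooth_cont O f p : diff_fun O f -> O p -> {for p, continuous f}.
Proof. by move=> [_ [_ /(_ [::])]]; apply. Qed.

Lemma smooth_derivable O f p v : diff_fun O f -> O p ->
  derivable (fun t => f (upd p v t)) (p v) 1.
Proof. by move=> [_ [/(_ [::] v p)]]. Qed.

Lemma smooth_pd O f v : open O -> diff_fun O f -> diff_fun O (pd v f).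
Proof.
move=> oO [fs [D C]]; split; first exact: finsupp_pd.
have E vs : iterpd vs (pd v f) = iterpd (rcons vs v) f.
  by rewrite /iterpd foldr_rcons.
by split=> [vs u p Op|vs p Op]; rewrite E; [exact: D|exact: C].
Qed.

Lemma smooth_C1 O f : open O -> diff_fun O f -> C1 O f.
Proof.
move=> oO sf; split=> v p Op; first exact: smooth_derivable sf Op.
exact: smooth_cont (smooth_pd v oO sf) Op.
Qed.

(** A partial derivative at a point sees only a neighbourhood, so it is enough that it agrees on the
    open set [O] with some member of [K]; by induction every iterated derivative then agrees on [O]
    with a member of [K]. *)
Lemma diff_fun_coind O (K : (J -> R) -> Prop) f : open O ->
  (forall g, K g -> [/\ finsupp O g, forall p, O p -> {for p, continuous g},
     forall v p, O p -> derivable (fun t => g (upd p v t)) (p v) 1 &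
     forall v, exists h, K h /\ forall p, O p -> pd v g p = h p]) ->
  K f -> diff_fun O f.
Proof.
move=> oO HK Kf.
have it vs : exists h, K h /\ forall p, O p -> iterpd vs f p = h p.
  elim: vs => [|v vs [h [Kh E]]]; first by exists f.
  have [_ _ _ /(_ v)[k [Kk Ek]]] := HK _ Kh.
  exists k; split=> // p Op; rewrite -Ek//=; apply: pd_near.
  exact: open_near E.
split; first by case: (HK _ Kf).
split=> [vs v p Op|vs p Op].
  have [h [Kh E]] := it vs; have [_ _ Dh _] := HK _ Kh.
  apply: derivable_upd_near (Dh v p Op).
  by apply: (open_near oO Op) => q Oq; rewrite E.
have [h [Kh E]] := it vs; have [_ Ch _ _] := HK _ Kh.
apply: cont_near (Ch p Op).
by apply: (open_near oO Op) => q Oq; rewrite E.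
Qed.

Lemma smooth_eq O f g : open O -> (forall p, O p -> f p = g p) ->
  diff_fun O f -> diff_fun O g.
Proof.
move=> oO E sf; pose K h := exists k, diff_fun O k /\ forall p, O p -> k p = h p.
apply: (@diff_fun_coind _ K) => //; last by exists f.
move=> h [k [sk Ek]]; split.
- have [S HS] := smooth_finsupp sk; exists S => p q Op Oq A.
  by rewrite -!Ek//; apply: HS.
- by move=> p Op; apply: cont_near (smooth_cont sk Op); apply: open_near Ek.
- move=> v p Op; refine (@derivable_upd_near k h p v _ (smooth_derivable sk Op)).
  exact: open_near Ek.
- move=> v; exists (pd v k); split; first by exists (pd v k); split=> //; apply: smooth_pd.
  by move=> p Op; apply/esym/pd_near; apply: open_near Ek.
Qed.

Lemma smooth_sub O V f : open O -> open V -> V `<=` O -> diff_fun O f -> diff_fun V f.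
Proof.
move=> oO oV VO sf; apply: (@diff_fun_coind _ (diff_fun O)) => //.
move=> h sh; split.
- have [S HS] := smooth_finsupp sh; exists S => p q Vp Vq A.
  by apply: HS => //; exact: VO.
- by move=> p /VO Op; exact: smooth_cont Op.
- by move=> v p /VO Op; exact: smooth_derivable Op.
- by move=> v; exists (pd v h); split=> //; exact: smooth_pd.
Qed.

Lemma is_derive_pd O f p v s : diff_fun O f -> O (upd p v s) ->
  is_derive s 1 (fun t => f (upd p v t)) (pd v f (upd p v s)).
Proof. by move=> sf Op; apply: pd_is_derive; exact: smooth_derivable sf Op. Qed.

Lemma dist_close (x y z e : R) : `|x - y| < e / 2 -> `|x - z| < e / 2 -> `|y - z| <= e.
Proof.
rewrite !ltr_norml ler_norml => /andP[x1 x2] /andP[x3 x4].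
by apply/andP; split; lra.
Qed.

(** The second difference [W] over a small square at [p] is evaluated by the mean value theorem in
    both orders. This gives the two mixed derivatives at two points of the square, and continuity at
    [p] makes them arbitrarily close. *)
Lemma schwarz O f p u v : open O -> diff_fun O f -> O p ->
  pd u (pd v f) p = pd v (pd u f) p.
Proof.
move=> oO sf Op; have [->//|uv] := eqVneq u v.
have vu : v != u by rewrite eq_sym.
have su := smooth_pd u oO sf; have sv := smooth_pd v oO sf.
have suv := smooth_pd u oO sv; have svu := smooth_pd v oO su.
apply/eqP; rewrite -subr_eq0 -normr_le0; apply/ler_addgt0Pl => e e0; rewrite addr0.
have e2 : 0 < e / 2 by lra.
have n1 := (cont_epsP _ _).1 (smooth_cont suv Op) _ e2.
have n2 := (cont_epsP _ _).1 (smooth_cont svu Op) _ e2.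
have nO : nbhs p O by apply: open_nbhs_nbhs.
have [S [d [d0 B]]] := (nbhs_boxP p _).1 (filterI nO (filterI n1 n2)).
pose h := d / 2; have h0 : 0 < h by rewrite /h; lra.
have hd : h < d by rewrite /h; lra.
pose pt (a b : R) : J := upd (upd p u (p u + a * h)) v (p v + b * h).
have ptE (a b : R) : pt a b = upd (upd p v (p v + b * h)) u (p u + a * h).
  by rewrite /pt updC.
have Bpt (a b : R) : 0 <= a <= 1 -> 0 <= b <= 1 -> box S d p (pt a b).
  move=> /andP[a0 D1_field] /andP[b0 b1] x _; rewrite /pt /upd.
  have ah : a * h <= h by rewrite ler_piMl// ltW.
  have bh : b * h <= h by rewrite ler_piMl// ltW.
  have ah0 : 0 <= a * h by rewrite mulr_ge0// ltW.
  have bh0 : 0 <= b * h by rewrite mulr_ge0// ltW.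
  case: eqP => [->|_]; last case: eqP => [->|_]; last by rewrite subrr normr0.
    by rewrite addrAC subrr add0r ger0_norm//; lra.
  by rewrite addrAC subrr add0r ger0_norm//; lra.
have Opt (a b : R) : 0 <= a <= 1 -> 0 <= b <= 1 -> O (pt a b).
  by move=> ha hb; case: (B _ (Bpt a b ha hb)).
have z01 : (0:R) <= (0:R) <= (1:R) by rewrite lexx ler01.
have o01 : (0:R) <= (1:R) <= (1:R) by rewrite lexx ler01.
have Du g (a b : R) : diff_fun O g -> 0 <= a <= 1 -> 0 <= b <= 1 ->
    is_derive a 1 (fun t => g (pt t b)) (pd u g (pt a b) * h).
  move=> sg ha hb; rewrite ptE.
  have := @is_derive_affine R (fun t => g (upd (upd p v (p v + b * h)) u t)) (p u) h a
    (pd u g (upd (upd p v (p v + b * h)) u (p u + a * h))).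
  move=> H; have := H (is_derive_pd sg _); rewrite -ptE => /(_ (Opt a b ha hb)).
  by rewrite (_ : (fun t => _) = (fun t => g (pt t b)))//; apply/funext => t; rewrite ptE.
have Dv g (a b : R) : diff_fun O g -> 0 <= a <= 1 -> 0 <= b <= 1 ->
    is_derive b 1 (fun t => g (pt a t)) (pd v g (pt a b) * h).
  move=> sg ha hb.
  have := @is_derive_affine R (fun t => g (upd (upd p u (p u + a * h)) v t)) (p v) h b
    (pd v g (upd (upd p u (p u + a * h)) v (p v + b * h))).
  by move=> H; apply: H; apply: is_derive_pd sg _; exact: Opt.
have mvt (k dk : R -> R) : (forall t : R, 0 <= t <= 1 -> is_derive t 1 k (dk t)) ->
    exists t : R, 0 <= t <= 1 /\ k 1 - k 0 = dk t.
  move=> D; have [||t t01 E] := @MVT_segment R k dk 0 1 ler01.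
  - by move=> x; rewrite in_itv/= => /andP[x0 x1]; apply: D; rewrite !ltW.
  - by apply: derivable_within_continuous => x; rewrite in_itv/= => /D[].
  by exists t; rewrite in_itv/= in t01; split=> //; rewrite E subr0 mulr1.
pose W := f (pt 1 1) - f (pt 1 0) - (f (pt 0 1) - f (pt 0 0)).
have [a [ha Ea]] : exists a : R, 0 <= a <= 1 /\
    W = (pd u f (pt a 1) - pd u f (pt a 0)) * h.
  have [|a [ha E]] := mvt (fun a => f (pt a 1) - f (pt a 0))
     (fun a => pd u f (pt a 1) * h - pd u f (pt a 0) * h).
    by move=> t t01; apply: is_deriveB; apply: Du.
  by exists a; split; [exact: ha|rewrite mulrBl -E].
have [b [hb Eb]] : exists b : R, 0 <= b <= 1 /\
    W = pd v (pd u f) (pt a b) * h * h.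
  have [|b [hb E]] := mvt (fun b => pd u f (pt a b)) (fun b => pd v (pd u f) (pt a b) * h).
    by move=> t t01; apply: Dv.
  by exists b; split; [exact: hb|rewrite Ea; congr (_ * h); exact: E].
have [b' [hb' Eb']] : exists b : R, 0 <= b <= 1 /\
    W = (pd v f (pt 1 b) - pd v f (pt 0 b)) * h.
  have [|b' [hb' E]] := mvt (fun b => f (pt 1 b) - f (pt 0 b))
     (fun b => pd v f (pt 1 b) * h - pd v f (pt 0 b) * h).
    by move=> t t01; apply: is_deriveB; apply: Dv.
  by exists b'; split; [exact: hb'|rewrite mulrBl -E /W; ring].
clearbody W.
have [a' [ha' Ea']] : exists a : R, 0 <= a <= 1 /\
    W = pd u (pd v f) (pt a b') * h * h.
  have [|a' [ha' E]] := mvt (fun a => pd v f (pt a b')) (fun a => pd u (pd v f) (pt a b') * h).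
    by move=> t t01; apply: Du.
  by exists a'; split; [exact: ha'|rewrite Eb'; congr (_ * h); exact: E].
have D1_D2_E_field : pd u (pd v f) (pt a' b') = pd v (pd u f) (pt a b).
  have hn0 : h != 0 by apply: lt0r_neq0.
  exact: (mulIf hn0 (mulIf hn0 (etrans (esym Ea') Eb))).
have [_ [c1 _]] := B _ (Bpt _ _ ha' hb').
have [_ [_ c2]] := B _ (Bpt _ _ ha hb).
rewrite D1_D2_E_field /= in c1; rewrite /= in c2.
exact: dist_close c1 c2.
Qed.

End Smooth.

(** * Smooth functions, vector fields and brackets *)

Section Rules.
Variable R : realType.
Implicit Types (h k : R -> R) (t a b c : R).

Lemma is_derive_addr h k t a b : is_derive t 1 h a -> is_derive t 1 k b ->
  is_derive t 1 (fun x => h x + k x) (a + b).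
Proof. by move=> H K; exact: is_deriveD. Qed.

Lemma is_derive_oppr h t a : is_derive t 1 h a -> is_derive t 1 (fun x => - h x) (- a).
Proof. by move=> H; exact: is_deriveN. Qed.

Lemma is_derive_mulr h k t a b : is_derive t 1 h a -> is_derive t 1 k b ->
  is_derive t 1 (fun x => h x * k x) (a * k t + h t * b).
Proof.
move=> H K; have := is_deriveM H K.
by rewrite /GRing.scale/= addrC [k t * a]mulrC.
Qed.

Lemma is_derive_constr c t : is_derive t 1 (fun=> c) 0.
Proof. exact: is_derive_cst. Qed.

Lemma is_derive_exprn h t a n : is_derive t 1 h a ->
  is_derive t 1 (fun x => h x ^+ n) (n%:R * h t ^+ n.-1 * a).
Proof.
move=> H; elim: n => [|n IH].
  rewrite (_ : (fun x => _) = fun=> 1); first by rewrite !mul0r; exact: is_derive_constr.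
  by apply/funext => x; rewrite expr0.
rewrite (_ : (fun x => _) = fun x => h x * h x ^+ n); last first.
  by apply/funext => x; rewrite exprS.
apply: is_derive_eq (is_derive_mulr H IH) _.
by case: n {IH} => [|n]; rewrite ?expr0 -?natr1 ?exprS /=; ring.
Qed.

Lemma is_derive_invr h t a : h t != 0 -> is_derive t 1 h a ->
  is_derive t 1 (fun x => (h x)^-1) (- a / h t ^+ 2).
Proof.
move=> h0 H; have := is_deriveV h0 H.
by rewrite /GRing.scale/= mulNr mulrC -mulNr.
Qed.

End Rules.

Section Smooth2.
Variable R : realType.
Local Notation J := (J R).
Implicit Types (f g : J -> R) (p q : J) (u v : var) (S : seq var) (O U : set J).

Lemma pd_eq f p v l : is_derive (p v) 1 (fun t => f (upd p v t)) l -> pd v f p = l.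
Proof. exact: is_derive_derive1. Qed.

Lemma pd_cst v (c : R) p : pd v (fun=> c) p = 0.
Proof. by apply: pd_eq; exact: is_derive_constr. Qed.

Lemma pd_coord v u p : pd v (fun q => q u) p = if u == v then 1 else 0.
Proof. by apply: pd_eq; apply: upd_line_is_derive. Qed.

Lemma cont_coord u p : {for p, continuous (fun q : J => q u)}.
Proof.
apply/cont_epsP => e e0; apply/nbhs_boxP; exists [:: u], e; split=> // q; apply.
by rewrite mem_head.
Qed.

Lemma smooth_basic O f : open O -> (exists c : R, f = fun=> c) \/ (exists u, f = fun q => q u) ->
  diff_fun O f.
Proof.
move=> oO H.
apply: (@diff_fun_coind _ _ (fun f => (exists c : R, f = fun=> c) \/ (exists u, f = fun q => q u))) H => //.
move=> g [[c ->]|[u ->]]; split.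
- by exists [::].
- by move=> p _; apply/cont_epsP => e e0; apply/nbhs_boxP; exists [::], 1; split=> // q _ /=; rewrite subrr normr0.
- by move=> v p _; have [] := @is_derive_constr R c (p v).
- by move=> v; exists (fun=> 0); split; [left; exists 0|move=> p _; exact: pd_cst].
- by exists [:: u] => p q _ _; apply; rewrite mem_head.
- by move=> p _; exact: cont_coord.
- by move=> v p _; have [] := @upd_line_is_derive R p v (p v) u.
- move=> v; exists (fun=> if u == v then 1 else 0); split; first by left; eexists.
  by move=> p _; exact: pd_coord.
Qed.

Lemma smooth_cst O (c : R) : open O -> diff_fun O (fun=> c).
Proof. by move=> oO; apply: smooth_basic => //; left; exists c. Qed.

Lemma smooth_coord O v : open O -> diff_fun O (fun q => q v).
Proof. by move=> oO; apply: smooth_basic => //; right; exists v. Qed.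

(** All operations are closed up at once because their derivatives mix them: the derivative of a
    composition is a sum of products of compositions, that of an inverse a product of inverses.
    Coinduction on this class yields smoothness without formulas for higher derivatives. *)
Inductive alg_closure O : (J -> R) -> Prop :=
| AC_base f : diff_fun O f -> alg_closure O f
| AC_add f g : alg_closure O f -> alg_closure O g -> alg_closure O (fun p => f p + g p)
| AC_mul f g : alg_closure O f -> alg_closure O g -> alg_closure O (fun p => f p * g p)
| AC_inv f : (forall p, O p -> f p != 0) -> alg_closure O f ->
    alg_closure O (fun p => (f p)^-1)
| AC_comp U g (Phi : J -> J) : open U -> (forall p, O p -> U (Phi p)) ->
    (forall v, alg_closure O (fun p => Phi p v)) -> diff_fun U g ->
    alg_closure O (fun p => g (Phi p)).

Lemma cont_real (h : R -> R) f p : {for f p, continuous h} -> {for p, continuous f} ->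
  {for p, continuous (fun q => h (f q))}.
Proof. by move=> ch cf A /ch /cf. Qed.

Lemma cont_comp g (Phi : J -> J) p : {for Phi p, continuous g} ->
  (forall v, {for p, continuous (fun q => Phi q v)}) ->
  {for p, continuous (fun q => g (Phi q))}.
Proof.
move=> cg cP A /cg /nbhs_boxP[S [e [e0 sub]]].
have : nbhs p [set q | forall v, v \in S -> `|Phi q v - Phi p v| < e].
  apply: (near_in_seq (P := fun v => [set q | `|Phi q v - Phi p v| < e])) => v _.
  exact: ((cont_epsP _ _).1 (cP v) e e0).
by apply: filterS => q Hq; apply: sub.
Qed.

Lemma contD f g p : {for p, continuous f} -> {for p, continuous g} ->
  {for p, continuous (fun q => f q + g q)}.
Proof.
move=> /cont_epsP cf /cont_epsP cg; apply/cont_epsP => e e0.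
have e2 : 0 < e / 2 by lra.
apply: filterS (filterI (cf _ e2) (cg _ e2)) => q [/= h1 h2].
rewrite (_ : _ - _ = (f q - f p) + (g q - g p)); last by ring.
by apply: le_lt_trans (ler_normD _ _) _; lra.
Qed.

Lemma contZ (k : R) f p : {for p, continuous f} -> {for p, continuous (fun q => k * f q)}.
Proof.
move=> /cont_epsP cf; apply/cont_epsP => e e0.
have k0 : 0 < `|k| + 1 by have := normr_ge0 k; lra.
apply: filterS (cf _ (divr_gt0 e0 k0)) => q /=; rewrite ltr_pdivlMr// => H.
rewrite -mulrBr normrM; apply: le_lt_trans H; rewrite mulrC ler_wpM2l//; lra.
Qed.

Lemma contM f g p : {for p, continuous f} -> {for p, continuous g} ->
  {for p, continuous (fun q => f q * g q)}.
Proof.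
move=> cf cg.
have sq (h : J -> R) : {for p, continuous h} -> {for p, continuous (fun q => h q ^+ 2)}.
  by move=> ch; apply: (@cont_real (fun x => x ^+ 2)) => //; exact: exprn_continuous.
(* Polarization reduces products to squares, that is, to a continuous function of one real
   variable. *)
have -> : (fun q => f q * g q) =
    (fun q => 2^-1 * ((f q + g q) ^+ 2 + (-1 * (f q ^+ 2 + g q ^+ 2)))).
  by apply/funext => q; field.
by apply: contZ; apply: contD; [apply/sq/contD|apply/contZ/contD; exact: sq].
Qed.

Lemma contV f p : f p != 0 -> {for p, continuous f} ->
  {for p, continuous (fun q => (f q)^-1)}.
Proof.
move=> f0 cf; apply: (@cont_real (fun x => x^-1)) => //; exact: inv_continuous.
Qed.

Lemma AC_sum O (s : seq var) (F : var -> J -> R) : open O ->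
  (forall v, alg_closure O (F v)) -> alg_closure O (fun p => \sum_(v <- s) F v p).
Proof.
move=> oO H; elim: s => [|v s IH].
  rewrite (_ : (fun p => _) = fun=> 0); first exact/AC_base/smooth_cst.
  by apply/funext => p; rewrite big_nil.
rewrite (_ : (fun p => _) = fun p => F v p + \sum_(v <- s) F v p); first exact: AC_add.
by apply/funext => p; rewrite big_cons.
Qed.

Lemma finsupp2 O f g : finsupp O f -> finsupp O g -> exists S,
  (forall p q, O p -> O q -> agree S p q -> f p = f q) /\
  (forall p q, O p -> O q -> agree S p q -> g p = g q).
Proof.
move=> [S HS] [T HT]; exists (S ++ T); split=> p q Op Oq A; [apply: HS|apply: HT] => //.
  by move=> v vS; apply: A; rewrite mem_cat vS.
by move=> v vS; apply: A; rewrite mem_cat vS orbT.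
Qed.

Lemma alg_closureP O f : open O -> alg_closure O f ->
  [/\ finsupp O f, forall p, O p -> {for p, continuous f},
     forall v p, O p -> derivable (fun t => f (upd p v t)) (p v) 1 &
     forall v, exists h, alg_closure O h /\ forall p, O p -> pd v f p = h p].
Proof.
move=> oO; elim => {f}.
- move=> f sf; split.
  + exact: smooth_finsupp.
  + by move=> p; exact: smooth_cont.
  + by move=> v p; exact: smooth_derivable.
  + by move=> v; exists (pd v f); split=> //; apply/AC_base/smooth_pd.
- move=> f g af [Sf Cf Df Pf] ag [Sg Cg Dg Pg].
  have D v p : O p -> is_derive (p v) 1 (fun t => f (upd p v t) + g (upd p v t))
      (pd v f p + pd v g p).
    by move=> Op; apply: is_derive_addr; apply: derivable_is_derive; [exact: Df|exact: Dg].
  split.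
  + have [S [H1 H2]] := finsupp2 Sf Sg; exists S => p q Op Oq A.
    by rewrite (H1 p q)// (H2 p q).
  + by move=> p Op; apply: contD; [exact: Cf|exact: Cg].
  + by move=> v p /(D v)[].
  + move=> v; have [h [ah Eh]] := Pf v; have [k [ak Ek]] := Pg v.
    exists (fun p => h p + k p); split; first exact: AC_add.
    by move=> p Op; rewrite (pd_eq (D v p Op)) Eh// Ek.
- move=> f g af [Sf Cf Df Pf] ag [Sg Cg Dg Pg].
  have D v p : O p -> is_derive (p v) 1 (fun t => f (upd p v t) * g (upd p v t))
      (pd v f p * g p + f p * pd v g p).
    move=> Op; have := is_derive_mulr (derivable_is_derive (Df v p Op)) (derivable_is_derive (Dg v p Op)).
    by rewrite upd_id.
  split.
  + have [S [H1 H2]] := finsupp2 Sf Sg; exists S => p q Op Oq A.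
    by rewrite (H1 p q)// (H2 p q).
  + by move=> p Op; apply: contM; [exact: Cf|exact: Cg].
  + by move=> v p /(D v)[].
  + move=> v; have [h [ah Eh]] := Pf v; have [k [ak Ek]] := Pg v.
    exists (fun p => h p * g p + f p * k p); split.
      by apply: AC_add; apply: AC_mul.
    by move=> p Op; rewrite (pd_eq (D v p Op)) Eh// Ek.
- move=> f f0 af [Sf Cf Df Pf].
  have D v p : O p -> is_derive (p v) 1 (fun t => (f (upd p v t))^-1)
      (- pd v f p / f p ^+ 2).
    move=> Op; have := is_derive_invr _ (derivable_is_derive (Df v p Op)).
    by rewrite upd_id; apply; exact: f0.
  split.
  + by have [S HS] := Sf; exists S => p q Op Oq A; rewrite (HS p q).
  + by move=> p Op; apply: contV; [exact: f0|exact: Cf].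
  + by move=> v p /(D v)[].
  + move=> v; have [h [ah Eh]] := Pf v.
    exists (fun p => (-1) * h p * ((f p)^-1 * (f p)^-1)); split.
      apply: AC_mul; apply: AC_mul => //; try exact: AC_inv.
      exact/AC_base/smooth_cst.
    by move=> p Op; rewrite (pd_eq (D v p Op)) Eh// expr2 invfM mulN1r.
- move=> U g Phi oU OU aP IH sg.
  have [S [uS sup]] := finsupp_uniq (smooth_finsupp sg).
  have D v p : O p -> is_derive (p v) 1 (fun t => g (Phi (upd p v t)))
      (\sum_(u <- S) pd u g (Phi p) * pd v (fun q => Phi q u) p).
    move=> Op; have := @chain_rule R U g (fun t => Phi (upd p v t)) (p v)
      (fun u => pd v (fun q => Phi q u) p) S oU.
    rewrite upd_id; apply => //; [exact: OU|exact: smooth_C1|].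
    by move=> u; apply: derivable_is_derive; have [_ _ Du _] := IH u; exact: Du.
  split.
  + have [T HT] : exists T, forall v, v \in S -> forall p q, O p -> O q ->
        agree T p q -> Phi p v = Phi q v.
      elim: (S) => [|v s [T HT]]; first by exists [::].
      have [[T' HT'] _ _ _] := IH v; exists (T' ++ T) => x xs p q Op Oq A.
      move: xs; rewrite inE => /predU1P[->|xs].
        by apply: HT' => // u uT; apply: A; rewrite mem_cat uT.
      by apply: HT => // u uT; apply: A; rewrite mem_cat uT orbT.
    exists T => p q Op Oq A; apply: sup; [exact: OU|exact: OU|].
    by move=> v vS; apply: HT.
  + move=> p Op; apply: cont_comp; first exact: smooth_cont (OU p Op).
    by move=> v; have [_ Cv _ _] := IH v; exact: Cv.
  + by move=> v p /(D v)[].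
  + move=> v; have /choice[h Hh] : forall u, exists h, alg_closure O h /\
        forall p, O p -> pd v (fun q => Phi q u) p = h p.
      by move=> u; have [_ _ _ /(_ v)] := IH u.
    exists (fun p => \sum_(u <- S) pd u g (Phi p) * h u p); split.
      apply: (@AC_sum O S (fun u p => pd u g (Phi p) * h u p)) => // u.
      by apply: AC_mul; [apply: AC_comp (smooth_pd u oU sg)|case: (Hh u)].
    move=> p Op; rewrite (pd_eq (D v p Op)); apply: eq_bigr => u _.
    by have [_ ->] := Hh u.
Qed.

Lemma alg_closure_smooth O f : open O -> alg_closure O f -> diff_fun O f.
Proof. by move=> oO; apply: diff_fun_coind => // g; exact: alg_closureP. Qed.

Section Closure.
Variable O : set J.
Hypothesis oO : open O.

Lemma smoothD f g : diff_fun O f -> diff_fun O g -> diff_fun O (fun p => f p + g p).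
Proof. by move=> sf sg; apply: alg_closure_smooth => //; apply: AC_add; apply: AC_base. Qed.

Lemma smoothM f g : diff_fun O f -> diff_fun O g -> diff_fun O (fun p => f p * g p).
Proof. by move=> sf sg; apply: alg_closure_smooth => //; apply: AC_mul; apply: AC_base. Qed.

Lemma smoothV f : (forall p, O p -> f p != 0) -> diff_fun O f -> diff_fun O (fun p => (f p)^-1).
Proof. by move=> f0 sf; apply: alg_closure_smooth => //; apply: AC_inv => //; apply: AC_base. Qed.

Lemma smooth_comp U g (Phi : J -> J) : open U -> (forall p, O p -> U (Phi p)) ->
  (forall v, diff_fun O (fun p => Phi p v)) -> diff_fun U g -> diff_fun O (fun p => g (Phi p)).
Proof.
move=> oU OU sP sg; apply: alg_closure_smooth => //; apply: (AC_comp oU) => // v.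
exact: AC_base.
Qed.

Lemma smoothN f : diff_fun O f -> diff_fun O (fun p => - f p).
Proof.
move=> sf; rewrite (_ : (fun p => _) = fun p => -1 * f p); last first.
  by apply/funext => p; rewrite mulN1r.
by apply: smoothM => //; exact: smooth_cst.
Qed.

Lemma smoothX f n : diff_fun O f -> diff_fun O (fun p => f p ^+ n).
Proof.
move=> sf; elim: n => [|n IH]; first exact: smooth_cst.
rewrite (_ : (fun p => _) = fun p => f p * f p ^+ n); first exact: smoothM.
by apply/funext => p; rewrite exprS.
Qed.

Lemma smooth_sum (s : seq var) (F : var -> J -> R) :
  (forall v, diff_fun O (F v)) -> diff_fun O (fun p => \sum_(v <- s) F v p).
Proof.
move=> H; apply: alg_closure_smooth => //; apply: AC_sum => // v; exact: AC_base.
Qed.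

End Closure.

(** A vector field acts through the straight line with its value as velocity, so no flow on the
    infinite jet space has to exist. For smooth functions [Lie] is the usual sum of coefficients
    times partial derivatives. *)
Definition lineto (a : J -> J) p (t : R) : J := fun v => p v + t * a p v.
Definition Lie (a : J -> J) f p : R := derive1 (fun t => f (lineto a p t)) 0.
Definition der (a : J -> J) p f (l : R) : Prop := is_derive (0:R) 1 (fun t => f (lineto a p t)) l.
Definition smooth_field O (a : J -> J) := forall v, diff_fun O (fun p => a p v).
Definition ev v : J -> J := fun _ u => if u == v then 1 else 0.

Implicit Types a b c : J -> J.

Lemma lineto0 a p : lineto a p 0 = p.
Proof. by apply/funext => v; rewrite /lineto mul0r addr0. Qed.

Lemma der_Lie a p f l : der a p f l -> Lie a f p = l.
Proof. exact: is_derive_derive1. Qed.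

Lemma der_coord a p v : der a p (fun q => q v) (a p v).
Proof.
rewrite /der /lineto.
have := is_derive_addr (is_derive_constr (p v) (0:R)) (is_derive_mulr (@is_derive_id R R (0:R) (1:R)) (is_derive_constr (a p v) (0:R))).
by rewrite mul1r mulr0 addr0 add0r.
Qed.

Lemma der_supp O a f p S : open O -> O p -> diff_fun O f -> uniq S ->
  (forall q r, O q -> O r -> agree S q r -> f q = f r) ->
  der a p f (\sum_(v <- S) pd v f p * a p v).
Proof.
move=> oO Op sf uS sup.
have := @chain_rule R O f (lineto a p) 0 (a p) S oO.
rewrite lineto0; apply=> //; first exact: smooth_C1.
by move=> v; exact: der_coord.
Qed.

Lemma der_smooth O a f p : open O -> diff_fun O f -> O p -> der a p f (Lie a f p).
Proof.
move=> oO sf Op; have [S [uS sup]] := finsupp_uniq (smooth_finsupp sf).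
have D := @der_supp O a f p S oO Op sf uS sup.
by rewrite (der_Lie D).
Qed.

Lemma Lie_curve O a f (c : R -> J) (t0 : R) : open O -> diff_fun O f -> O (c t0) ->
  (forall v, is_derive t0 1 (fun t => c t v) (a (c t0) v)) ->
  is_derive t0 1 (fun t => f (c t)) (Lie a f (c t0)).
Proof.
move=> oO sf Oc H; have [S [uS sup]] := finsupp_uniq (smooth_finsupp sf).
rewrite (der_Lie (der_supp a oO Oc sf uS sup)).
by apply: chain_rule sup H => //; exact: smooth_C1.
Qed.

Lemma Lie_push U a b g (Phi : J -> J) p : open U -> diff_fun U g -> U (Phi p) ->
  (forall v, der a p (fun q => Phi q v) (b (Phi p) v)) ->
  der a p (fun q => g (Phi q)) (Lie b g (Phi p)).
Proof.
move=> oU sg UP H.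
have := @Lie_curve U b g (fun t => Phi (lineto a p t)) 0 oU sg; rewrite lineto0.
by apply.
Qed.

Lemma lineto_near a p (A : set J) : nbhs p A ->
  exists d, 0 < d /\ forall s, `|s| < d -> A (lineto a p s).
Proof.
move=> nA; have := @curve_near R (lineto a p) 0 (a p) A (fun v => der_coord a p v).
rewrite lineto0 => /(_ nA)[d [d0 H]]; exists d; split=> // s /H.
by rewrite add0r.
Qed.

Lemma der_near a p f g l : (\forall q \near p, f q = g q) -> der a p f l -> der a p g l.
Proof.
move=> /(lineto_near a)[d [d0 H]]; apply: is_derive_near; exists d; split=> // s /H.
by rewrite add0r.
Qed.

Lemma Lie_near a p f g : (\forall q \near p, f q = g q) -> Lie a f p = Lie a g p.
Proof.
move=> /(lineto_near a)[d [d0 H]]; apply: derive1_near; exists d; split=> // s /H.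
by rewrite add0r.
Qed.

Lemma Lie_on O a p f g : open O -> O p -> (forall q, O q -> f q = g q) -> Lie a f p = Lie a g p.
Proof. by move=> oO Op E; apply: Lie_near; apply: open_near E. Qed.

Lemma LieE O a f p S : open O -> O p -> diff_fun O f -> uniq S ->
  (forall q r, O q -> O r -> agree S q r -> f q = f r) ->
  Lie a f p = \sum_(v <- S) pd v f p * a p v.
Proof. by move=> oO Op sf uS sup; apply: der_Lie; apply: der_supp sup. Qed.

Lemma smooth_Lie O a f : open O -> smooth_field O a -> diff_fun O f -> diff_fun O (Lie a f).
Proof.
move=> oO sa sf; have [S [uS sup]] := finsupp_uniq (smooth_finsupp sf).
apply: (smooth_eq oO (f := fun p => \sum_(v <- S) pd v f p * a p v)).
  by move=> p Op; rewrite (LieE a oO Op sf uS sup).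
by apply: (@smooth_sum O oO S (fun v p => pd v f p * a p v)) => // v; apply: smoothM => //; exact: smooth_pd.
Qed.

Lemma Lie_pd O v f p : open O -> diff_fun O f -> O p -> Lie (ev v) f p = pd v f p.
Proof.
move=> oO sf Op.
have := @Lie_curve O (ev v) f (upd p v) (p v) oO sf; rewrite upd_id => H.
by apply/esym/is_derive_derive1/H => // u; exact: upd_line_is_derive.
Qed.

Lemma Lie_lin O a b f p (k : R) (c : J -> J) : open O -> diff_fun O f -> O p ->
  (forall v, c p v = a p v + k * b p v) ->
  Lie c f p = Lie a f p + k * Lie b f p.
Proof.
move=> oO sf Op E; have [S [uS sup]] := finsupp_uniq (smooth_finsupp sf).
rewrite !(LieE _ oO Op sf uS sup) mulr_sumr -big_split; apply: eq_bigr => v _.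
by rewrite E /=; ring.
Qed.

Lemma Lie_scale O b f p (k : R) (c : J -> J) : open O -> diff_fun O f -> O p ->
  (forall v, c p v = k * b p v) -> Lie c f p = k * Lie b f p.
Proof.
move=> oO sf Op E; have [S [uS sup]] := finsupp_uniq (smooth_finsupp sf).
rewrite !(LieE _ oO Op sf uS sup) mulr_sumr; apply: eq_bigr => v _.
by rewrite E /=; ring.
Qed.

Section DerRules.
Variables (a : J -> J) (p : J).

Lemma derD f g l m : der a p f l -> der a p g m -> der a p (fun q => f q + g q) (l + m).
Proof. exact: is_derive_addr. Qed.
Lemma derN f l : der a p f l -> der a p (fun q => - f q) (- l).
Proof. exact: is_derive_oppr. Qed.
Lemma derM f g l m : der a p f l -> der a p g m ->
  der a p (fun q => f q * g q) (l * g p + f p * m).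
Proof. by move=> F G; have := is_derive_mulr F G; rewrite lineto0. Qed.
Lemma derC (k : R) : der a p (fun=> k) 0.
Proof. exact: is_derive_constr. Qed.
Lemma derX f l n : der a p f l -> der a p (fun q => f q ^+ n) (n%:R * f p ^+ n.-1 * l).
Proof. by move=> F; have := is_derive_exprn n F; rewrite lineto0. Qed.
Lemma derV f l : f p != 0 -> der a p f l -> der a p (fun q => (f q)^-1) (- l / f p ^+ 2).
Proof. by move=> f0 F; have := is_derive_invr _ F; rewrite lineto0; apply. Qed.
Lemma der_eq f l m : der a p f l -> l = m -> der a p f m.
Proof. by move=> ? <-. Qed.

End DerRules.

Lemma der_sum a p (s : seq var) (F : var -> J -> R) (l : var -> R) :
  (forall v, der a p (F v) (l v)) ->
  der a p (fun q => \sum_(v <- s) F v q) (\sum_(v <- s) l v).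
Proof. by move=> H; apply: is_derive_sumr. Qed.

(** In both orders the second-order terms form the same double sum, by symmetry of second
    derivatives; what remains are the derivatives of the coefficients, which make up [c]. *)
Lemma Lie_bracket O a b c f p : open O -> smooth_field O a -> smooth_field O b -> diff_fun O f -> O p ->
  (forall v, c p v = Lie a (fun q => b q v) p - Lie b (fun q => a q v) p) ->
  Lie a (Lie b f) p - Lie b (Lie a f) p = Lie c f p.
Proof.
move=> oO sa sb sf Op E; have [S [uS sup]] := finsupp_uniq (smooth_finsupp sf).
have main x y : smooth_field O x -> smooth_field O y -> Lie x (Lie y f) p =
    \sum_(v <- S) \sum_(u <- S) pd u (pd v f) p * x p u * y p v +
    \sum_(v <- S) pd v f p * Lie x (fun q => y q v) p.
  move=> sx sy.
  rewrite (@Lie_on O x p _ (fun q => \sum_(v <- S) pd v f q * y q v))//; last first.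
    by move=> q Oq; rewrite (LieE y oO Oq sf uS sup).
  rewrite (der_Lie (l := \sum_(v <- S) (Lie x (pd v f) p * y p v + pd v f p * Lie x (fun q => y q v) p))).
    rewrite big_split/=; congr (_ + _); rewrite big_seq [RHS]big_seq; apply: eq_bigr => v vS.
    by rewrite (LieE x oO Op (smooth_pd v oO sf) uS (supp_pd oO vS sup)) mulr_suml.
  apply: (@der_sum x p S (fun v q => pd v f q * y q v)) => v; apply: derM.
    exact: der_smooth (smooth_pd v oO sf) Op.
  exact: der_smooth (sy v) Op.
rewrite (main a b)// (main b a)// (LieE c oO Op sf uS sup).
rewrite [X in _ - (X + _)]exchange_big/=.
rewrite [X in _ - (X + _)](_ : _ = \sum_(v <- S) \sum_(u <- S) pd u (pd v f) p * a p u * b p v).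
  rewrite opprD addrACA subrr add0r -sumrB; apply: eq_bigr => v _.
  by rewrite E; ring.
apply: eq_bigr => v _; apply: eq_bigr => u _; rewrite (schwarz u v oO sf Op); ring.
Qed.

End Smooth2.

(** * Total derivatives as vector fields *)

(* The hypotheses are matched syntactically first: comparing them up to conversion
   would unfold the jet functions. *)
Ltac der_step := lazymatch goal with
  | |- der _ _ (fun _ => ?c) _ => refine (derC _ _ _)
  | |- der _ _ (fun x => @?f x ^+ _) _ => refine (derX _ _)
  | |- der _ _ (fun x => - @?f x) _ => refine (derN _)
  | |- der _ _ (fun x => @?f x * @?g x) _ => refine (derM _ _)
  | |- der _ _ (fun x => @?f x + @?g x) _ => refine (derD _ _)
  | H : der _ _ ?f _ |- der _ _ (fun x => ?f x) _ => exact H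
  | H : der _ _ ?f _ |- der _ _ ?f _ => exact H
  | |- der _ _ _ _ => first [refine (der_coord _ _ _) | eassumption]
  end.
Ltac der_tac := repeat der_step.
Ltac smooth_step := lazymatch goal with
  | |- diff_fun _ (fun _ => ?c) => refine (smooth_cst _ _)
  | |- diff_fun _ (fun x => @?f x ^+ _) => refine (smoothX _ _ _)
  | |- diff_fun _ (fun x => - @?f x) => refine (smoothN _ _)
  | |- diff_fun _ (fun x => @?f x * @?g x) => refine (smoothM _ _ _)
  | |- diff_fun _ (fun x => @?f x + @?g x) => refine (smoothD _ _ _)
  | H : diff_fun _ ?f |- diff_fun _ (fun x => ?f x) => exact H
  | H : diff_fun _ ?f |- diff_fun _ ?f => exact H
  | |- diff_fun _ _ => first [refine (smooth_coord _ _) | eassumption]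
  | |- _ => eassumption
  end.
Ltac smooth_tac := repeat smooth_step.

Section JetFields.
Variable R : realType.
Local Notation J := (J R).
Local Notation Dom := (@Dom R).
Implicit Types (f g : J -> R) (p q : J) (u v : var) (S : seq var) (O U : set J).

Definition mkjet (x1 x2 : R) (f0 f1 f2 : nat -> R) : J := fun v =>
  match v with
  | inl false => x1
  | inl true => x2
  | inr (k, l) => match val l with 0%N => f0 k | 1%N => f1 k | _ => f2 k end
  end.

Lemma mkjet0 x1 x2 h0 h1 h2 k : mkjet x1 x2 h0 h1 h2 (vw k 0) = h0 k.
Proof. by rewrite /= inordK. Qed.
Lemma mkjet1 x1 x2 h0 h1 h2 k : mkjet x1 x2 h0 h1 h2 (vw k 1) = h1 k.
Proof. by rewrite /= inordK. Qed.
Lemma mkjet2 x1 x2 h0 h1 h2 k : mkjet x1 x2 h0 h1 h2 (vw k 2) = h2 k.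
Proof. by rewrite /= inordK. Qed.

Definition mkjetE := (mkjet0, mkjet1, mkjet2).

Lemma var_ind (P : var -> Prop) : P vz1 -> P vz2 -> (forall k, P (vw k 0)) ->
  (forall k, P (vw k 1)) -> (forall k, P (vw k 2)) -> forall v, P v.
Proof.
move=> P1 P2 Q0 Q1 Q2 [[]|[k l]] //; rewrite -(inord_val l).
by case: l => [[|[|[|l]]] H]; rewrite ?ltnS //=; [exact: Q0|exact: Q1|exact: Q2].
Qed.

Lemma vw_eq k l k' l' : (l < 3)%N -> (l' < 3)%N ->
  (vw k l == vw k' l') = (k == k') && (l == l').
Proof.
move=> h h'; apply/eqP/andP => [[-> E]|[/eqP-> /eqP->]//]; split=> //.
by have := congr1 val E; rewrite /= !inordK// => ->.
Qed.

Lemma pd_notin O f S v p : open O -> O p ->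
  (forall q r, O q -> O r -> agree S q r -> f q = f r) -> v \notin S -> pd v f p = 0.
Proof.
move=> oO Op sup vS; have [d [d0 Hd]] := upd_near v (open_nbhs_nbhs (conj oO Op)).
apply: pd_eq; apply: is_derive_near (is_derive_constr (f p) (p v)); exists d; split=> // s /Hd Os.
apply: sup => // x xS; rewrite upd_neq//; apply: contraNneq vS => <- //.
Qed.

Definition vars N : seq var :=
  [:: vz1; vz2] ++ [seq inr (k, l) | k <- iota 0 N, l <- enum 'I_3].

Lemma vars_uniq N : uniq (vars N).
Proof.
rewrite /vars cat_uniq; apply/and3P; split=> //.
  by apply/hasPn => x /allpairsP[[k l] [_ _ ->]].
rewrite allpairs_uniq ?iota_uniq ?enum_uniq// => -[k l] [k' l'] _ _ /= [-> ->] //.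
Qed.

Lemma mem_vars N k (l : 'I_3) : (inr (k, l) \in vars N) = (k < N)%N.
Proof.
rewrite mem_cat /=; apply/allpairsP/idP => [[[k' l'] [/= + _ [-> _]]]|kN].
  by rewrite mem_iota.
by exists (k, l); rewrite mem_iota mem_enum.
Qed.

Lemma vars_supp S : exists N, {subset S <= vars N}.
Proof.
elim: S => [|v S [N HN]]; first by exists 0%N.
have mono M : (N <= M)%N -> {subset vars N <= vars M}.
  by move=> NM [[]|[k l]] //; rewrite !mem_vars => /leq_trans; apply.
case: v => [b|[k l]].
  by exists N => x; rewrite inE => /predU1P[->|/HN//]; case: b.
exists (maxn N k.+1) => x; rewrite inE => /predU1P[->|/HN].
  by rewrite mem_vars leq_maxr.
by apply: mono; rewrite leq_maxl.
Qed.

Lemma sum_ord3 (h : 'I_3 -> R) : \sum_(l < 3) h l = h (inord 0) + h (inord 1) + h (inord 2).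
Proof.
rewrite !big_ord_recl big_ord0 addr0 addrA.
by congr (h _ + h _ + h _); apply: val_inj; rewrite /= inordK.
Qed.

Lemma sum_vars N (F : var -> R) : \sum_(v <- vars N) F v =
  F vz1 + F vz2 + \sum_(0 <= k < N) (F (vw k 0) + F (vw k 1) + F (vw k 2)).
Proof.
rewrite /vars big_cat /= !big_cons big_nil /= addr0; congr (_ + _).
rewrite big_allpairs_dep /index_iota subn0; apply: eq_bigr => k _.
by rewrite big_enum/= sum_ord3.
Qed.

Lemma limn_stationary (s : nat -> R) N : (forall n, (N <= n)%N -> s n = s N) -> limn s = s N.
Proof.
move=> H; apply: cvg_lim => //; apply: cvg_near_cst; by exists N => // n /= /H.
Qed.

(** Coordinates outside the support contribute 0, so the partial sums are stationary. This turns the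
    limits in [D1] and [D2] into finite sums over vector field components. *)
Lemma Lie_limn O (a : J -> J) f p : open O -> O p -> diff_fun O f ->
  pd vz1 f p * a p vz1 + pd vz2 f p * a p vz2 + limn (fun N => \sum_(0 <= k < N)
     (pd (vw k 0) f p * a p (vw k 0) + pd (vw k 1) f p * a p (vw k 1)
      + pd (vw k 2) f p * a p (vw k 2))) = Lie a f p.
Proof.
move=> oO Op sf; have [S [uS sup]] := finsupp_uniq (smooth_finsupp sf).
have [N SN] := vars_supp S.
have supN : forall q r, O q -> O r -> agree (vars N) q r -> f q = f r.
  by move=> q r Oq Or A; apply: sup => // v /SN; apply: A.
rewrite (LieE a oO Op sf (vars_uniq N) supN) sum_vars; congr (_ + _).
apply: limn_stationary => n Nn; rewrite (@big_cat_nat _ _ _ N)//=.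
rewrite addrC big_nat_cond big1 ?add0r// => k /andP[/andP[Nk _] _].
by rewrite !(pd_notin oO Op supN) ?mem_vars -?leqNgt// !mul0r !addr0.
Qed.

Definition D1_field : J -> J := fun p => mkjet 1 0
  (fun k => w k.+1 0 p) (fun k => w k.+1 1 p) (fun k => w k.+1 2 p).
Definition D2_field : J -> J := fun p => mkjet 0 1
  (fun k => w k 1 p) (fun k => w k 2 p) (fun k => w3 k p).
Definition E_field : J -> J := fun p v => D1_field p v + w 0 2 p * D2_field p v.

Lemma D1E O f p : open O -> diff_fun O f -> O p -> D1 f p = Lie D1_field f p.
Proof.
move=> oO sf Op; rewrite -(Lie_limn D1_field oO Op sf) /D1 mulr1 mulr0 addr0; congr (_ + limn _).
apply/funext => N; apply: eq_bigr => k _; rewrite sum_ord3 /D1_field !mkjetE /w /vw.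
by rewrite ![p _ * _]mulrC.
Qed.

Lemma D2E O f p : open O -> diff_fun O f -> O p -> D2 f p = Lie D2_field f p.
Proof.
move=> oO sf Op; rewrite -(Lie_limn D2_field oO Op sf) /D2 mulr1 mulr0 add0r; congr (_ + limn _).
apply/funext => N; apply: eq_bigr => k _; rewrite /D2_field !mkjetE.
by rewrite ![pd _ _ _ * _]mulrC.
Qed.

Lemma open_neq0 O f : open O -> diff_fun O f -> open (O `&` [set p | f p != 0]).
Proof.
move=> oO sf; rewrite openE => p [Op fp]; apply: filterI; first exact: open_nbhs_nbhs.
have := (cont_epsP _ _).1 (smooth_cont sf Op) `|f p|; rewrite normr_gt0 => /(_ fp).
apply: filterS => q /=; apply: contraTneq => ->.
by rewrite sub0r normrN ltxx.
Qed.

Lemma open_Dom : open Dom.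
Proof.
have oT : open [set: J] by exact: openT.
have s02 : diff_fun [set: J] (w 0 2) by exact: smooth_coord.
have s12 : diff_fun [set: J] (w 1 2) by exact: smooth_coord.
have -> : Dom = ([set: J] `&` [set p | w 0 2 p != 0]) `&` ([set: J] `&` [set p | w 1 2 p != 0]).
  by apply/seteqP; split=> p /=; rewrite /Defs.Dom/=; tauto.
by apply: openI; apply: open_neq0.
Qed.

Lemma smooth_mkjet O (x1 x2 : J -> R) (f0 f1 f2 : J -> nat -> R) :
  diff_fun O x1 -> diff_fun O x2 -> (forall k, diff_fun O (fun p => f0 p k)) ->
  (forall k, diff_fun O (fun p => f1 p k)) -> (forall k, diff_fun O (fun p => f2 p k)) ->
  smooth_field O (fun p => mkjet (x1 p) (x2 p) (f0 p) (f1 p) (f2 p)).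
Proof.
move=> s1 s2 h0 h1 h2; apply: var_ind => // k.
- by rewrite (_ : (fun p => _) = (fun p => f0 p k))//; apply/funext => p; rewrite mkjetE.
- by rewrite (_ : (fun p => _) = (fun p => f1 p k))//; apply/funext => p; rewrite mkjetE.
- by rewrite (_ : (fun p => _) = (fun p => f2 p k))//; apply/funext => p; rewrite mkjetE.
Qed.

Lemma smooth_D1_field O : open O -> smooth_field O D1_field.
Proof. by move=> oO; apply: smooth_mkjet => *; smooth_tac. Qed.

Lemma smooth_D1 O f : open O -> diff_fun O f -> diff_fun O (D1 f).
Proof.
move=> oO sf; apply: (smooth_eq oO (f := Lie D1_field f)).
  by move=> p Op; rewrite (D1E oO sf Op).
by apply: smooth_Lie => //; exact: smooth_D1_field.
Qed.

Section InDom.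
Variable O : set J.
Hypotheses (oO : open O) (OD : O `<=` Dom).

Lemma smooth_w02V : diff_fun O (fun p => (w 0 2 p)^-1).
Proof. by apply: smoothV => //; [move=> p /OD[]|exact: smooth_coord]. Qed.

Lemma smooth_w12V : diff_fun O (fun p => (w 1 2 p)^-1).
Proof. by apply: smoothV => //; [move=> p /OD[]|exact: smooth_coord]. Qed.

Lemma smooth_w3 k : diff_fun O (w3 k).
Proof.
elim: k => [|k IH]; last exact: smooth_D1.
by have := smooth_w02V => H; rewrite /w3 /=; smooth_tac.
Qed.

Lemma smooth_D2_field : smooth_field O D2_field.
Proof. by apply: smooth_mkjet => *; try smooth_tac; exact: smooth_w3. Qed.

Lemma smooth_E_field : smooth_field O E_field.
Proof. by move=> v; have := smooth_D1_field oO v; have := smooth_D2_field v => h1 h2; rewrite /E_field; smooth_tac. Qed.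

Lemma smooth_D2 f : diff_fun O f -> diff_fun O (D2 f).
Proof.
move=> sf; apply: (smooth_eq oO (f := Lie D2_field f)).
  by move=> p Op; rewrite (D2E oO sf Op).
by apply: smooth_Lie => //; exact: smooth_D2_field.
Qed.

Lemma D1_D2_E_field f p : diff_fun O f -> O p -> D1 f p + w 0 2 p * D2 f p = Lie E_field f p.
Proof.
move=> sf Op; rewrite (D1E oO sf Op) (D2E oO sf Op).
by rewrite (@Lie_lin R O D1_field D2_field f p (w 0 2 p) E_field).
Qed.

(** The bracket of the two fields vanishes in every coordinate. The only component that involves the
    equation is the one at w_{k,2}, where both sides are [w3 k.+1] because [w3] iterates [D1]. *)
Lemma D1D2 f p : diff_fun O f -> O p -> D1 (D2 f) p = D2 (D1 f) p.
Proof.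
move=> sf Op; rewrite (D1E oO (smooth_D2 sf) Op) (D2E oO (smooth_D1 oO sf) Op).
rewrite (Lie_on D1_field oO Op (g := Lie D2_field f)); last by move=> q; exact: D2E.
rewrite (Lie_on D2_field oO Op (g := Lie D1_field f)); last by move=> q; exact: D1E.
apply/eqP; rewrite -subr_eq0.
rewrite (@Lie_bracket R O D1_field D2_field (fun _ _ => 0) f p)//; [|exact: smooth_D1_field|exact: smooth_D2_field|].
  by rewrite (@Lie_scale R O D1_field f p 0)// ?mul0r// => v; rewrite mul0r.
have co a v f' : f' = (fun q : J => q v) -> Lie a f' p = a p v.
  by move=> ->; apply: der_Lie; exact: der_coord.
have cs a f' (x : R) : f' = (fun=> x) -> Lie a f' p = 0.
  by move=> ->; apply: der_Lie; exact: derC.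
have fk (a : J -> J) v (h : J -> R) : (forall q, a q v = h q) -> (fun q => a q v) = h.
  by move=> H; apply/funext.
apply: var_ind => [||k|k|k].
- by rewrite (cs _ _ 0)// (cs _ _ 1)// subrr.
- by rewrite (cs _ _ 1)// (cs _ _ 0)// subrr.
- rewrite (co D1_field (vw k 1)); last by apply: fk => q; rewrite /D1_field /D2_field mkjetE.
  rewrite (co D2_field (vw k.+1 0)); last by apply: fk => q; rewrite /D1_field mkjetE.
  by rewrite /D1_field /D2_field !mkjetE subrr.
- rewrite (co D1_field (vw k 2)); last by apply: fk => q; rewrite /D1_field /D2_field mkjetE.
  rewrite (co D2_field (vw k.+1 1)); last by apply: fk => q; rewrite /D1_field mkjetE.
  by rewrite /D1_field /D2_field !mkjetE subrr.
- rewrite (_ : (fun q => D2_field q (vw k 2)) = w3 k); last by apply: fk => q; rewrite /D1_field /D2_field mkjetE.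
  rewrite (co D2_field (vw k.+1 2)); last by apply: fk => q; rewrite /D1_field mkjetE.
  by rewrite /D2_field mkjetE -(D1E oO (smooth_w3 k) Op) subrr.
Qed.


End InDom.
End JetFields.

(** * The straightening chart *)

Section Coordinates.
Variable R : realType.
Local Notation J := (J R).
Local Notation Dom := (@Dom R).
Local Notation E_field := (@E_field R).
Local Notation D1_field := (@D1_field R).
Local Notation D2_field := (@D2_field R).
Implicit Types (f g : J -> R) (p q : J) (u v : var) (S : seq var) (O U : set J).

Lemma D1_on O f g p : open O -> diff_fun O f -> (forall q, O q -> f q = g q) -> O p ->
  D1 f p = D1 g p.
Proof.
move=> oO sf E Op; rewrite (D1E oO sf Op) (D1E oO (smooth_eq oO E sf) Op).
exact: Lie_on E.
Qed.

Lemma D2_on O f g p : open O -> diff_fun O f -> (forall q, O q -> f q = g q) -> O p ->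
  D2 f p = D2 g p.
Proof.
move=> oO sf E Op; rewrite (D2E oO sf Op) (D2E oO (smooth_eq oO E sf) Op).
exact: Lie_on E.
Qed.

Lemma der_D1 O f p : open O -> diff_fun O f -> O p -> der D1_field p f (D1 f p).
Proof. by move=> oO sf Op; rewrite (D1E oO sf Op); exact: der_smooth sf Op. Qed.

Lemma der_D2 O f p : open O -> diff_fun O f -> O p -> der D2_field p f (D2 f p).
Proof. by move=> oO sf Op; rewrite (D2E oO sf Op); exact: der_smooth sf Op. Qed.

Lemma D1_der O f p l : open O -> diff_fun O f -> O p -> der D1_field p f l -> D1 f p = l.
Proof. by move=> oO sf Op H; rewrite (D1E oO sf Op) (der_Lie H). Qed.

Lemma D2_der O f p l : open O -> diff_fun O f -> O p -> der D2_field p f l -> D2 f p = l.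
Proof. by move=> oO sf Op H; rewrite (D2E oO sf Op) (der_Lie H). Qed.

Let oD := @open_Dom R.
Let DD : Dom `<=` Dom := fun _ h => h.

Lemma smooth_theta k : diff_fun Dom (theta k).
Proof.
elim: k => [|k IH]; first by rewrite /theta/=; have := oD => ?; smooth_tac.
have h := smooth_D2 oD DD IH; have h' := smooth_w12V oD DD; have := oD => ?.
by rewrite /theta /= -/(theta k); smooth_tac.
Qed.

Lemma w31E p : Dom p -> w3 1 p = - w 2 2 p / w 0 2 p + w 1 2 p ^+ 2 / w 0 2 p ^+ 2.
Proof.
move=> Dp; have [u0 _] := Dp; apply: (D1_der oD (smooth_w3 oD DD 0) Dp).
have V := derV u0 (der_coord D1_field p (vw 0 2)).
apply: der_eq; first by rewrite /w3 /=; der_tac.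
by rewrite /D1_field !mkjetE /w; ring.
Qed.

Lemma E_field_w02 p : Dom p -> E_field p (vw 0 2) = 0.
Proof.
by move=> [u0 _]; rewrite /E_field /D1_field /D2_field !mkjetE /w3 /=; field.
Qed.

Lemma E_field_w12 p : Dom p -> E_field p (vw 1 2) = w 1 2 p ^+ 2 / w 0 2 p.
Proof.
by move=> Dp; have [u0 _] := Dp; rewrite /E_field /D1_field /D2_field !mkjetE w31E//; field.
Qed.

Lemma E_theta k p : Dom p -> Lie E_field (theta k) p = 0.
Proof.
elim: k p => [|k IH] p Dp; have [u0 w0] := Dp.
  apply: der_Lie; apply: der_eq; first by rewrite /theta /=; der_tac.
  by rewrite E_field_w02// /E_field /= /z1 /w; ring.
have sg := smooth_theta k; set g := theta k in IH sg.
have s2 := smooth_D2 oD DD sg; have s1 := smooth_D1 oD sg.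
have V := derV w0 (der_coord E_field p (vw 1 2)).
have dD2 := der_smooth E_field oD s2 Dp.
apply: der_Lie; apply: der_eq; first by rewrite /theta /= -/(theta k) -/g; der_tac.
rewrite E_field_w02// E_field_w12// -(D1_D2_E_field oD s2 Dp) (D1D2 oD DD sg Dp).
(* The induction hypothesis holds on all of [Dom], not only at [p], so it may be differentiated. *)
have -> : D2 (D1 g) p = D2 (fun q => - (w 0 2 q * D2 g q)) p.
  apply: (D2_on oD s1) => // q Dq; have := IH q Dq.
  by rewrite -(D1_D2_E_field oD sg Dq) => /eqP; rewrite addr_eq0 => /eqP.
have -> : D2 (fun q => - (w 0 2 q * D2 g q)) p =
    - (- w 1 2 p / w 0 2 p * D2 g p + w 0 2 p * D2 (D2 g) p).
  have h : diff_fun Dom (fun q => - (w 0 2 q * D2 g q)) by have := oD => ?; smooth_tac.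
  have d2 := der_D2 oD s2 Dp.
  apply: (D2_der oD h Dp); apply: der_eq; first by der_tac.
  by rewrite /D2_field mkjetE.
by rewrite /w; field; rewrite ?u0 ?w0.
Qed.

Lemma D2_theta k p : Dom p -> D2 (theta k) p = w 1 2 p / w 0 2 p * theta k.+1 p.
Proof.
move=> [u0 w0]; rewrite /theta /= -/(theta k); field; by rewrite u0 w0.
Qed.

Lemma theta1E p : Dom p -> theta 1 p = w 0 2 p / w 1 2 p + z1 p.
Proof.
move=> Dp; have [u0 w0] := Dp; have := D2_theta 0 Dp.
have -> : D2 (theta 0) p = 1 + w 1 2 p / w 0 2 p * z1 p.
  apply: (D2_der oD (smooth_theta 0) Dp); apply: der_eq; first by rewrite /theta /=; der_tac.
  by rewrite /D2_field mkjetE /w3 /= /z1 /w; ring.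
move=> H; have : w 0 2 p / w 1 2 p * (1 + w 1 2 p / w 0 2 p * z1 p) = theta 1 p.
  by rewrite H; field; rewrite u0 w0.
by move=> <-; field; rewrite u0 w0.
Qed.

Lemma smooth_zeta O i k : open O -> diff_fun O (@zeta R i k).
Proof.
move=> oO; elim: k => [|k IH]; last exact: (smooth_D1 oO IH).
have s1 : diff_fun O (@I1 R) by rewrite /I1; smooth_tac.
rewrite /zeta/=; case: (i == 1%N) => //; rewrite /I2.
have := smooth_D1 oO s1 => ?; smooth_tac.
Qed.

(** [halfsq] and [thirdcb] collect the terms of the zeta's that involve only the w_{j,2}. What is
    left is one new coordinate, w_{k+1,1} or w_{k+2,0}, apart from a multiple of z_2; this makes the
    chart triangular. *)
Definition halfsq k : J -> R := iter k (@D1 R) (fun q => w 0 2 q ^+ 2 / 2).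
Definition thirdcb k : J -> R := iter k (@D1 R) (fun q => w 0 2 q ^+ 3 / 3).

Lemma smooth_halfsq O k : open O -> diff_fun O (halfsq k).
Proof. by move=> oO; elim: k => [|k IH]; [rewrite /halfsq/=; smooth_tac|exact: (smooth_D1 oO IH)]. Qed.

Lemma smooth_thirdcb O k : open O -> diff_fun O (thirdcb k).
Proof. by move=> oO; elim: k => [|k IH]; [rewrite /thirdcb/=; smooth_tac|exact: (smooth_D1 oO IH)]. Qed.

Lemma zeta1E k p : zeta 1 k p = w k.+1 1 p + halfsq k p.
Proof.
elim: k p => [//|k IH] p.
have oT : open [set: J] by exact: openT.
have sz := smooth_zeta 1 k oT; have sq := smooth_halfsq k oT.
rewrite /zeta /= -/(zeta 1 k) (D1_on oT sz (fun q _ => IH q))//.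
have d := der_D1 oT sq (I : [set: J] p).
apply: (D1_der oT (p := p)) => //; first by smooth_tac.
apply: der_eq; first by der_tac.
by rewrite /D1_field mkjetE.
Qed.

Lemma zeta2E k p : zeta 2 k p = w k.+2 0 p - thirdcb k p - z2 p * zeta 1 k.+1 p.
Proof.
elim: k p => [//|k IH] p.
have oT : open [set: J] by exact: openT.
have sz := smooth_zeta 2 k oT; have sq := smooth_thirdcb k oT; have sz1 := smooth_zeta 1 k.+1 oT.
rewrite {1}/zeta /= -/(zeta 2 k) (D1_on oT sz (fun q _ => IH q))//.
have d := der_D1 oT sq (I : [set: J] p).
have d1 := der_D1 oT sz1 (I : [set: J] p).
apply: (D1_der oT (p := p)) => //; first by smooth_tac.
apply: der_eq; first by der_tac.
by rewrite /D1_field mkjetE /= -/(zeta 1 k.+2) mul0r add0r.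
Qed.

(** The case k = 0 is a computation in which D_2 w_{2,0} and the cubic term of [I2] add up to
    [D1 I1], cancelled by the derivative of the factor z_2. Higher k follow since [D1] and [D2]
    commute. *)
Lemma D2_zeta i k p : (i == 1%N) || (i == 2%N) -> Dom p -> D2 (zeta i k) p = 0.
Proof.
move=> i12; elim: k p => [|k IH] p Dp; have [u0 w0] := Dp.
  have s1 := smooth_zeta 1 1 oD; have h0 := smooth_halfsq 0 oD; have h1 := smooth_halfsq 1 oD.
  have D20 : der D2_field p (@halfsq 0) (- w 1 2 p).
    apply: der_eq; first by rewrite /halfsq /=; der_tac.
    by rewrite /D2_field mkjetE /w3 /= /w; field.
  have z10 q : Dom q -> D2 (zeta 1 0) q = 0.
    move=> Dq; have [v0 _] := Dq; apply: (D2_der oD (smooth_zeta 1 0 oD) Dq).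
    apply: der_eq; first by rewrite /zeta /= /I1; der_tac.
    by rewrite /D2_field !mkjetE /w3 /= /w; field.
  case/orP: i12 => /eqP ->; first exact: z10.
  have z11 : D2 (zeta 1 1) p = 0.
    rewrite /zeta iterS -/(zeta 1 0) -(D1D2 oD DD (smooth_zeta 1 0 oD) Dp).
    have s0 := smooth_D2 oD DD (smooth_zeta 1 0 oD).
    rewrite (D1_on oD s0 z10 Dp); apply: (D1_der oD (smooth_cst _ oD) Dp); exact: derC.
  have d11 := der_D2 oD s1 Dp; rewrite z11 in d11.
  apply: (D2_der oD (smooth_zeta 2 0 oD) Dp).
  apply: der_eq; first by rewrite /zeta /= /I2 -/(zeta 1 1); der_tac.
  have -> : D1 (@I1 R) p = w 2 1 p + w 0 2 p * w 1 2 p.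
    rewrite -[LHS]/(zeta 1 1 p) zeta1E; congr (_ + _); apply: (D1_der oD h0 Dp).
    apply: der_eq; first by rewrite /halfsq /=; der_tac.
    by rewrite /D1_field mkjetE /w; field.
  by rewrite /D2_field !mkjetE /w3 /= /w; field.
rewrite /zeta iterS -/(zeta i k) -(D1D2 oD DD (smooth_zeta i k oD) Dp).
rewrite (D1_on oD (smooth_D2 oD DD (smooth_zeta i k oD)) IH Dp).
by apply: (D1_der oD (smooth_cst _ oD) Dp); exact: derC.
Qed.

Lemma der_E_field_zeta i k p : (i == 1%N) || (i == 2%N) -> Dom p ->
  der E_field p (zeta i k) (zeta i k.+1 p).
Proof.
move=> i12 Dp; have := der_smooth E_field oD (smooth_zeta i k oD) Dp.
by rewrite -(D1_D2_E_field oD (smooth_zeta i k oD) Dp) D2_zeta// mulr0 addr0.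
Qed.

Lemma der_D2_field_zeta i k p : (i == 1%N) || (i == 2%N) -> Dom p -> der D2_field p (zeta i k) 0.
Proof.
by move=> i12 Dp; have := der_D2 oD (smooth_zeta i k oD) Dp; rewrite D2_zeta.
Qed.

(* Along solutions, [cA], [potential0] and [potential1] are primitives with respect to D_1 + w_{0,2} D_2 of
   zeta^{10}, of [potential1] and of zeta^{20}, respectively. *)
Definition potential0 p : R := w 0 0 p - z2 p * w 0 1 p
  + z1 p ^+ 2 * w 0 2 p ^+ 3 / 12 + z2 p ^+ 2 * w 0 2 p / 4.
Definition potential1 p : R := cB p + z1 p * w 0 2 p ^+ 3 / 6.

(* The new coordinates are stored in a jet again: theta^0 takes the place of z_2, theta^k (k > 0)
   that of w_{k,2}, the sequence cA, zeta^{10}, zeta^{11}, ... that of w_{k,1}, and the sequence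
   potential0, potential1, zeta^{20}, zeta^{21}, ... that of w_{k,0}; z_1 and w_{0,2} are kept. *)
Definition chart p : J := mkjet (z1 p) (theta 0 p)
  (fun k => match k with 0%N => potential0 p | 1%N => potential1 p | k'.+2 => zeta 2 k' p end)
  (fun k => match k with 0%N => cA p | k'.+1 => zeta 1 k' p end)
  (fun k => match k with 0%N => w 0 2 p | k'.+1 => theta k'.+1 p end).

(* In the new coordinates D_1 + w_{0,2} D_2 is the total derivative of jets in the variable z_1,
   with theta^k and w_{0,2} as parameters. *)
Definition E_chart p : J := mkjet 1 0 (fun k => w k.+1 0 p) (fun k => w k.+1 1 p) (fun=> 0).

(* D_2 divided by its value at w_{0,2}, i.e. by w_{0,3} = (z_1 - theta^1)^{-1}. *)
Definition D2_chart_dir p : J := mkjet 0 (- w 1 2 p)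
  (fun k => match k with
    | 0%N => z2 p ^+ 2 / 4 + (z2 p + w 0 2 p * z1 p) * w 0 2 p * w 1 2 p / 2
    | 1%N => w 0 2 p ^+ 2 * w 1 2 p / 2 | _ => 0 end)
  (fun k => match k with 0%N => - w 0 2 p * w 1 2 p | _ => 0 end)
  (fun k => match k with 0%N => 1 | k'.+1 => - w k'.+2 2 p end).

Definition D2_chart p : J := fun v => (z1 p - w 1 2 p)^-1 * D2_chart_dir p v.

Lemma chart_z1 p : z1 (chart p) = z1 p. Proof. by []. Qed.
Lemma chart_z2 p : z2 (chart p) = theta 0 p. Proof. by []. Qed.
Lemma chart_w p : (w 0 2 (chart p) = w 0 2 p) * (forall k, w k.+1 2 (chart p) = theta k.+1 p)
  * (w 0 1 (chart p) = cA p) * (forall k, w k.+1 1 (chart p) = zeta 1 k p)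
  * (w 0 0 (chart p) = potential0 p) * (w 1 0 (chart p) = potential1 p) *
  (forall k, w k.+2 0 (chart p) = zeta 2 k p).
Proof. by rewrite /w /chart; do !split; move=> *; rewrite !mkjetE. Qed.

Definition chartE p := (chart_z1 p, chart_z2 p, chart_w p).

Lemma smooth_chart : smooth_field Dom chart.
Proof.
have h k := smooth_theta k; have h1 k := smooth_zeta 1 k oD; have h2 k := smooth_zeta 2 k oD.
have h10 := h1 0%N; have := oD => ?.
apply: smooth_mkjet => [||k|k|k]; [by smooth_tac|exact: (h 0%N)|case: k => [|[|k]]|case: k => [|k]|case: k => [|k]].
- by rewrite /potential0; smooth_tac.
- by rewrite /potential1 /cB; smooth_tac.
- exact: h2.
- by rewrite /cA; smooth_tac.
- exact: h1.
- by smooth_tac.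
- exact: h.
Qed.

Lemma der_field (a : J -> J) f (h : J -> R) p l : (forall q, f q = h q) -> der a p h l -> der a p f l.
Proof. by move=> /funext ->. Qed.

(** This is where the constants of the potentials come from. With u = w_{0,2}, E maps [cB] to
    zeta^{20} - u^3/6, which the summand z_1 u^3/6 corrects. It maps w_{0,0} - z_2 w_{0,1} to [cB] -
    z_2 u^2/2; the summand z_2^2 u/4 cancels the defect, and z_1^2 u^3/12 supplies the z_1 u^3/6
    needed in [potential1]. *)
Lemma push_E_field p : Dom p -> forall v, der E_field p (fun q => chart q v) (E_chart (chart p) v).
Proof.
move=> Dp; have [u0 w0] := Dp; have := E_field_w02 Dp => e02.
have th k : der E_field p (theta k) 0 by have := der_smooth E_field oD (smooth_theta k) Dp; rewrite E_theta.
have z10 := @der_E_field_zeta 1 0 p isT Dp.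
have z1k k := @der_E_field_zeta 1 k p isT Dp; have z2k k := @der_E_field_zeta 2 k p isT Dp.
have z11E : zeta 1 0 p = w 1 1 p + w 0 2 p ^+ 2 / 2 by rewrite zeta1E.
have z20E : zeta 2 0 p = w 2 0 p - w 0 2 p ^+ 3 / 3 - z2 p * zeta 1 1 p by rewrite zeta2E.
apply: var_ind => [||[|[|k]]|[|k]|[|k]]; rewrite /E_chart ?mkjetE ?chartE.
- by apply: der_eq; first (rewrite /chart /=; der_tac); rewrite /E_field /=; ring.
- exact: (th 0%N).
- apply: (der_field (h := potential0)); first by move=> q; rewrite /chart mkjetE.
  apply: der_eq; first by rewrite /potential0; der_tac.
  rewrite e02 /E_field /D1_field /D2_field !mkjetE /potential1 /cB z11E /= /w /z1 /z2; by field.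
- apply: (der_field (h := potential1)); first by move=> q; rewrite /chart mkjetE.
  apply: der_eq; first by rewrite /potential1 /cB; der_tac.
  rewrite e02 z20E /E_field /D1_field /D2_field !mkjetE z11E /= /w /z1 /z2; by field.
- apply: (der_field (h := zeta 2 k)); first by move=> q; rewrite /chart mkjetE.
  exact: z2k.
- apply: (der_field (h := @cA R)); first by move=> q; rewrite /chart mkjetE.
  apply: der_eq; first by rewrite /cA; der_tac.
  rewrite e02 /E_field /D1_field /D2_field !mkjetE z11E /= /w /z1 /z2; by field.
- apply: (der_field (h := zeta 1 k)); first by move=> q; rewrite /chart mkjetE.
  exact: z1k.
- apply: (der_field (h := w 0 2)); first by move=> q; rewrite /chart mkjetE.
  by apply: der_eq; first by der_tac.
- by apply: (der_field (h := theta k.+1)); first by move=> q; rewrite /chart mkjetE.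
Qed.

Lemma push_D2_field p : Dom p -> forall v, der D2_field p (fun q => chart q v) (D2_chart (chart p) v).
Proof.
move=> Dp; have [u0 w0] := Dp.
have w30 : D2_field p (vw 0 2) = - w 1 2 p / w 0 2 p by rewrite /D2_field mkjetE.
have kE : (z1 p - theta 1 p)^-1 = - w 1 2 p / w 0 2 p.
  by rewrite theta1E//; field; rewrite u0 w0 /=; apply/eqP => H; move: u0; rewrite (_ : w 0 2 p = 0) ?eqxx//; move: H; rewrite /w; lra.
have th k : der D2_field p (theta k) (w 1 2 p / w 0 2 p * theta k.+1 p).
  by have := der_D2 oD (smooth_theta k) Dp; rewrite D2_theta.
have z10 := @der_D2_field_zeta 1 0 p isT Dp.
have z1k k := @der_D2_field_zeta 1 k p isT Dp; have z2k k := @der_D2_field_zeta 2 k p isT Dp.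
have t0 : theta 0 p = z2 p - w 0 2 p * z1 p by [].
have t1 := theta1E Dp.
have z11E : zeta 1 0 p = w 1 1 p + w 0 2 p ^+ 2 / 2 by rewrite zeta1E.
apply: var_ind => [||[|[|k]]|[|k]|[|k]]; rewrite /D2_chart /D2_chart_dir ?mkjetE ?chartE ?kE.
- by apply: der_eq; first (rewrite /chart /=; der_tac); rewrite /D2_field /=; ring.
- by apply: der_eq; first exact: (th 0%N); rewrite /= ?chartE; field; rewrite ?u0 ?w0.
- apply: (der_field (h := potential0)); first by move=> q; rewrite /chart mkjetE.
  apply: der_eq; first by rewrite /potential0; der_tac.
  rewrite w30 /D2_field !mkjetE t0 t1 /= /w /z1 /z2; field; by rewrite ?u0 ?w0.
- apply: (der_field (h := potential1)); first by move=> q; rewrite /chart mkjetE.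
  apply: der_eq; first by rewrite /potential1 /cB; der_tac.
  rewrite w30 /D2_field !mkjetE z11E t1 /= /w /z1 /z2; field; by rewrite ?u0 ?w0.
- apply: (der_field (h := zeta 2 k)); first by move=> q; rewrite /chart mkjetE.
  rewrite mulr0; exact: z2k.
- apply: (der_field (h := @cA R)); first by move=> q; rewrite /chart mkjetE.
  apply: der_eq; first by rewrite /cA; der_tac.
  rewrite w30 /D2_field !mkjetE t1 /= /w /z1 /z2; field; by rewrite ?u0 ?w0.
- apply: (der_field (h := zeta 1 k)); first by move=> q; rewrite /chart mkjetE.
  rewrite mulr0; exact: z1k.
- apply: (der_field (h := w 0 2)); first by move=> q; rewrite /chart mkjetE.
  by apply: der_eq; first (by der_tac); rewrite w30 mulr1.
- apply: (der_field (h := theta k.+1)); first by move=> q; rewrite /chart mkjetE.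
  by apply: der_eq; first (exact: th); ring.
Qed.

End Coordinates.

(** * Inverse of the chart through the hodograph transformation *)

Section Inverse.
Variable R : realType.
Local Notation J := (J R).
Local Notation Dom := (@Dom R).
Local Notation D1_field := (@D1_field R).
Implicit Types (f g : J -> R) (p q : J) (u v : var) (S : seq var) (O U : set J).

(** Dependence is stated for total functions, without smoothness or a domain. It lets [hodX],
    [halfsq] and [thirdcb] be evaluated on jets that agree only in the coordinates that matter. *)
Definition depends_on (P : pred var) f :=
  forall p q, (forall v, P v -> p v = q v) -> f p = f q.

Lemma depends_pd P f v : depends_on P f -> depends_on P (pd v f).
Proof.
move=> H p q E; rewrite /pd; case Pv : (P v); last first.
  have const r s : f (upd r v s) = f r.
    by apply: H => u Pu; rewrite upd_neq//; apply: contraTneq Pu => ->; rewrite Pv.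
  rewrite (_ : (fun t => f (upd p v t)) = fun=> f p); last by apply/funext => t; exact: const.
  rewrite (_ : (fun t => f (upd q v t)) = fun=> f q); last by apply/funext => t; exact: const.
  by rewrite (is_derive_derive1 (is_derive_constr (f p) _)) (is_derive_derive1 (is_derive_constr (f q) _)).
rewrite -E//; congr (derive1 _ _); apply/funext => t; apply: H => u Pu.
by rewrite /upd; case: eqP => // _; exact: E.
Qed.

Lemma depends_pd0 P f v p : depends_on P f -> ~~ P v -> pd v f p = 0.
Proof.
move=> H Pv; apply: pd_eq.
rewrite (_ : (fun t => f (upd p v t)) = fun=> f p); first exact: is_derive_constr.
apply/funext => t; apply: H => u Pu; rewrite upd_neq//.
by apply: contraTneq Pu => ->.
Qed.

(** A coordinate on which [f] depends is multiplied by its z_1-derivative, again in [P] by the shift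
    hypothesis; any other coordinate has partial derivative 0. *)
Lemma depends_D1 (P : pred var) f : (forall k l, P (inr (k, l)) -> P (inr (k.+1, l))) ->
  depends_on P f -> depends_on P (D1 f).
Proof.
move=> PS H p q E; rewrite /D1 (depends_pd vz1 H E); congr (_ + limn _).
apply/funext => N; apply: eq_bigr => k _; apply: eq_bigr => l _.
rewrite (depends_pd (inr (k, l)) H E); have [/PS/E->//|nP] := boolP (P (inr (k, l))).
by rewrite (depends_pd0 q H nP) !mulr0.
Qed.

(** The k-th derivative of z_1 with respect to w_{0,2} at fixed z_2: with w_{0,2} as independent
    variable the total derivative is D_1 / w_{1,2}. *)
Definition hodX k : J -> R := iter k (fun g q => D1 g q / w 1 2 q) (@z1 R).
Definition Dom12 : set J := [set: J] `&` [set p | w 1 2 p != 0].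

Lemma open_Dom12 : open Dom12.
Proof. by apply: open_neq0; [exact: openT|apply: smooth_coord; exact: openT]. Qed.

Lemma smooth_hodX k : diff_fun Dom12 (hodX k).
Proof.
have oD := open_Dom12; elim: k => [|k IH]; first by rewrite /hodX/=; smooth_tac.
have h : diff_fun Dom12 (fun q => (w 1 2 q)^-1) by apply: smoothV => //; [move=> p []|exact: smooth_coord].
by have := smooth_D1 oD IH => ?; rewrite /hodX /= -/(hodX k); smooth_tac.
Qed.

Definition jetP : pred var := fun v => match v with inr (_, l) => val l == 2%N | _ => false end.
Definition jetP1 : pred var := fun v => (v == vz1) || jetP v.

Lemma jetP_agree p q : (forall k, w k 2 p = w k 2 q) -> forall v, jetP v -> p v = q v.
Proof. by move=> H; apply: var_ind => // [k|k|k _]; rewrite /jetP /= ?inordK//; exact: H. Qed.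

Lemma jetP1_agree p q : z1 p = z1 q -> (forall k, w k 2 p = w k 2 q) ->
  forall v, jetP1 v -> p v = q v.
Proof. by move=> H1 H v /orP[/eqP->//|]; exact: jetP_agree. Qed.

Lemma depends_hodX k : depends_on jetP1 (hodX k).
Proof.
elim: k => [|k IH] p q E; first by rewrite /hodX/= /z1 E.
rewrite /hodX /= -/(hodX k) (depends_D1 (P := jetP1) (fun _ _ => id) IH E)//; congr (_ / _).
by apply: E; rewrite /jetP1 /jetP /= inordK.
Qed.

Lemma depends_halfsq k : depends_on jetP (@halfsq R k).
Proof.
elim: k => [|k IH] p q E; last exact: (depends_D1 (P := jetP) (fun _ _ => id) IH E).
by rewrite /halfsq/= /w (E (vw 0 2))// /jetP /= inordK.
Qed.

Lemma depends_thirdcb k : depends_on jetP (@thirdcb R k).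
Proof.
elim: k => [|k IH] p q E; last exact: (depends_D1 (P := jetP) (fun _ _ => id) IH E).
by rewrite /thirdcb/= /w (E (vw 0 2))// /jetP /= inordK.
Qed.

Lemma hodX1 p : hodX 1 p = (w 1 2 p)^-1.
Proof.
have oT : open [set: J] by exact: openT.
rewrite /hodX /= (D1_der (l := 1) oT _ (I : [set: J] p)) ?div1r//; first exact: smooth_coord.
exact: der_coord.
Qed.

Definition hodograph p : J := mkjet (w 0 2 p) 0 (fun=> 0) (fun=> 0) (fun k => hodX k p).

(* The hodograph transformation is an involution: w_{0,2} and z_1 exchange their roles. *)
Lemma hodX_hodograph k p : Dom12 p -> hodX k (hodograph p) = w k 2 p.
Proof.
have oD := open_Dom12; elim: k p => [|k IH] p [_ w0] //.
have w12h q : w 1 2 (hodograph q) = (w 1 2 q)^-1 by rewrite /w /hodograph mkjetE hodX1.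
have Dh : Dom12 (hodograph p) by split=> //=; rewrite w12h invr_eq0.
(* The total derivative with respect to w_{0,2}. The hodograph map carries it to the total
   derivative with respect to z_1, so applying the construction twice returns the original jet. *)
pose a : J -> J := fun q v => (w 1 2 q)^-1 * D1_field q v.
have push : forall v, der a p (fun q => hodograph q v) (D1_field (hodograph p) v).
  apply: var_ind => [||j|j|j].
  - rewrite [D1_field _ _]/=; apply: der_eq; first exact: der_coord.
    by rewrite /a /D1_field mkjetE /w mulVf.
  - exact: derC.
  - apply: (der_field (h := fun=> 0)); first by move=> q; rewrite /hodograph mkjetE.
    by rewrite /D1_field mkjetE /w /hodograph mkjetE; exact: derC.
  - apply: (der_field (h := fun=> 0)); first by move=> q; rewrite /hodograph mkjetE.
    by rewrite /D1_field mkjetE /w /hodograph mkjetE; exact: derC.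
  - apply: (der_field (h := hodX j)); first by move=> q; rewrite /hodograph mkjetE.
    rewrite /D1_field mkjetE /w /hodograph mkjetE.
    apply: der_eq; first exact: (der_smooth a oD (smooth_hodX j)).
    rewrite (@Lie_scale R Dom12 D1_field (hodX j) p (w 1 2 p)^-1)//; last exact: smooth_hodX.
    by rewrite -(D1E oD (smooth_hodX j))// mulrC.
have D := Lie_push oD (smooth_hodX k) Dh push.
have E : \forall q \near p, hodX k (hodograph q) = w k 2 q by apply: (open_near oD).
have := der_Lie (der_near E D); rewrite (der_Lie (der_coord _ _ _)).
rewrite /hodX /= -/(hodX k) (D1E oD (smooth_hodX k) Dh) w12h => <-.
by rewrite /a /D1_field mkjetE; field.
Qed.

(** Since E annihilates theta^{k+1}, applying (w_{0,2}/w_{1,2}) D_2 to it amounts to applying -D_1 /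
    w_{1,2}, minus the derivative with respect to w_{0,2}. The product rule on w_{0,2} X_{k+1}
    raises the factor k+1 to k+2. The formula starts at theta^1 because theta^0 still contains
    z_2. *)
Lemma theta_hodX k p : Dom p ->
  theta k.+1 p = (-1) ^+ k * (w 0 2 p * hodX k.+1 p + k.+1%:R * hodX k p).
Proof.
have oD := @open_Dom R; have oD' := open_Dom12.
have DD : Dom `<=` Dom12 by move=> q [].
elim: k p => [|k IH] p Dp; have [u0 w0] := Dp.
  by rewrite theta1E// hodX1 /hodX /= mul1r mulr1n mul1r.
have E := E_theta k.+1 Dp; rewrite -(D1_D2_E_field oD (smooth_theta R k.+1) Dp) in E.
have -> : theta k.+2 p = - D1 (theta k.+1) p / w 1 2 p.
  move/eqP: E; rewrite addr_eq0 => /eqP ->.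
  by rewrite [LHS]/theta /= -/(theta k.+1); field; rewrite ?w0.
have sX j := smooth_sub oD' oD DD (smooth_hodX j).
have d1 := der_D1 oD (sX k.+1) Dp; have d0 := der_D1 oD (sX k) Dp.
have -> : D1 (theta k.+1) p = (-1) ^+ k * (w 1 2 p * hodX k.+1 p
    + w 0 2 p * (hodX k.+2 p * w 1 2 p) + k.+1%:R * (hodX k.+1 p * w 1 2 p)).
  rewrite (D1_on oD (smooth_theta R k.+1) IH Dp).
  have s0 := sX k; have s1 := sX k.+1.
  apply: (D1_der oD _ Dp); first by have := oD => ?; smooth_tac.
  apply: der_eq; first by der_tac.
  have -> : D1 (hodX k.+1) p = hodX k.+2 p * w 1 2 p.
    by rewrite [hodX k.+2]/hodX /= -/(hodX k) -/(hodX k.+1) divfK.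
  have -> : D1 (hodX k) p = hodX k.+1 p * w 1 2 p.
    by rewrite [hodX k.+1]/hodX /= -/(hodX k) divfK.
  by rewrite /D1_field mkjetE; ring.
by rewrite exprS -[k.+2%:R]natr1; field; rewrite ?w0.
Qed.

Definition Dom' : set J := [set q | w 0 2 q != 0 /\ z1 q - w 1 2 q != 0].

(* Solves theta^{k+1} = (-1)^k (w_{0,2} X_{k+1} + (k+1) X_k) for the hodograph jet X. *)
Fixpoint chi k q : R := match k with
  | 0%N => z1 q
  | k'.+1 => ((-1) ^+ k' * w k 2 q - k%:R * chi k' q) / w 0 2 q
  end.

Definition hodjet q : J := mkjet (w 0 2 q) 0 (fun=> 0) (fun=> 0) (fun k => chi k q).
(** Only the slots of w_{k,2} are filled, so the corrections [halfsq] and [thirdcb] can be evaluated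
    before the remaining coordinates of the preimage are known. *)
Definition w2jet q : J := mkjet 0 0 (fun=> 0) (fun=> 0) (fun k => hodX k (hodjet q)).
Definition zz2 q : R := z2 q + w 0 2 q * z1 q.
Definition ww01 q : R := w 0 1 q + z1 q * w 0 2 q ^+ 2 / 2.

(** The inverse is triangular: the w_{k,2} come from the theta's alone, the w_{k,1} need the
    w_{j,2}, and the w_{k,0} need both of these and z_2. *)
Definition chart_inv q : J := mkjet (z1 q) (zz2 q)
  (fun k => match k with
   | 0%N => w 0 0 q + zz2 q * ww01 q - z1 q ^+ 2 * w 0 2 q ^+ 3 / 12 - zz2 q ^+ 2 * w 0 2 q / 4
   | 1%N => w 1 0 q + zz2 q * w 1 1 q - z1 q * w 0 2 q ^+ 3 / 6
   | k'.+2 => w k 0 q + thirdcb k' (w2jet q) + zz2 q * w k 1 q end)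
  (fun k => match k with 0%N => ww01 q | k'.+1 => w k 1 q - halfsq k' (w2jet q) end)
  (fun k => hodX k (hodjet q)).

Lemma open_Dom' : open Dom'.
Proof.
have oT : open [set: J] by exact: openT.
have s02 : diff_fun [set: J] (w 0 2) by exact: smooth_coord.
have s12 : diff_fun [set: J] (fun q => z1 q - w 1 2 q) by smooth_tac.
have -> : Dom' = ([set: J] `&` [set p | w 0 2 p != 0]) `&`
    ([set: J] `&` [set p | z1 p - w 1 2 p != 0]).
  by apply/seteqP; split=> p /=; rewrite /Dom'/=; tauto.
by apply: openI; apply: open_neq0.
Qed.

Lemma hodjet_Dom12 q : Dom' q -> Dom12 (hodjet q).
Proof.
move=> [u0 x0]; split=> //=; rewrite /w /hodjet mkjetE /= expr0 mul1r mul1r.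
by rewrite mulf_neq0 ?invr_eq0// -opprB oppr_eq0.
Qed.

Lemma chart_inv_Dom q : Dom' q -> Dom (chart_inv q).
Proof.
move=> Dq; have [u0 x0] := Dq; have [_ /= r0] := hodjet_Dom12 Dq.
by split; rewrite /w /chart_inv mkjetE// hodX1 invr_eq0.
Qed.

Lemma chart_Dom' p : Dom p -> Dom' (chart p).
Proof.
move=> Dp; have [u0 w0] := Dp; split; rewrite ?chartE// theta1E// opprD addrC addrNK oppr_eq0.
by rewrite mulf_neq0// invr_eq0.
Qed.

Lemma chi_eq q k : Dom' q -> (-1) ^+ k * (w 0 2 q * chi k.+1 q + k.+1%:R * chi k q) = w k.+1 2 q.
Proof.
move=> [u0 _] /=; rewrite mulrC [w 0 2 q * _]mulrC divfK// subrK mulrAC -expr2.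
by rewrite sqrr_sign mul1r.
Qed.

(** In z_1 and all w_{k,2} the jet [chart_inv q] agrees with the hodograph image of [hodjet q], so
    the involution returns the prescribed derivatives [chi]. *)
Lemma hodX_chart_inv k q : Dom' q -> hodX k (chart_inv q) = chi k q.
Proof.
move=> Dq; have Dr := hodjet_Dom12 Dq.
have ag : forall v, jetP1 v -> chart_inv q v = hodograph (hodjet q) v.
  apply: jetP1_agree; first by rewrite /z1 /= /w /hodjet mkjetE.
  by move=> j; rewrite /w /chart_inv /hodograph !mkjetE.
by rewrite (@depends_hodX k _ _ ag) hodX_hodograph// /w /hodjet mkjetE.
Qed.

Lemma chart_invK q : Dom' q -> chart (chart_inv q) = q.
Proof.
move=> Dq; have DX := chart_inv_Dom Dq.
have u0 : w 0 2 (chart_inv q) = w 0 2 q by rewrite {1}/w /chart_inv mkjetE.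
have ag : forall v, jetP v -> (chart_inv q) v = (w2jet q) v.
  by apply: jetP_agree => k; rewrite /w /chart_inv /w2jet !mkjetE.
have x1 : z1 (chart_inv q) = z1 q by [].
have x2 : z2 (chart_inv q) = zz2 q by [].
have w1E k : w k.+1 1 (chart_inv q) = w k.+1 1 q - halfsq k (w2jet q) by rewrite {1}/w /chart_inv mkjetE.
have ze k : zeta 1 k (chart_inv q) = w k.+1 1 q.
  by rewrite zeta1E w1E (@depends_halfsq _ _ _ ag) subrK.
apply/funext; apply: var_ind => [||[|[|k]]|[|k]|[|k]]; rewrite /chart ?mkjetE //.
- by rewrite -[LHS]/(z2 (chart_inv q) - w 0 2 (chart_inv q) * z1 (chart_inv q)) x2 u0 x1 /zz2 addrK.
- rewrite /potential0 x1 x2 u0 {1 2}/w /chart_inv !mkjetE /w; by field.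
- by rewrite /potential1 /cB x1 x2 u0 ze {1}/w /chart_inv mkjetE /w; field.
- by rewrite zeta2E ze {1}/w /chart_inv mkjetE x2 (@depends_thirdcb _ _ _ ag) /w; ring.
- by rewrite /cA x1 u0 {1}/w /chart_inv mkjetE /ww01 /w; field.
- by rewrite theta_hodX// u0 !hodX_chart_inv// chi_eq.
Qed.

Lemma chi_chart k p : Dom p -> chi k (chart p) = hodX k p.
Proof.
move=> Dp; have [u0 w0] := Dp; elim: k => [//|k IH].
rewrite [LHS]/= IH !chartE theta_hodX// mulrA -expr2 sqrr_sign mul1r addrK.
by rewrite mulrC mulKf.
Qed.

Lemma chartK p : Dom p -> chart_inv (chart p) = p.
Proof.
move=> Dp; have [u0 w0] := Dp.
have rE : hodjet (chart p) = hodograph p.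
  by rewrite /hodjet /hodograph chartE; congr mkjet; apply/funext => k; rewrite chi_chart.
have hE k : hodX k (hodjet (chart p)) = w k 2 p by rewrite rE hodX_hodograph.
have ag : forall v, jetP v -> (w2jet (chart p)) v = p v.
  by apply: jetP_agree => k; rewrite {1}/w /w2jet mkjetE.
have zE : zz2 (chart p) = z2 p.
  by rewrite /zz2 !chartE -[theta 0 p]/(z2 p - w 0 2 p * z1 p) subrK.
have wE : ww01 (chart p) = w 0 1 p by rewrite /ww01 !chartE /cA subrK.
apply/funext; apply: var_ind => [||[|[|k]]|[|k]|k]; rewrite /chart_inv ?mkjetE ?zE ?wE ?chartE //.
- by rewrite /potential0 -[p (vw 0 0)]/(w 0 0 p); ring.
- by rewrite /potential1 /cB -[p (vw 1 0)]/(w 1 0 p); ring.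
- by rewrite (@depends_thirdcb _ _ _ ag) zeta2E -[p (vw k.+2 0)]/(w k.+2 0 p); ring.
- by rewrite (@depends_halfsq _ _ _ ag) zeta1E -[p (vw k.+1 1)]/(w k.+1 1 p); ring.
Qed.

Lemma smooth_chi k : diff_fun Dom' (chi k).
Proof.
have oD := open_Dom'; elim: k => [|k IH]; first exact: smooth_coord.
have h : diff_fun Dom' (fun q => (w 0 2 q)^-1) by apply: smoothV => //; [move=> p []|exact: smooth_coord].
by rewrite /= -/(chi k); smooth_tac.
Qed.

Lemma smooth_chart_inv : smooth_field Dom' chart_inv.
Proof.
have oD := open_Dom'; have oT : open [set: J] by exact: openT.
have sh : smooth_field Dom' hodjet.
  by apply: smooth_mkjet => *; [smooth_tac..|exact: smooth_chi].
have sX k : diff_fun Dom' (fun q => hodX k (hodjet q)).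
  exact: (smooth_comp oD open_Dom12 hodjet_Dom12 sh (smooth_hodX k)).
have sw : smooth_field Dom' w2jet by apply: smooth_mkjet => *; [smooth_tac..|exact: sX].
have sH k : diff_fun Dom' (fun q => halfsq k (w2jet q)).
  exact: (smooth_comp oD oT (fun _ _ => I) sw (smooth_halfsq k oT)).
have sT k : diff_fun Dom' (fun q => thirdcb k (w2jet q)).
  exact: (smooth_comp oD oT (fun _ _ => I) sw (smooth_thirdcb k oT)).
have sz : diff_fun Dom' zz2 by rewrite /zz2; smooth_tac.
have s1 : diff_fun Dom' ww01 by rewrite /ww01; smooth_tac.
apply: smooth_mkjet => [||[|[|k]]|[|k]|k] //.
- by smooth_tac.
- by smooth_tac.
- by smooth_tac.
- by have := sT k => ?; smooth_tac.
- by have := sH k => ?; smooth_tac.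
Qed.

End Inverse.

(** * Kernels of the straightened fields *)

Section NewCoordinates.
Variable R : realType.
Local Notation J := (J R).
Local Notation Dom' := (@Dom' R).
Local Notation E_chart := (@E_chart R).
Local Notation D2_chart_dir := (@D2_chart_dir R).
Local Notation D2_chart := (@D2_chart R).
Implicit Types (f g : J -> R) (p q : J) (u v : var) (S : seq var) (O U : set J) (a b c : J -> J).

Lemma evE v q u : ev v q u = (u == v)%:R :> R.
Proof. by rewrite /ev; case: eqP. Qed.

Lemma smooth_ev O v : open O -> smooth_field O (@ev R v).
Proof. by move=> oO u; exact: smooth_cst. Qed.

Lemma Lie0_on O a g p : open O -> (forall q, O q -> g q = 0) -> O p -> Lie a g p = 0.
Proof.
move=> oO g0 Op; rewrite (Lie_on a oO Op (g := fun=> 0))//.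
by apply: der_Lie; exact: derC.
Qed.

Lemma pd0_on O g p v : open O -> (forall q, O q -> g q = 0) -> O p -> pd v g p = 0.
Proof.
by move=> oO g0 Op; rewrite (pd_near v (open_near oO Op g0)) pd_cst.
Qed.

Lemma Lie_zero_field O a g p : open O -> diff_fun O g -> O p -> (forall v, a p v = 0) ->
  Lie a g p = 0.
Proof.
by move=> oO sg Op a0; rewrite (@Lie_scale R O a g p 0)// ?mul0r// => v; rewrite a0 mul0r.
Qed.

(** The starting rank is supplied by the finite support of a differential function. *)
Lemma downward (P : nat -> Prop) : (exists N, forall k, (N <= k)%N -> P k) ->
  (forall k, P k.+1 -> P k) -> forall k, P k.
Proof.
move=> [N HN] H; suff D n k : (N - n <= k)%N -> P k by move=> k; apply: (D N); rewrite subnn.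
elim: n k => [|n IH] k; first by rewrite subn0; exact: HN.
by move=> nk; apply/H/IH; lia.
Qed.

Lemma Lie_pd_sum O a g p N : open O -> diff_fun O g -> O p ->
  (forall k, (N <= k)%N -> pd (vw k 0) g p * a p (vw k 0) + pd (vw k 1) g p * a p (vw k 1)
     + pd (vw k 2) g p * a p (vw k 2) = 0) ->
  Lie a g p = pd vz1 g p * a p vz1 + pd vz2 g p * a p vz2 + \sum_(0 <= k < N)
    (pd (vw k 0) g p * a p (vw k 0) + pd (vw k 1) g p * a p (vw k 1)
     + pd (vw k 2) g p * a p (vw k 2)).
Proof.
move=> oO sg Op H; rewrite -(Lie_limn a oO Op sg); congr (_ + _).
apply: limn_stationary => n Nn; rewrite (@big_cat_nat _ _ _ N)//=.
by rewrite addrC big_nat_cond big1 ?add0r// => k /andP[/andP[Nk _] _]; exact: H.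
Qed.

Lemma pd_vanish O g l : open O -> diff_fun O g -> (l < 3)%N ->
  exists N, forall k, (N <= k)%N -> forall p, O p -> pd (vw k l) g p = 0.
Proof.
move=> oO sg l3; have [S [_ sup]] := finsupp_uniq (smooth_finsupp sg).
have [N SN] := vars_supp S; exists N => k Nk p Op.
by apply: (pd_notin oO Op sup); apply/negP => /SN; rewrite mem_vars ltnNge Nk.
Qed.

Lemma bracket_zero O a b c g : open O -> smooth_field O a -> smooth_field O b -> diff_fun O g ->
  (forall q, O q -> Lie a g q = 0) -> (forall q, O q -> Lie b g q = 0) ->
  (forall q, O q -> forall v, exists l m,
     [/\ der a q (fun r => b r v) l, der b q (fun r => a r v) m & c q v = l - m]) ->
  forall q, O q -> Lie c g q = 0.
Proof.
move=> oO sa sb sg ga gb H q Oq.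
rewrite -(@Lie_bracket R O a b c g q)//.
  by rewrite !(Lie0_on _ oO)// subrr.
by move=> v; have [l [m [h1 h2 ->]]] := H q Oq v; rewrite (der_Lie h1) (der_Lie h2).
Qed.

Lemma smooth_E_chart O : open O -> smooth_field O E_chart.
Proof. by move=> oO; apply: smooth_mkjet => *; smooth_tac. Qed.

Lemma smooth_D2_chart_dir O : open O -> smooth_field O D2_chart_dir.
Proof.
by move=> oO; apply: smooth_mkjet => [||[|[|k]]|[|k]|[|k]]; smooth_tac.
Qed.

Lemma smooth_D2_chart O : open O -> O `<=` Dom' -> smooth_field O D2_chart.
Proof.
move=> oO OD v; have h := smooth_D2_chart_dir oO v.
have h' : diff_fun O (fun q => (z1 q - w 1 2 q)^-1).
  by apply: smoothV => //; [move=> q /OD[]|smooth_tac].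
by rewrite /D2_chart; smooth_tac.
Qed.

(** Here [c] is the bracket of the coordinate field of [v] with [E_chart]: a slot w_{k+1,l} with l <
    2 occurs in [E_chart] only as the coefficient at w_{k,l}. *)
Lemma pd_Lie_E_chart O v c g q : open O -> diff_fun O g -> O q ->
  c q = mkjet 0 0 (fun k => (vw k.+1 0 == v)%:R) (fun k => (vw k.+1 1 == v)%:R) (fun=> 0) ->
  pd v (Lie E_chart g) q = Lie E_chart (pd v g) q + Lie c g q.
Proof.
move=> oO sg Oq cE; have sF := smooth_E_chart oO.
rewrite -(Lie_pd v oO (smooth_Lie oO sF sg) Oq).
rewrite (Lie_on E_chart oO Oq (g := Lie (ev v) g)); last first.
  by move=> r Or; rewrite (Lie_pd v oO sg Or).
apply/eqP; rewrite addrC -subr_eq; apply/eqP.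
apply: (Lie_bracket oO (smooth_ev v oO) sF sg Oq) => x; rewrite cE.
have -> : Lie E_chart (fun r => ev v r x) q = 0 by apply: der_Lie; exact: derC.
rewrite subr0; apply/esym/der_Lie; move: x.
apply: var_ind => [||k|k|k]; rewrite ?mkjetE -?evE.
- exact: derC.
- exact: derC.
- by apply: (der_field (h := fun r => w k.+1 0 r)) => [r|]; [rewrite /E_chart mkjetE|rewrite -(evE v q); exact: der_coord].
- by apply: (der_field (h := fun r => w k.+1 1 r)) => [r|]; [rewrite /E_chart mkjetE|rewrite -(evE v q); exact: der_coord].
- by apply: (der_field (h := fun=> 0)) => [r|]; [rewrite /E_chart mkjetE|exact: derC].
Qed.

Lemma pd_E_chart_comm O v g q : open O -> diff_fun O g -> O q ->
  (forall k l, (l < 2)%N -> vw k.+1 l != v) ->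
  pd v (Lie E_chart g) q = Lie E_chart (pd v g) q.
Proof.
move=> oO sg Oq nv; rewrite (@pd_Lie_E_chart O v (fun=> mkjet 0 0
   (fun k => (vw k.+1 0 == v)%:R) (fun k => (vw k.+1 1 == v)%:R) (fun=> 0)) g q)//.
rewrite (Lie_zero_field oO sg Oq) ?addr0//.
by apply: var_ind => // k; rewrite mkjetE// (negbTE (nv _ _ _)).
Qed.

Lemma pd_E_chart_succ O k l g q : open O -> diff_fun O g -> O q -> (l < 2)%N ->
  pd (vw k.+1 l) (Lie E_chart g) q = Lie E_chart (pd (vw k.+1 l) g) q + pd (vw k l) g q.
Proof.
move=> oO sg Oq l2; rewrite -(Lie_pd (vw k l) oO sg Oq); apply: (pd_Lie_E_chart oO sg Oq).
have l3 : (l < 3)%N by exact: ltnW.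
apply/funext; apply: var_ind => [||j|j|j]; rewrite evE ?mkjetE//.
by rewrite vw_eq//; case: l l2 {l3} => [|[|]] //=; rewrite andbF.
Qed.

Definition isparam : pred var := fun v => (v == vz2) || jetP v.

Lemma isparamE : (isparam vz1 = false) * (isparam vz2 = true) *
  (forall k, isparam (vw k 0) = false) * (forall k, isparam (vw k 1) = false) *
  (forall k, isparam (vw k 2) = true).
Proof. by do !split => *; rewrite /isparam /jetP /= ?inordK. Qed.

(** The bracket of the derivative with respect to w_{k+1,l} and [E_chart] is the derivative with
    respect to w_{k,l}, so vanishing descends from above the support to k = 0. Once these
    derivatives are gone, [E_chart] reduces to d/dz_1. *)
Lemma ker_E_chart O g : open O -> diff_fun O g -> (forall q, O q -> Lie E_chart g q = 0) ->
  forall q v, O q -> ~~ isparam v -> pd v g q = 0.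
Proof.
move=> oO sg g0.
have main l : (l < 2)%N -> forall k q, O q -> pd (vw k l) g q = 0.
  move=> l2; apply: downward; first exact: pd_vanish (ltnW l2).
  move=> k IH q Oq; have := pd_E_chart_succ k oO sg Oq l2.
  by rewrite (pd0_on _ oO g0 Oq) (Lie0_on _ oO IH Oq) add0r => /esym.
move=> q v Oq; move: v; apply: var_ind => [_||k _|k _|k]; rewrite ?isparamE//; last 2 first.
- exact: main.
- exact: main.
have := g0 q Oq; rewrite (@Lie_pd_sum O E_chart g q 0 oO sg Oq).
  by rewrite big_geq// /E_chart /= mulr1 mulr0 !addr0.
by move=> k _; rewrite (main 0%N isT k q Oq) (main 1%N isT k q Oq) /E_chart mkjet2 !mul0r mulr0 !addr0.
Qed.

(* [fX] and [- fY] are the coefficients of 1 and theta^1 in [D2_chart_dir] once the derivatives with respect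
   to theta^k, k > 0, are dropped; [fZ] = [fX, fY], [fW] = [fX, fZ] and [fV] = [fY, fZ]. *)
Definition fX q : J := mkjet 0 0 (fun k => if k is 0%N then z2 q ^+ 2 / 4 else 0) (fun=> 0)
  (fun k => if k is 0%N then 1 else 0).
Definition fY q : J := mkjet 0 1
  (fun k => match k with 0%N => - (z2 q + w 0 2 q * z1 q) * w 0 2 q / 2
    | 1%N => - w 0 2 q ^+ 2 / 2 | _ => 0 end)
  (fun k => if k is 0%N then w 0 2 q else 0) (fun=> 0).
Definition fZ q : J := mkjet 0 0
  (fun k => match k with 0%N => - (z2 q + w 0 2 q * z1 q) | 1%N => - w 0 2 q | _ => 0 end)
  (fun k => if k is 0%N then 1 else 0) (fun=> 0).
Definition fW q : J := mkjet 0 0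
  (fun k => match k with 0%N => - z1 q | 1%N => -1 | _ => 0 end) (fun=> 0) (fun=> 0).
Definition fV q : J := mkjet 0 0
  (fun k => match k with 0%N => -1 | _ => 0 end) (fun=> 0) (fun=> 0).

Ltac comp_der := (refine (der_field _ _); [let r := fresh "r" in intro r;
   rewrite /fX /fY /fZ /fW /fV /D2_chart_dir ?mkjetE /=; reflexivity | der_tac]).

Ltac brk := eexists; eexists; (split; [comp_der | comp_der |
   rewrite /fX /fY /fZ /fW /fV /D2_chart_dir ?mkjetE /=; by field]).

Lemma smooth_fX O : open O -> smooth_field O fX.
Proof. by move=> oO; apply: smooth_mkjet => [||[|[|k]]|[|k]|[|k]]; smooth_tac. Qed.
Lemma smooth_fY O : open O -> smooth_field O fY.
Proof. by move=> oO; apply: smooth_mkjet => [||[|[|k]]|[|k]|[|k]]; smooth_tac. Qed.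
Lemma smooth_fZ O : open O -> smooth_field O fZ.
Proof. by move=> oO; apply: smooth_mkjet => [||[|[|k]]|[|k]|[|k]]; smooth_tac. Qed.

(** In the chart these are the parameters and the slots of [potential0], [potential1] and [cA]; the
    complement consists of z_1 and the zeta's. *)
Definition integral_pd v := [|| isparam v, v == vw 0 0, v == vw 1 0 | v == vw 0 1].

Lemma ker_D2_chart O g : open O -> O `<=` Dom' -> diff_fun O g -> (forall q, O q -> Lie D2_chart g q = 0) ->
  forall q v, O q -> integral_pd v -> pd v g q = 0.
Proof.
move=> oO OD sg g0.
(* Dropping the nonvanishing factor keeps the kernel and leaves polynomial coefficients, so that the
   brackets below stay short. *)
have gD q : O q -> Lie D2_chart_dir g q = 0.
  move=> Oq; have [_ x0] := OD _ Oq; have := g0 q Oq.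
  rewrite (@Lie_scale R O D2_chart_dir g q (z1 q - w 1 2 q)^-1 D2_chart)// => /eqP.
  by rewrite mulf_eq0 invr_eq0 (negbTE x0) => /eqP.
(* theta^{k+2} enters [D2_chart_dir] only through the coefficient -theta^{k+2} at theta^{k+1};
   bracketing with its coordinate field therefore gives minus the coordinate field of
   theta^{k+1}. *)
have gth : forall k q, O q -> pd (vw k.+1 2) g q = 0.
  apply: downward.
    have [N HN] := pd_vanish oO sg (isT : (2 < 3)%N).
    by exists N => k Nk q Oq; apply: HN => //; rewrite leqW.
  move=> k IH q Oq.
  have h r : O r -> Lie (ev (vw k.+2 2)) g r = 0 by move=> Or; rewrite (Lie_pd _ oO sg Or) IH.
  have e12 : ev (vw k.+2 2) q (vw 1 2) = 0 :> R by rewrite evE vw_eq.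
  have e02 : ev (vw k.+2 2) q (vw 0 2) = 0 :> R by rewrite evE vw_eq.
  have := @bracket_zero O (ev (vw k.+2 2)) D2_chart_dir (fun p v => - ev (vw k.+1 2) p v) g oO
    (smooth_ev _ oO) (smooth_D2_chart_dir oO) sg h gD.
  move=> /(_ _ q Oq) H; apply/eqP; rewrite -oppr_eq0 -(Lie_pd _ oO sg Oq) -mulN1r; apply/eqP.
  rewrite -(@Lie_scale R O _ g q (-1) (fun p v => - ev (vw k.+1 2) p v))//; last first.
    by move=> v; rewrite mulN1r.
  apply: H => r Or.
  have f12 : ev (vw k.+2 2) r (vw 1 2) = 0 :> R by rewrite evE vw_eq.
  have f02 : ev (vw k.+2 2) r (vw 0 2) = 0 :> R by rewrite evE vw_eq.
  have f1 : ev (vw k.+2 2) r vz1 = 0 :> R by [].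
  have f2 : ev (vw k.+2 2) r vz2 = 0 :> R by [].
  have fk j : ev (vw k.+2 2) r (vw j.+2 2) = (j == k)%:R :> R by rewrite evE vw_eq// andbT.
  have c1 : ev (vw k.+1 2) r vz1 = 0 :> R by [].
  have c2 : ev (vw k.+1 2) r vz2 = 0 :> R by [].
  have c30 j : ev (vw k.+1 2) r (vw j 0) = 0 :> R by rewrite evE vw_eq// andbF.
  have c31 j : ev (vw k.+1 2) r (vw j 1) = 0 :> R by rewrite evE vw_eq// andbF.
  have c02 : ev (vw k.+1 2) r (vw 0 2) = 0 :> R by rewrite evE vw_eq.
  have ck j : ev (vw k.+1 2) r (vw j.+1 2) = (j == k)%:R :> R by rewrite evE vw_eq// andbT.
  apply: var_ind => [||[|[|j]]|[|j]|[|j]]; eexists; exists 0;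
    (split; [comp_der|exact: derC|]); rewrite ?c1 ?c2 ?c30 ?c31 ?c02 ?ck /= ?f12 ?f02 ?f1 ?f2 ?fk; ring.
(* theta^1 occurs in several components, all linearly; differentiating the coefficients with respect
   to it gives [- fY]. *)
have gY q : O q -> Lie fY g q = 0.
  move=> Oq; have h r : O r -> Lie (ev (vw 1 2)) g r = 0.
    by move=> Or; rewrite (Lie_pd _ oO sg Or) gth.
  have := @bracket_zero O (ev (vw 1 2)) D2_chart_dir (fun p v => -1 * fY p v) g oO
    (smooth_ev _ oO) (smooth_D2_chart_dir oO) sg h gD.
  move=> /(_ _ q Oq) H; apply/eqP; rewrite -oppr_eq0 -mulN1r; apply/eqP.
  rewrite -(@Lie_scale R O _ g q (-1) (fun p v => -1 * fY p v))//.
  apply: H => r Or.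
  have f12 : ev (vw 1 2) r (vw 1 2) = 1 :> R by rewrite evE vw_eq.
  have f02 : ev (vw 1 2) r (vw 0 2) = 0 :> R by rewrite evE vw_eq.
  have f1 : ev (vw 1 2) r vz1 = 0 :> R by [].
  have f2 : ev (vw 1 2) r vz2 = 0 :> R by [].
  have fk j : ev (vw 1 2) r (vw j.+2 2) = 0 :> R by rewrite evE vw_eq.
  apply: var_ind => [||[|[|j]]|[|j]|[|j]]; eexists; exists 0;
    (split; [comp_der|exact: derC|]); rewrite /fY ?mkjetE /= ?f12 ?f02 ?f1 ?f2 ?fk; by field.
(* Modulo derivatives with respect to theta^k, k > 0, already known to vanish, [fX] is
   [D2_chart_dir] plus theta^1 times [fY]. *)
have gX q : O q -> Lie fX g q = 0.
  move=> Oq; have := gD q Oq; have := gY q Oq.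
  rewrite (@Lie_pd_sum O fY g q 2 oO sg Oq); last first.
    by case=> [|[|k]] // _; rewrite /fY !mkjetE !mulr0 !addr0.
  rewrite (@Lie_pd_sum O D2_chart_dir g q 2 oO sg Oq); last first.
    by case=> [|[|k]] // _; rewrite /D2_chart_dir !mkjetE gth// !mulr0 mul0r !addr0.
  rewrite (@Lie_pd_sum O fX g q 2 oO sg Oq); last first.
    by case=> [|[|k]] // _; rewrite /fX !mkjetE !mulr0 !addr0.
  rewrite !big_nat_recr// !big_geq// /fX /fY /D2_chart_dir !mkjetE /= !gth// => hY hD.
  match type of hY with ?y = _ => match type of hD with ?d = _ =>
    transitivity (d + w 1 2 q * y) end end; first by field.
  by rewrite hY hD mulr0 addr0.
have gZ : forall q, O q -> Lie fZ g q = 0.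
  apply: (bracket_zero oO (smooth_fX oO) (smooth_fY oO) sg gX gY) => q Oq.
  by apply: var_ind => [||[|[|k]]|[|k]|[|k]]; brk.
have gW : forall q, O q -> Lie fW g q = 0.
  apply: (bracket_zero oO (smooth_fX oO) (smooth_fZ oO) sg gX gZ) => q Oq.
  by apply: var_ind => [||[|[|k]]|[|k]|[|k]]; brk.
have gV : forall q, O q -> Lie fV g q = 0.
  apply: (bracket_zero oO (smooth_fY oO) (smooth_fZ oO) sg gY gZ) => q Oq.
  by apply: var_ind => [||[|[|k]]|[|k]|[|k]]; brk.
have sumE (a : J -> J) q : O q -> (forall k, a q (vw k.+2 0) = 0) -> (forall k, a q (vw k.+1 1) = 0) ->
    (forall k, a q (vw k.+1 2) = 0) ->
    Lie a g q = pd vz1 g q * a q vz1 + pd vz2 g q * a q vz2 + pd (vw 0 0) g q * a q (vw 0 0)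
     + pd (vw 1 0) g q * a q (vw 1 0) + pd (vw 0 1) g q * a q (vw 0 1)
     + pd (vw 0 2) g q * a q (vw 0 2).
  move=> Oq h0 h1 h2; rewrite (@Lie_pd_sum O a g q 2 oO sg Oq).
    by rewrite !big_nat_recr// !big_geq// h1 h2 /=; ring.
  by case=> [|[|k]] // _; rewrite h0 h1 h2; ring.
(* The five fields are triangular: [fV], [fW], [fZ], [fX], [fY] in this order each give one new
   vanishing derivative, with respect to the slots of [potential0], [potential1], [cA], w_{0,2} and
   theta^0. *)
have g00 q : O q -> pd (vw 0 0) g q = 0.
  move=> Oq; have := gV q Oq; rewrite (sumE _ _ Oq) => [H|k|k|k]; rewrite /fV ?mkjetE//.
  by move: H; rewrite /fV !mkjetE /=; lra.
have g10 q : O q -> pd (vw 1 0) g q = 0.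
  move=> Oq; have := gW q Oq; rewrite (sumE _ _ Oq) => [H|k|k|k]; rewrite /fW ?mkjetE//.
  by move: H; rewrite /fW !mkjetE g00// /=; lra.
have g01 q : O q -> pd (vw 0 1) g q = 0.
  move=> Oq; have := gZ q Oq; rewrite (sumE _ _ Oq) => [H|k|k|k]; rewrite /fZ ?mkjetE//.
  by move: H; rewrite /fZ !mkjetE g00// g10// /=; lra.
have g02 q : O q -> pd (vw 0 2) g q = 0.
  move=> Oq; have := gX q Oq; rewrite (sumE _ _ Oq) => [H|k|k|k]; rewrite /fX ?mkjetE//.
  by move: H; rewrite /fX !mkjetE g00// g10// g01// /=; lra.
have gz2 q : O q -> pd vz2 g q = 0.
  move=> Oq; have := gY q Oq; rewrite (sumE _ _ Oq) => [H|k|k|k]; rewrite /fY ?mkjetE//.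
  by move: H; rewrite /fY !mkjetE g00// g10// g01// g02// /=; lra.
move=> q v Oq /or4P[|/eqP->|/eqP->|/eqP->]; rewrite ?g00 ?g10 ?g01//.
move: v; apply: var_ind => [||k|k|[|k]]; rewrite ?isparamE// => _; rewrite ?gz2 ?g02 ?gth//.
Qed.


End NewCoordinates.

(** * Structure of the solutions in the chart *)

Section Structure.
Variable R : realType.
Local Notation J := (J R).
Local Notation Dom' := (@Dom' R).
Local Notation E_chart := (@E_chart R).
Local Notation D2_chart_dir := (@D2_chart_dir R).
Local Notation D2_chart := (@D2_chart R).
Implicit Types (f g F : J -> R) (p q : J) (u v : var) (S : seq var) (O U : set J).

Lemma integral_D2_chart O g q : open O -> diff_fun O g -> O q ->
  (forall v, integral_pd v -> pd v g q = 0) -> Lie D2_chart g q = 0.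
Proof.
move=> oO sg Oq H.
rewrite (@Lie_scale R O D2_chart_dir g q (z1 q - w 1 2 q)^-1 D2_chart)// (@Lie_pd_sum R O D2_chart_dir g q 0 oO sg Oq).
  by rewrite big_geq// (H vz2)// /D2_chart_dir /= mul0r mulr0 !addr0 mulr0.
have h2 k : pd (vw k 2) g q = 0 by apply: H; rewrite /integral_pd isparamE.
have h00 : pd (vw 0 0) g q = 0 by apply: H; rewrite /integral_pd eqxx !orbT.
have h10 : pd (vw 1 0) g q = 0 by apply: H; rewrite /integral_pd eqxx !orbT.
have h01 : pd (vw 0 1) g q = 0 by apply: H; rewrite /integral_pd eqxx !orbT.
by case=> [|[|k]] _; rewrite /D2_chart_dir !mkjetE h2 ?h00 ?h10 ?h01; ring.
Qed.

Lemma der_pd O g q v : open O -> diff_fun O g -> O q -> der (ev v) q g (pd v g q).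
Proof. by move=> oO sg Oq; rewrite -(Lie_pd v oO sg Oq); exact: der_smooth sg Oq. Qed.

Lemma pd_der O g q v l : open O -> diff_fun O g -> O q -> der (ev v) q g l -> pd v g q = l.
Proof. by move=> oO sg Oq H; rewrite -(Lie_pd v oO sg Oq) (der_Lie H). Qed.

Lemma param_neq v : isparam v ->
  [/\ forall k l, (l < 2)%N -> vw k l != v, vz1 != v & forall k, vw k.+1 0 != v].
Proof.
move=> pv; split=> [k l l2||k]; apply: contraTneq pv => <-; rewrite ?isparamE//.
by case: l l2 => [|[|]] //; rewrite isparamE.
Qed.

Section Box.
Variables (S0 : seq var) (e0 : R) (q0 : J).
Hypothesis e0_gt0 : 0 < e0.
Local Notation B := (box S0 e0 q0).
Hypothesis BD : B `<=` Dom'.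
Let oB : open B := box_open S0 e0 q0.

(** Every mixture of two points of a box lies in the box, as does the segment between mixtures
    differing in one coordinate. Changing the finitely many relevant coordinates one by one, each
    change outside [P] has mean value 0. *)
Lemma box_indep F (P : pred var) : diff_fun B F ->
  (forall q v, B q -> ~~ P v -> pd v F q = 0) ->
  forall q q', B q -> B q' -> (forall v, P v -> q v = q' v) -> F q = F q'.
Proof.
move=> sF F0 q q' Bq Bq' E; have [T HT] := smooth_finsupp sF.
have Bm s : B (mix s q' q).
  by move=> v vS; rewrite /mix; case: ifP => _; [exact: Bq'|exact: Bq].
rewrite (HT q' (mix T q' q) Bq' (Bm T)); last by move=> v vT; rewrite /mix vT.
elim: T {HT} => [|v s ->]; first by congr F; apply/funext => v; rewrite /mix.
set m := mix s q' q.
have mE : mix (v :: s) q' q = upd m v (q' v).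
  by apply/funext => u; rewrite /m /mix /upd inE; case: eqP => [->|].
rewrite mE; have [Pv|nPv] := boolP (P v).
  have <- : m v = q' v by rewrite /m /mix E//; case: ifP.
  by rewrite upd_id.
have Bseg (r : R) : 0 <= r <= 1 -> B (upd m v (m v + r * (q' v - m v))).
  by move=> r01; apply: box_upd => //; [exact: Bm|rewrite -mE; exact: Bm].
have [|r [r01 Er]] := @mvt_upd R F m v (q' v).
  by move=> r r01; apply: smooth_derivable sF _; exact: Bseg.
by apply/eqP; rewrite eq_sym -subr_eq0 Er F0 ?mul0r//; exact: Bseg.
Qed.

Definition paramfree F := forall q v, B q -> isparam v -> pd v F q = 0.

Lemma paramfree_E_chart F : diff_fun B F -> paramfree F -> paramfree (Lie E_chart F).
Proof.
move=> sF F0 q v Bq pv; have [n1 _ _] := param_neq pv.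
rewrite (pd_E_chart_comm oB sF Bq) => [|k l]; last exact: n1.
by apply: (Lie0_on _ oB) Bq => r Br; exact: F0.
Qed.

Lemma paramfree_pd F v : diff_fun B F -> paramfree F -> paramfree (pd v F).
Proof.
move=> sF F0 q u Bq pu; rewrite (schwarz u v oB sF Bq).
by apply: (pd0_on _ oB) Bq => r Br; exact: F0.
Qed.

Lemma const_box F : diff_fun B F -> paramfree F -> (forall q, B q -> Lie E_chart F q = 0) ->
  forall q, B q -> F q = F q0.
Proof.
move=> sF F0 EF q Bq; apply: (box_indep (P := pred0) sF) => //; last exact: box_center.
move=> r v Br _; have [pv|npv] := boolP (isparam v); first exact: F0.
exact: (ker_E_chart oB sF EF).
Qed.

Lemma smooth_E_chart_box F : diff_fun B F -> diff_fun B (Lie E_chart F).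
Proof. by move=> sF; apply: smooth_Lie => //; exact: smooth_E_chart. Qed.

Lemma affine_box F : diff_fun B F -> paramfree F ->
  (forall q, B q -> Lie E_chart (Lie E_chart F) q = 0) ->
  exists m n, forall q, B q -> F q = m * z1 q + n.
Proof.
move=> sF F0 EEF; have sE := smooth_E_chart_box sF.
have Em := const_box sE (paramfree_E_chart sF F0) EEF; set m := Lie E_chart F q0 in Em.
have sG : diff_fun B (fun q => F q + - (m * z1 q)) by smooth_tac.
have G0 : paramfree (fun q => F q + - (m * z1 q)).
  move=> q v Bq pv; have d := der_pd v oB sF Bq; have [_ n1 _] := param_neq pv.
  apply: (pd_der oB sG Bq); apply: der_eq; first by der_tac.
  by rewrite evE (negbTE n1) F0// /=; ring.
have EG q : B q -> Lie E_chart (fun q => F q + - (m * z1 q)) q = 0.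
  move=> Bq; have d := der_smooth E_chart oB sF Bq; apply: der_Lie; apply: der_eq; first by der_tac.
  by rewrite Em// /E_chart /=; ring.
exists m, (F q0 - m * z1 q0) => q Bq.
by have := const_box sG G0 EG Bq; move=> H; rewrite -H; ring.
Qed.

Definition free3 F := forall q v, B q -> [|| v == vw 0 0, v == vw 1 0 | v == vw 0 1] -> pd v F q = 0.

Lemma vw_neq01 : (forall k l, (l < 2)%N -> vw k.+1 l != vw 0 1) *
  (forall k l, (l < 2)%N -> vw k.+1 l != vw 0 0).
Proof. by split=> k l l2; rewrite vw_eq// ltnW. Qed.

Lemma integral_box F : diff_fun B F -> paramfree F -> free3 F ->
  forall q, B q -> Lie D2_chart F q = 0.
Proof.
move=> sF F0 F3 q Bq; apply: (integral_D2_chart oB sF Bq) => v.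
by rewrite /integral_pd => /orP[]; [exact: F0|exact: F3].
Qed.

(* If E is the derivative [E_chart] and E (E T) does not involve y_0, c_0, c_1 (the slots of w_{0,1},
   w_{0,0}, w_{1,0}), then T is a function independent of these coordinates plus [polyT], and
   [polyET] is E of [polyT]; [polyS] plays the same role when E S is free of them. *)
Definition polyT (a b c d r s : R) q : R :=
  (a * z1 q + b) * w 0 1 q + (c * z1 q + d) * w 0 0 q
  + (- c * z1 q ^+ 2 + r * z1 q + s) * w 1 0 q.

Definition polyET (a b c d r s : R) q : R :=
  a * w 0 1 q + (a * z1 q + b) * w 1 1 q + c * w 0 0 q + (c * z1 q + d) * w 1 0 q
  + (r - 2 * c * z1 q) * w 1 0 q + (- c * z1 q ^+ 2 + r * z1 q + s) * w 2 0 q.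

Definition polyS (a b c : R) q : R := a * w 0 1 q + b * (w 0 0 q - z1 q * w 1 0 q) + c * w 1 0 q.

Lemma smooth_polyT (a b c d r s : R) : diff_fun B (polyT a b c d r s).
Proof. by rewrite /polyT; smooth_tac. Qed.

Lemma smooth_polyS (a b c : R) : diff_fun B (polyS a b c).
Proof. by rewrite /polyS; smooth_tac. Qed.

Lemma ev_coord v q : [/\ ev v q vz1 = (vz1 == v)%:R :> R, ev v q (vw 0 0) = (vw 0 0 == v)%:R :> R,
  ev v q (vw 1 0) = (vw 1 0 == v)%:R :> R & ev v q (vw 0 1) = (vw 0 1 == v)%:R :> R].
Proof. by split; exact: evE. Qed.

(** Common end of the two structure lemmas. The derivative of [f] with respect to z_1 is left open
    since the coefficients may depend on z_1, which remains a variable of the resulting integral. *)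
Lemma subtract_poly F f (y0 c0 c1 : J -> R) : diff_fun B F -> diff_fun B f -> paramfree F ->
  (forall q, B q -> pd (vw 0 1) F q = y0 q) -> (forall q, B q -> pd (vw 0 0) F q = c0 q) ->
  (forall q, B q -> pd (vw 1 0) F q = c1 q) ->
  (forall q v, B q -> vz1 != v -> der (ev v) q f ((vw 0 1 == v)%:R * y0 q
      + (vw 0 0 == v)%:R * c0 q + (vw 1 0 == v)%:R * c1 q)) ->
  [/\ diff_fun B (fun q => F q + - f q), paramfree (fun q => F q + - f q) &
      free3 (fun q => F q + - f q)].
Proof.
move=> sF sf F0 hy h0 h1 df; have sG : diff_fun B (fun q => F q + - f q) by smooth_tac.
split=> // q v Bq pv; have d := der_pd v oB sF Bq.
  have [n1 n2 _] := param_neq pv; have d' := df q v Bq n2.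
  apply: (pd_der oB sG Bq); apply: der_eq; first by der_tac.
  by rewrite F0// !(negbTE (n1 _ _ _))// /=; ring.
have n2 : vz1 != v by case/or3P: pv => /eqP ->.
have d' := df q v Bq n2.
apply: (pd_der oB sG Bq); apply: der_eq; first by der_tac.
by case/or3P: pv => /eqP ->; rewrite !vw_eq//= ?h0 ?h1 ?hy// /=; ring.
Qed.

(** The derivatives of T with respect to y_0 and c_0 commute with [E_chart], hence are annihilated
    by its square and affine in z_1. For c_1 the commutator brings in the derivative with respect to
    c_0, whence a quadratic coefficient. *)
Lemma struct_T T : diff_fun B T -> paramfree T -> free3 (Lie E_chart (Lie E_chart T)) ->
  exists a b c d r s gam, [/\ diff_fun B gam, forall q, B q -> Lie D2_chart gam q = 0 &
    forall q, B q -> T q = gam q + polyT a b c d r s q /\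
      Lie E_chart T q = Lie E_chart gam q + polyET a b c d r s q].
Proof.
move=> sT T0 T3; have sE := smooth_E_chart_box sT; have sEE := smooth_E_chart_box sE.
have comm v : (forall k l, (l < 2)%N -> vw k.+1 l != v) -> [|| v == vw 0 0, v == vw 1 0 | v == vw 0 1] ->
    forall q, B q -> Lie E_chart (Lie E_chart (pd v T)) q = 0.
  move=> nv v3 q Bq; have := T3 q v Bq v3; rewrite (pd_E_chart_comm oB sE Bq nv) => <-.
  by apply: (Lie_on E_chart oB Bq) => r Br; rewrite (pd_E_chart_comm oB sT Br nv).
have spd v := smooth_pd v oB sT.
have [|a [b Hy]] := affine_box (spd (vw 0 1)) (paramfree_pd (vw 0 1) sT T0).
  by apply: comm; [exact: vw_neq01.1|rewrite eqxx !orbT].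
have [|c [d H0]] := affine_box (spd (vw 0 0)) (paramfree_pd (vw 0 0) sT T0).
  by apply: comm; [exact: vw_neq01.2|rewrite eqxx].
have s1 := spd (vw 1 0); have p1 := paramfree_pd (vw 1 0) sT T0.
have E0 q : B q -> Lie E_chart (pd (vw 0 0) T) q = c.
  move=> Bq; rewrite (Lie_on E_chart oB Bq H0); apply: der_Lie; apply: der_eq; first by der_tac.
  by rewrite /E_chart /=; ring.
(* Commuting the derivative with respect to c_1 past E twice leaves 2 E (dT/dc_0) = 2 c. *)
have E1 q : B q -> Lie E_chart (Lie E_chart (pd (vw 1 0) T)) q = - (2 * c).
  move=> Bq; have := T3 q (vw 1 0) Bq; rewrite eqxx !orbT => /(_ isT).
  rewrite (@pd_E_chart_succ R B 0 0 _ q oB sE Bq isT).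
  rewrite (pd_E_chart_comm oB sT Bq vw_neq01.2) E0//.
  rewrite (Lie_on E_chart oB Bq (g := fun r => Lie E_chart (pd (vw 1 0) T) r + (c * z1 r + d))); last first.
    by move=> r Br; rewrite (@pd_E_chart_succ R B 0 0 _ r oB sT Br isT) H0.
  have dd := der_smooth E_chart oB (smooth_E_chart_box s1) Bq.
  rewrite (der_Lie (l := Lie E_chart (Lie E_chart (pd (vw 1 0) T)) q + c)); last first.
    by apply: der_eq; [der_tac|rewrite /E_chart /=; ring].
  by move=> H; rewrite -[LHS](addrK (c + c)) addrA H; ring.
(* As E (E (c z_1^2)) = 2 c, adding c z_1^2 makes the derivative affine; this is the origin of the
   term - c z_1^2 in [polyT]. *)
have sG : diff_fun B (fun q => pd (vw 1 0) T q + c * z1 q ^+ 2) by smooth_tac.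
have [|q Bq|r [s H1]] := affine_box sG.
- move=> q v Bq pv; have d' := der_pd v oB s1 Bq; have [_ n1 _] := param_neq pv.
  apply: (pd_der oB sG Bq); apply: der_eq; first by der_tac.
  by rewrite evE (negbTE n1) p1// /=; ring.
- rewrite (Lie_on E_chart oB Bq (g := fun r => Lie E_chart (pd (vw 1 0) T) r + 2 * c * z1 r)); last first.
    move=> r Br; have d' := der_smooth E_chart oB s1 Br; apply: der_Lie.
    by apply: der_eq; [der_tac|rewrite /E_chart /=; ring].
  have d' := der_smooth E_chart oB (smooth_E_chart_box s1) Bq; apply: der_Lie; apply: der_eq; first by der_tac.
  by rewrite E1// /E_chart /=; ring.
have [q Bq|q v Bq n1|sg g0 g3] := @subtract_poly T (polyT a b c d r s) (fun q => a * z1 q + b)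
  (fun q => c * z1 q + d) (fun q => - c * z1 q ^+ 2 + r * z1 q + s) sT (smooth_polyT _ _ _ _ _ _) T0 Hy H0.
- by rewrite -[LHS](addrK (c * z1 q ^+ 2)) (H1 q Bq); ring.
- apply: der_eq; first by rewrite /polyT; der_tac.
  by have [-> -> -> ->] := ev_coord v q; rewrite (negbTE n1) /w /z1 /=; ring.
have dP q : B q -> der E_chart q (polyT a b c d r s) (polyET a b c d r s q).
  move=> Bq; apply: der_eq; first by rewrite /polyT; der_tac.
  by rewrite /polyET /E_chart !mkjetE /=; ring.
exists a, b, c, d, r, s, (fun q => T q + - polyT a b c d r s q); split=> //.
  exact: integral_box.
move=> q Bq; split; first by rewrite subrK.
have d1 := der_smooth E_chart oB sT Bq; have d2 := dP q Bq.
rewrite (der_Lie (f := fun q => T q + - polyT a b c d r s q)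
  (l := Lie E_chart T q - polyET a b c d r s q)); first by rewrite subrK.
by der_tac.
Qed.

(** With one application of E instead of two, the derivatives with respect to y_0 and c_0 are
    constants, and E (dF/dc_1) = - dF/dc_0 gives the combination c_0 - z_1 c_1. *)
Lemma struct_S F : diff_fun B F -> paramfree F -> free3 (Lie E_chart F) ->
  exists a b c sig, [/\ diff_fun B sig, forall q, B q -> Lie D2_chart sig q = 0 &
    forall q, B q -> F q = sig q + polyS a b c q].
Proof.
move=> sF F0 F3.
have spd v := smooth_pd v oB sF; have ppd v := paramfree_pd v sF F0.
have Hy := const_box (spd (vw 0 1)) (ppd (vw 0 1)).
have H0 := const_box (spd (vw 0 0)) (ppd (vw 0 0)).
have {}Hy : forall q, B q -> pd (vw 0 1) F q = pd (vw 0 1) F q0.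
  apply: Hy => q Bq; rewrite -(pd_E_chart_comm oB sF Bq vw_neq01.1).
  by apply: F3 => //; rewrite eqxx !orbT.
have {}H0 : forall q, B q -> pd (vw 0 0) F q = pd (vw 0 0) F q0.
  apply: H0 => q Bq; rewrite -(pd_E_chart_comm oB sF Bq vw_neq01.2).
  by apply: F3 => //; rewrite eqxx.
set a := pd (vw 0 1) F q0 in Hy; set b := pd (vw 0 0) F q0 in H0.
have s1 := spd (vw 1 0).
have E1 q : B q -> Lie E_chart (pd (vw 1 0) F) q = - b.
  move=> Bq; have := F3 q (vw 1 0) Bq; rewrite eqxx !orbT => /(_ isT).
  by rewrite (@pd_E_chart_succ R B 0 0 _ q oB sF Bq isT) H0// => /eqP; rewrite addr_eq0 => /eqP.
have sG : diff_fun B (fun q => pd (vw 1 0) F q + b * z1 q) by smooth_tac.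
have pG : paramfree (fun q => pd (vw 1 0) F q + b * z1 q).
  move=> q v Bq pv; have d' := der_pd v oB s1 Bq; have [_ n1 _] := param_neq pv.
  apply: (pd_der oB sG Bq); apply: der_eq; first by der_tac.
  by rewrite evE (negbTE n1) ppd// /=; ring.
have H1 := const_box sG pG.
have {}H1 : forall q, B q -> pd (vw 1 0) F q + b * z1 q = pd (vw 1 0) F q0 + b * z1 q0.
  apply: H1 => q Bq; have d' := der_smooth E_chart oB s1 Bq; apply: der_Lie.
  by apply: der_eq; [der_tac|rewrite E1// /E_chart /=; ring].
set c := _ + b * z1 q0 in H1.
have [q Bq|q v Bq n1|sg g0 g3] := @subtract_poly F (polyS a b c) (fun=> a) (fun=> b)
  (fun q => - b * z1 q + c) sF (smooth_polyS _ _ _) F0 Hy H0.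
- by rewrite -(H1 q Bq); ring.
- apply: der_eq; first by rewrite /polyS; der_tac.
  by have [-> -> -> ->] := ev_coord v q; rewrite (negbTE n1) /w /z1 /=; ring.
exists a, b, c, (fun q => F q + - polyS a b c q); split=> //.
  exact: integral_box.
by move=> q Bq; rewrite subrK.
Qed.

(** Replacing the parameters by their values at the centre commutes with [E_chart], which neither
    differentiates nor contains them, and does not change functions free of parameters. *)
Definition freeze q : J := fun v => if isparam v then q0 v else q v.

Lemma freeze_box q : B q -> B (freeze q).
Proof.
move=> Bq v vS; rewrite /freeze; case: ifP => _; last exact: Bq.
by rewrite subrr normr0.
Qed.

Lemma smooth_freeze g : diff_fun B g -> diff_fun B (fun q => g (freeze q)).
Proof.
move=> sg; apply: (smooth_comp oB oB freeze_box) sg => v; rewrite /freeze.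
by case: (isparam v); smooth_tac.
Qed.

Lemma freeze_paramfree g : paramfree (fun q => g (freeze q)).
Proof.
move=> q v Bq pv; apply: pd_eq.
rewrite (_ : (fun t => _) = fun=> g (freeze q)); first exact: is_derive_constr.
apply/funext => t; congr g; apply/funext => u; rewrite /freeze.
by case: ifP => // pu; rewrite upd_neq//; apply: contraFneq pu => ->.
Qed.

Lemma Lie_freeze g q : diff_fun B g -> B q ->
  der E_chart q (fun r => g (freeze r)) (Lie E_chart g (freeze q)).
Proof.
move=> sg Bq; apply: (Lie_push oB sg (freeze_box Bq)).
have fz k l : (l < 2)%N -> w k l (freeze q) = w k l q.
  by move=> l2; rewrite /w /freeze; case: l l2 => [|[|]]; rewrite // isparamE.
apply: var_ind => [||k|k|k]; rewrite /E_chart ?mkjetE ?fz//.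
- apply: (der_field (h := fun r => r vz1)); first by move=> r; rewrite /freeze isparamE.
  exact: der_coord.
- apply: (der_field (h := fun=> q0 vz2)); first by move=> r; rewrite /freeze isparamE.
  exact: derC.
- apply: (der_field (h := fun r => r (vw k 0))); first by move=> r; rewrite /freeze isparamE.
  by apply: der_eq; first exact: der_coord; rewrite mkjetE.
- apply: (der_field (h := fun r => r (vw k 1))); first by move=> r; rewrite /freeze isparamE.
  by apply: der_eq; first exact: der_coord; rewrite mkjetE.
- apply: (der_field (h := fun=> q0 (vw k 2))); first by move=> r; rewrite /freeze isparamE.
  exact: derC.
Qed.

Lemma integral_freeze g q : diff_fun B g -> (forall q v, B q -> integral_pd v -> pd v g q = 0) ->
  B q -> g (freeze q) = g q.
Proof.
move=> sg g0 Bq; apply: (box_indep (P := fun v => ~~ isparam v) sg) => //.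
- by move=> r v Br /negPn pv; apply: g0 => //; rewrite /integral_pd pv.
- exact: freeze_box.
- by move=> v; rewrite /freeze => /negbTE ->.
Qed.

Lemma structure F : diff_fun B F ->
  (forall q, B q -> Lie D2_chart (Lie D2_chart (Lie E_chart F)) q = 0) ->
  exists a b c d r s k0 k1 k2 gam sig rho,
    [/\ diff_fun B gam /\ (forall q, B q -> Lie D2_chart gam q = 0),
        diff_fun B sig /\ (forall q, B q -> Lie D2_chart sig q = 0),
        diff_fun B rho /\ (forall q v, B q -> ~~ isparam v -> pd v rho q = 0) &
        forall q, B q -> F q = zz2 q * (Lie E_chart gam q + polyET a b c d r s q)
          - w 0 2 q * (gam q + polyT a b c d r s q) + (sig q + polyS k0 k1 k2 q) + rho q].
Proof.
move=> sF H; have sdF := smooth_D2_chart oB BD.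
pose h := Lie E_chart F; have sh : diff_fun B h by exact: smooth_E_chart_box.
pose al := Lie D2_chart h; have sal : diff_fun B al by exact: smooth_Lie.
have szz : diff_fun B (@zz2 R) by rewrite /zz2; smooth_tac.
pose be q := h q + - (zz2 q * al q); have sbe : diff_fun B be by rewrite /be; smooth_tac.
have dzz q : B q -> der D2_chart q (@zz2 R) 1.
  move=> /BD[_ x0]; apply: der_eq; first by rewrite /zz2; der_tac.
  by rewrite /D2_chart /D2_chart_dir !mkjetE /= /z1 /w; field.
have ial := ker_D2_chart oB BD sal H.
have ibe : forall q v, B q -> integral_pd v -> pd v be q = 0.
  apply: (ker_D2_chart oB BD sbe) => q Bq; have dz := dzz q Bq.
  have dh := der_smooth D2_chart oB sh Bq; have da := der_smooth D2_chart oB sal Bq.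
  apply: der_Lie; apply: der_eq; first by rewrite /be; der_tac.
  by rewrite (H q Bq) /al; ring.
have hE q : B q -> h q = zz2 q * al q + be q by rewrite /be => _; ring.
have pint v : isparam v -> integral_pd v by rewrite /integral_pd => ->.
have pdh v q l : B q -> isparam v -> der (ev v) q (@zz2 R) l -> pd v h q = l * al q.
  move=> Bq pv dz; have d1 := der_pd v oB sal Bq; have d2 := der_pd v oB sbe Bq.
  rewrite (pd_near v (open_near oB Bq hE)); apply: (pd_der oB _ Bq); first by smooth_tac.
  apply: der_eq; first by der_tac.
  by rewrite ial ?pint// ibe ?pint//; ring.
pose P1 := pd vz2 F; pose Q1 := pd (vw 0 2) F.
have sP1 : diff_fun B P1 := smooth_pd vz2 oB sF.
have sQ1 : diff_fun B Q1 := smooth_pd (vw 0 2) oB sF.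
have EP1 q : B q -> Lie E_chart P1 q = al q.
  move=> Bq; rewrite -(pd_E_chart_comm oB sF Bq) => [|k l l2//].
  rewrite (@pdh vz2 q 1 Bq isT) ?mul1r//.
  apply: der_eq; first by rewrite /zz2; der_tac.
  by rewrite !evE /=; ring.
have p02 : isparam (vw 0 2) by rewrite isparamE.
have EQ1 q : B q -> Lie E_chart Q1 q = z1 q * al q.
  move=> Bq; have [n1 _ _] := param_neq p02.
  rewrite -(pd_E_chart_comm oB sF Bq) => [|k l l2]; last exact: n1.
  rewrite (@pdh (vw 0 2) q (z1 q) Bq p02)//.
  apply: der_eq; first by rewrite /zz2; der_tac.
  by rewrite !evE eqxx /z1 /=; ring.
(* [P1] and [Q1] may depend on the parameters. Their frozen versions do not, and have the same
   derivatives along E because [al] is free of parameters. *)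
pose P q := P1 (freeze q); pose Q q := Q1 (freeze q).
have sP : diff_fun B P by exact: smooth_freeze.
have sQ : diff_fun B Q by exact: smooth_freeze.
have sF0 : diff_fun B (fun q => F (freeze q)) by exact: smooth_freeze.
have dP q : B q -> der E_chart q P (al q).
  move=> Bq; apply: der_eq; first exact: Lie_freeze.
  by rewrite EP1; [exact: (integral_freeze sal ial Bq)|exact: freeze_box].
have dQ q : B q -> der E_chart q Q (z1 q * al q).
  move=> Bq; apply: der_eq; first exact: Lie_freeze.
  rewrite EQ1; last exact: freeze_box.
  by rewrite (integral_freeze sal ial Bq) /z1 /freeze isparamE.
have dF0 q : B q -> der E_chart q (fun q => F (freeze q))
    ((z2 q0 + w 0 2 q0 * z1 q) * al q + be q).
  move=> Bq; apply: der_eq; first exact: Lie_freeze.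
  rewrite -/h hE; last exact: freeze_box.
  by rewrite (integral_freeze sal ial Bq) (integral_freeze sbe ibe Bq) /zz2 /z1 /z2 /w /freeze !isparamE.
pose T q := z1 q * P q + - Q q; have sT : diff_fun B T by rewrite /T; smooth_tac.
have dT q : B q -> der E_chart q T (P q).
  move=> Bq; have dp := dP q Bq; have dq := dQ q Bq.
  apply: der_eq; first by rewrite /T; der_tac.
  by rewrite /E_chart /=; ring.
pose S q := F (freeze q) + - (z2 q0 * P q) + - (w 0 2 q0 * Q q).
have sS : diff_fun B S by rewrite /S; smooth_tac.
have dS q : B q -> der E_chart q S (be q).
  move=> Bq; have dp := dP q Bq; have dq := dQ q Bq; have df := dF0 q Bq.
  by apply: der_eq; first (by rewrite /S; der_tac); move=> /=; ring.
have T0 : paramfree T.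
  move=> q v Bq pv; have [_ n1 _] := param_neq pv.
  have d1 := der_pd v oB sP Bq; have d2 := der_pd v oB sQ Bq.
  apply: (pd_der oB sT Bq); apply: der_eq; first by rewrite /T; der_tac.
  by rewrite evE (negbTE n1) !(freeze_paramfree _ Bq pv) /=; ring.
have PS : paramfree S.
  move=> q v Bq pv.
  have d1 := der_pd v oB sP Bq; have d2 := der_pd v oB sQ Bq; have d3 := der_pd v oB sF0 Bq.
  apply: (pd_der oB sS Bq); apply: der_eq; first by rewrite /S; der_tac.
  by rewrite !(freeze_paramfree _ Bq pv) /=; ring.
have ET q : B q -> Lie E_chart T q = P q by move=> Bq; exact: der_Lie (dT q Bq).
have T3 : free3 (Lie E_chart (Lie E_chart T)).
  move=> q v Bq v3; rewrite (pd_near v (g := al)); last first.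
    apply: (open_near oB Bq) => r Br.
    by rewrite (Lie_on E_chart oB Br ET); exact: der_Lie (dP r Br).
  by apply: ial => //; rewrite /integral_pd v3 orbT.
have S3 : free3 (Lie E_chart S).
  move=> q v Bq v3; rewrite (pd_near v (g := be)); last first.
    by apply: (open_near oB Bq) => r Br; exact: der_Lie (dS r Br).
  by apply: ibe => //; rewrite /integral_pd v3 orbT.
have [a [b [c [d [r [s [gam [sgam gam0 HT]]]]]]]] := struct_T sT T0 T3.
have [k0 [k1 [k2 [sig [ssig sig0 HS]]]]] := struct_S sS PS S3.
pose rho q := F q + - (zz2 q * P q + - (w 0 2 q * T q) + S q).
have srho : diff_fun B rho by rewrite /rho; smooth_tac.
exists a, b, c, d, r, s, k0, k1, k2, gam, sig, rho; split=> //.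
  split=> // ; apply: (ker_E_chart oB srho) => q Bq.
  have d1 := dT q Bq; have d2 := dS q Bq; have d3 := dP q Bq; have d4 := der_smooth E_chart oB sF Bq.
  apply: der_Lie; apply: der_eq; first by rewrite /rho /zz2; der_tac.
  rewrite -/h hE// /E_chart !mkjetE /zz2 /= /w /z1 /z2; ring.
move=> q Bq; have [TE D1_D2_E_field] := HT q Bq; rewrite -TE -D1_D2_E_field -HS// ET// /rho; ring.
Qed.


End Box.
End Structure.

(** * Cosymmetries *)

Section Cosymmetries.
Variable R : realType.
Local Notation J := (J R).
Local Notation Dom := (@Dom R).
Local Notation Dom' := (@Dom' R).
Local Notation E_chart := (@E_chart R).
Local Notation D2_chart := (@D2_chart R).
Local Notation E_field := (@E_field R).
Local Notation D2_field := (@D2_field R).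
Local Notation chart := (@chart R).
Local Notation chart_inv := (@chart_inv R).
Implicit Types (f g F G : J -> R) (p q : J) (u v : var) (S : seq var) (O U V B : set J).

Lemma open_preim U V (Phi : J -> J) : open U -> open V -> smooth_field U Phi ->
  open (U `&` Phi @^-1` V).
Proof.
move=> oU oV sP; rewrite openE => p [Up Vp]; apply: filterI; first exact: open_nbhs_nbhs.
have [S [e [e0 sub]]] := openP_box oV Vp.
have : nbhs p [set q | forall v, v \in S -> `|Phi q v - Phi p v| < e].
  apply: (near_in_seq (P := fun v => [set q | `|Phi q v - Phi p v| < e])) => v _.
  exact: ((cont_epsP _ _).1 (smooth_cont (sP v) Up) e e0).
by apply: filterS => q Hq; apply: sub.
Qed.

Lemma push_E B G p : open B -> diff_fun B G -> Dom p -> B (chart p) ->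
  Lie E_field (fun q => G (chart q)) p = Lie E_chart G (chart p).
Proof. by move=> oB sG Dp Bp; apply: der_Lie; apply: (Lie_push oB sG Bp); exact: push_E_field. Qed.

Lemma push_D2 B G p : open B -> diff_fun B G -> Dom p -> B (chart p) ->
  Lie D2_field (fun q => G (chart q)) p = Lie D2_chart G (chart p).
Proof. by move=> oB sG Dp Bp; apply: der_Lie; apply: (Lie_push oB sG Bp); exact: push_D2_field. Qed.

Lemma cosymE V f p : open V -> V `<=` Dom -> diff_fun V f -> V p ->
  D2 (D2 (fun q => D1 f q + w 0 2 q * D2 f q)) p = Lie D2_field (Lie D2_field (Lie E_field f)) p.
Proof.
move=> oV VD sf Vp.
have sE : diff_fun V (Lie E_field f) by apply: smooth_Lie => //; exact: smooth_E_field.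
have eqE q : V q -> Lie E_field f q = D1 f q + w 0 2 q * D2 f q by move=> Vq; rewrite (D1_D2_E_field oV sf Vq).
have s1 := smooth_eq oV eqE sE.
have e1 q : V q -> D2 (fun q => D1 f q + w 0 2 q * D2 f q) q = Lie D2_field (Lie E_field f) q.
  by move=> Vq; rewrite (D2E oV s1 Vq); apply: (Lie_on D2_field oV Vq) => r Vr; rewrite eqE.
by rewrite (D2E oV (smooth_D2 oV VD s1) Vp); exact: (Lie_on D2_field oV Vp e1).
Qed.

Lemma Lie_sumZ V (a : J -> J) n (c : 'I_n -> R) (g : 'I_n -> J -> R) p : open V ->
  (forall i, diff_fun V (g i)) -> V p ->
  Lie a (fun q => \sum_(i < n) c i * g i q) p = \sum_(i < n) c i * Lie a (g i) p.
Proof.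
move=> oV sg Vp; apply: der_Lie; apply: is_derive_sumr => i.
apply: is_derive_eq (is_derive_mulr (is_derive_constr (c i) 0) (der_smooth a oV (sg i) Vp)) _.
by rewrite mul0r add0r.
Qed.

(** D_2 maps z_2 to 1 and kills [A0] and [A1]: one application leaves [A1], the second leaves 0. *)
Lemma cosym_affine V g A0 A1 : open V -> V `<=` Dom ->
  diff_fun V A0 -> diff_fun V A1 ->
  (forall q, V q -> Lie D2_field A0 q = 0) -> (forall q, V q -> Lie D2_field A1 q = 0) ->
  (forall q, V q -> Lie E_field g q = A1 q * z2 q + A0 q) ->
  forall q, V q -> Lie D2_field (Lie D2_field (Lie E_field g)) q = 0.
Proof.
move=> oV VD s0 s1 h0 h1 E q Vq.
rewrite (Lie_on D2_field oV Vq (g := A1)) ?h1// => r Vr.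
rewrite (Lie_on D2_field oV Vr E); have d0 := der_smooth D2_field oV s0 Vr; have d1 := der_smooth D2_field oV s1 Vr.
by apply: der_Lie; apply: der_eq; [der_tac|rewrite h0// h1// /D2_field /=; ring].
Qed.

Lemma smooth_cC V : open V -> diff_fun V (@cC R).
Proof.
by move=> oV; have h := smooth_zeta 1 0 oV; rewrite /cC /cB; smooth_tac.
Qed.

Lemma smooth_cA V : open V -> diff_fun V (@cA R).
Proof. by move=> oV; rewrite /cA; smooth_tac. Qed.

Lemma smooth_cB V : open V -> diff_fun V (@cB R).
Proof. by move=> oV; have h := smooth_zeta 1 0 oV; rewrite /cB; smooth_tac. Qed.

Lemma cCE p : cC p = z1 p * potential1 p - potential0 p.
Proof. by rewrite /cC /potential1 /potential0; field. Qed.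

Lemma theta0E p : theta 0 p = z2 p - w 0 2 p * z1 p.
Proof. by []. Qed.

Lemma smooth_explicit V i : open V -> V `<=` Dom -> (i < 9)%N ->
  diff_fun V (nth (fun=> 0) (explicit_gens R) i).
Proof.
move=> oV VD i9; have sA := smooth_cA oV; have sB := smooth_cB oV; have sC := smooth_cC oV.
have s1 := smooth_zeta 1 0 oV; have s2 := smooth_zeta 2 0 oV.
have st := smooth_sub (@open_Dom R) oV VD (@smooth_theta R 0).
by do 9?[case: i i9 => [_|i i9]; first by cbv [nth explicit_gens]; smooth_tac].
Qed.

Lemma smooth_generator V g : open V -> V `<=` Dom -> generator V g -> diff_fun V g.
Proof.
move=> oV VD [[]|[[]|[[gam [[sg _] ->]]|[i [i9 ->]]]]] //; last exact: smooth_explicit.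
by have s1 := smooth_D1 oV sg; smooth_tac.
Qed.

Lemma integral_E V g p : open V -> V `<=` Dom -> z2_integral V g -> V p ->
  Lie E_field g p = D1 g p.
Proof. by move=> oV VD [sg g0] Vp; rewrite -(D1_D2_E_field oV sg Vp) g0// mulr0 addr0. Qed.

Lemma integral_D1 V g : open V -> V `<=` Dom -> z2_integral V g -> z2_integral V (D1 g).
Proof.
move=> oV VD [sg g0]; split; first exact: smooth_D1.
move=> p Vp; rewrite -(D1D2 oV VD sg Vp) (D1_on oV (smooth_D2 oV VD sg) g0 Vp).
by apply: (D1_der oV (smooth_cst _ oV) Vp); exact: derC.
Qed.

Lemma integral_D2_field V g p : open V -> z2_integral V g -> V p -> Lie D2_field g p = 0.
Proof. by move=> oV [sg g0] Vp; rewrite -(D2E oV sg Vp) g0. Qed.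

(** The function [F] in [rho_fun] is not assumed differentiable, so there is no chain rule for it.
    In the chart, the line along [E_chart] leaves every parameter fixed, so [g] is exactly constant
    on it near the point. *)
Lemma rho_E V g p : open V -> V `<=` Dom -> rho_fun V g -> V p -> Lie E_field g p = 0.
Proof.
move=> oV VD [sg [n [F gE]]] Vp; have Dp := VD _ Vp.
pose W : set J := Dom' `&` chart_inv @^-1` V.
have oW : open W := open_preim (@open_Dom' R) oV (@smooth_chart_inv R).
have sG : diff_fun W (fun q => g (chart_inv q)).
  apply: (smooth_comp oW oV _ _ sg); first by move=> q [].
  by move=> v; apply: (smooth_sub (@open_Dom' R) oW) (smooth_chart_inv R v) => q [].
have Wp : W (chart p) by split; [exact: chart_Dom'|rewrite /= chartK].
rewrite (Lie_on E_field oV Vp (g := fun q => g (chart_inv (chart q)))); last first.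
  by move=> q Vq; rewrite chartK//; exact: VD.
rewrite (push_E oW sG Dp Wp); set q := chart p in Wp *.
apply: der_Lie; apply: is_derive_near (is_derive_constr (g (chart_inv q)) (0:R)).
have [d [d0 Hd]] := lineto_near E_chart (open_nbhs_nbhs (conj oW Wp)).
exists d; split=> // s /Hd Ws; rewrite add0r.
have par r v : isparam v -> lineto E_chart r s v = r v.
  move: v; apply: var_ind => [||k|k|k]; rewrite ?isparamE// => _.
    by rewrite /lineto /E_chart /= mulr0 addr0.
  by rewrite /lineto /E_chart mkjetE mulr0 addr0.
set r := lineto _ _ _ in Ws *; have parr v : isparam v -> r v = q v by exact: par.
have [Dr Vr] := Ws; have [Dq Vq] := Wp.
rewrite !gE//.
have uE x : Dom' x -> w 0 2 (chart_inv x) = w 0 2 x by move=> Dx; rewrite -[in RHS](chart_invK Dx) chartE.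
have tE x k : Dom' x -> theta k (chart_inv x) = if k is 0%N then z2 x else w k 2 x.
  by move=> Dx; rewrite -[in RHS](chart_invK Dx); case: k => [|k]; rewrite chartE.
congr F; first by rewrite !uE// /w parr// isparamE.
apply/rowP => k; rewrite !mxE !tE//; case: (val k) => [|j].
  by rewrite /z2 parr// isparamE.
by rewrite /w parr// isparamE.
Qed.

(** Written through [cA], [potential0], [potential1] and theta^0, each generator has an E-derivative
    of the form A_1 z_2 + A_0 with explicit integrals; terms in w_{0,2} without z_2 cancel because E
    maps z_2 to w_{0,2}. *)
Lemma cosym_explicit V i : open V -> V `<=` Dom -> (i < 9)%N ->
  forall q, V q -> Lie D2_field (Lie D2_field (Lie E_field (nth (fun=> 0) (explicit_gens R) i))) q = 0.
Proof.
move=> oV VD i9.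
have sz k l := smooth_zeta k l oV.
have s10 := sz 1%N 0%N; have s11 := sz 1%N 1%N; have s20 := sz 2%N 0%N; have s21 := sz 2%N 1%N.
have main A0 A1 : diff_fun V A0 -> diff_fun V A1 ->
    (forall q, V q -> der D2_field q A0 0) -> (forall q, V q -> der D2_field q A1 0) ->
    (forall q, V q -> der E_field q (nth (fun=> 0) (explicit_gens R) i) (A1 q * z2 q + A0 q)) ->
    forall q, V q -> Lie D2_field (Lie D2_field (Lie E_field (nth (fun=> 0) (explicit_gens R) i))) q = 0.
  move=> s0 s1 h0 h1 E; apply: (cosym_affine oV VD s0 s1) => q Vq;
    [exact: der_Lie (h0 q Vq)|exact: der_Lie (h1 q Vq)|exact: der_Lie (E q Vq)].
have zero (h : J -> R) : (forall q, h q = 0) -> forall q, V q -> der D2_field q h 0.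
  by move=> h0 q _; apply: (der_field (h := fun=> 0) h0); exact: derC.
have dz k l q : (k == 1%N) || (k == 2%N) -> V q -> der D2_field q (zeta k l) 0.
  by move=> k12 /VD Dq; exact: der_D2_field_zeta.
have facts q : V q -> [/\ der E_field q (@cA R) (zeta 1 0 q), der E_field q (@potential1 R) (zeta 2 0 q),
    der E_field q (@potential0 R) (potential1 q) & der E_field q (theta 0) 0 ].
  move=> /VD Dq; have P := push_E_field Dq; split.
  - have := P (vw 0 1); rewrite /E_chart mkjetE chartE; apply: der_field => r.
    by rewrite /chart mkjetE.
  - have := P (vw 1 0); rewrite /E_chart mkjetE chartE; apply: der_field => r.
    by rewrite /chart mkjetE.
  - have := P (vw 0 0); rewrite /E_chart mkjetE chartE; apply: der_field => r.
    by rewrite /chart mkjetE.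
  - exact: (P vz2).
have facts2 q : V q -> [/\ der E_field q (zeta 1 0) (zeta 1 1 q), der E_field q (zeta 2 0) (zeta 2 1 q),
   E_field q (vw 0 2) = 0, E_field q vz1 = 1 & E_field q vz2 = w 0 2 q].
  move=> /VD Dq; split; [exact: der_E_field_zeta|exact: der_E_field_zeta|exact: E_field_w02| |].
    by rewrite /E_field /= mulr0 addr0.
  by rewrite /E_field /= mulr1 add0r.
have t0 := theta0E.
have dcC q : V q -> der E_field q (@cC R) (z1 q * zeta 2 0 q).
  move=> Vq; have [_ d1 d0 _] := facts q Vq; have [_ _ _ e1 _] := facts2 q Vq.
  apply: (der_field cCE); apply: der_eq; first by der_tac.
  by rewrite e1; ring.
have dcB q : V q -> der E_field q (fun r => cB r + z1 r * (w 0 2 r) ^+ 3 / 6) (zeta 2 0 q).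
  by move=> Vq; have [_ d1 _ _] := facts q Vq.
have a2z1 q : D2_field q vz1 = 0 by [].
case: i i9 main => [|[|[|[|[|[|[|[|[|i]]]]]]]]] i9 main; last by [].
all: cbv [nth explicit_gens] in main |- *.
- apply: (main (zeta 1 0) (fun=> 0)); [exact: s10|exact: smooth_cst|by move=> q; exact: dz|exact: zero|].
  move=> q Vq; have [d _ _ _] := facts q Vq; apply: der_eq; first exact: d.
  by rewrite mul0r add0r.
- apply: (main (fun=> 0) (fun q => - zeta 1 1 q)) => [||||]; [exact: smooth_cst|by smooth_tac|exact: zero| |].
    move=> q Vq; have d := @dz 1 1 q isT Vq.
    by apply: der_eq; [der_tac|rewrite oppr0].
  move=> q Vq; have [d1 _ _ _] := facts q Vq; have [d2 _ e02 e1 e2] := facts2 q Vq.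
  by apply: der_eq; [der_tac|rewrite e02 e2; ring].
- apply: (main (fun=> 0) (fun q => 2 * zeta 1 0 q + z1 q * zeta 1 1 q)) => [||||];
    [exact: smooth_cst|by smooth_tac|exact: zero| |].
    move=> q Vq; have d := @dz 1 1 q isT Vq; have d' := @dz 1 0 q isT Vq.
    by apply: der_eq; [der_tac|rewrite a2z1; ring].
  move=> q Vq; have [d1 _ _ d3] := facts q Vq; have [d2 _ e02 e1 e2] := facts2 q Vq.
  by apply: der_eq; [der_tac|rewrite e1 e2 t0; ring].
- apply: (main (fun q => z1 q * zeta 2 0 q) (fun=> 0)) => [||||]; [by smooth_tac|exact: smooth_cst| |exact: zero|].
    move=> q Vq; have d := @dz 2 0 q isT Vq.
    by apply: der_eq; [der_tac|rewrite a2z1; ring].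
  by move=> q Vq; apply: der_eq; [exact: dcC|ring].
- apply: (main (zeta 2 0) (fun=> 0)); [exact: s20|exact: smooth_cst|by move=> q; exact: dz|exact: zero|].
  by move=> q Vq; apply: der_eq; [exact: dcB|ring].
- apply: (main (fun=> 0) (fun q => 3 * z1 q * zeta 2 0 q + z1 q ^+ 2 * zeta 2 1 q)) => [||||];
    [exact: smooth_cst|by smooth_tac|exact: zero| |].
    move=> q Vq; have d := @dz 2 1 q isT Vq; have d' := @dz 2 0 q isT Vq.
    by apply: der_eq; [der_tac|rewrite a2z1; ring].
  move=> q Vq; have dC := dcC q Vq; have [_ _ _ d3] := facts q Vq; have [_ d2 e02 e1 e2] := facts2 q Vq.
  by apply: der_eq; [der_tac|rewrite e1 e2 t0 /=; ring].
- apply: (main (fun=> 0) (fun q => - zeta 2 0 q - z1 q * zeta 2 1 q)) => [||||];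
    [exact: smooth_cst|by smooth_tac|exact: zero| |].
    move=> q Vq; have d := @dz 2 1 q isT Vq; have d' := @dz 2 0 q isT Vq.
    by apply: der_eq; [der_tac|rewrite a2z1; ring].
  move=> q Vq; have dC := dcC q Vq; have [_ d2 e02 e1 e2] := facts2 q Vq.
  by apply: der_eq; [der_tac|rewrite e1 e2 e02; ring].
- apply: (main (fun=> 0) (zeta 2 0)) => [||||]; [exact: smooth_cst|by smooth_tac|exact: zero|by move=> q; exact: dz|].
  move=> q Vq; have [_ d1 d0 dt] := facts q Vq; have [_ _ e02 _ e2] := facts2 q Vq.
  (* The last summand is a function of parameters, invisible to E; it cancels the terms in z_1 left
     by the potentials, and turns the coefficient -1/4 of z_2^2 w_{0,2}^2 into -1/6. *)
  apply: (der_field (h := fun r => z2 r * potential1 r - w 0 2 r * potential0 r + (w 0 2 r) ^+ 2 * theta 0 r ^+ 2 / 12)).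
    by move=> r; rewrite t0 /potential1 /potential0; field.
  by apply: der_eq; [der_tac|rewrite e2 e02; ring].
- apply: (main (fun=> 0) (fun q => - zeta 2 1 q)) => [||||]; [exact: smooth_cst|by smooth_tac|exact: zero| |].
    move=> q Vq; have d := @dz 2 1 q isT Vq.
    by apply: der_eq; [der_tac|rewrite oppr0].
  move=> q Vq; have [_ d1 _ _] := facts q Vq; have [_ d2 e02 e1 e2] := facts2 q Vq.
  apply: (der_field (h := fun r => potential1 r * w 0 2 r - z2 r * zeta 2 0 r)).
    by move=> r; rewrite /potential1; field.
  by apply: der_eq; [der_tac|rewrite e02 e2; ring].
Qed.

Lemma cosym_generator V g : open V -> V `<=` Dom -> generator V g ->
  forall q, V q -> Lie D2_field (Lie D2_field (Lie E_field g)) q = 0.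
Proof.
move=> oV VD; have s0 := smooth_cst 0 oV.
have z0 q : Lie D2_field (fun=> 0) q = 0 by apply: der_Lie; exact: derC.
case=> [rg|[ig|[[gam [ig ->]]|[i [i9 ->]]]]]; last exact: cosym_explicit.
- apply: (cosym_affine oV VD s0 s0) => // q Vq.
  by rewrite (rho_E oV VD rg Vq) mul0r addr0.
- have i1 := integral_D1 oV VD ig; apply: (cosym_affine oV VD i1.1 s0) => // q Vq.
    exact: (integral_D2_field oV i1 Vq).
  by rewrite (integral_E oV VD ig Vq) mul0r add0r.
- have i1 := integral_D1 oV VD ig; have i2 := integral_D1 oV VD i1.
  have s2 : diff_fun V (fun q => - D1 (D1 gam) q) by have := i2.1 => ?; smooth_tac.
  apply: (cosym_affine oV VD s0 s2) => // q Vq.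
    have d := der_smooth D2_field oV i2.1 Vq; apply: der_Lie; apply: der_eq; first by der_tac.
    by rewrite (integral_D2_field oV i2 Vq) oppr0.
  have d := der_smooth E_field oV ig.1 Vq; have d1 := der_smooth E_field oV i1.1 Vq.
  apply: der_Lie; apply: der_eq; first by der_tac.
  rewrite (integral_E oV VD ig Vq) (integral_E oV VD i1 Vq) E_field_w02; last exact: VD.
  by rewrite /E_field /=; ring.
Qed.

Lemma lin_comb_cosymmetry V f : open V -> V `<=` Dom -> diff_fun V f -> lin_comb_on V f ->
  cosymmetry V f.
Proof.
move=> oV VD sf [n [c [g [gen fE]]]] p Vp; rewrite (cosymE oV VD sf Vp).
have sg i := smooth_generator oV VD (gen i).
have sE i : diff_fun V (Lie E_field (g i)) by apply: smooth_Lie => //; exact: smooth_E_field.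
have sE2 i : diff_fun V (Lie D2_field (Lie E_field (g i))) by apply: smooth_Lie => //; exact: smooth_D2_field.
have E1 q : V q -> Lie E_field f q = \sum_(i < n) c i * Lie E_field (g i) q.
  by move=> Vq; rewrite (Lie_on E_field oV Vq fE) (Lie_sumZ E_field c oV sg Vq).
have E2 q : V q -> Lie D2_field (Lie E_field f) q = \sum_(i < n) c i * Lie D2_field (Lie E_field (g i)) q.
  by move=> Vq; rewrite (Lie_on D2_field oV Vq E1) (Lie_sumZ D2_field c oV sE Vq).
rewrite (Lie_on D2_field oV Vp E2) (Lie_sumZ D2_field c oV sE2 Vp) big1// => i _.
by rewrite (cosym_generator oV VD (gen i) Vp) mulr0.
Qed.

End Cosymmetries.

(** * From cosymmetries to linear combinations of the generators *)

Section Forward.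
Variable R : realType.
Local Notation J := (J R).
Local Notation Dom := (@Dom R).
Local Notation Dom' := (@Dom' R).
Local Notation E_chart := (@E_chart R).
Local Notation D2_chart := (@D2_chart R).
Local Notation E_field := (@E_field R).
Local Notation D2_field := (@D2_field R).
Local Notation chart := (@chart R).
Local Notation chart_inv := (@chart_inv R).
Implicit Types (f g F G : J -> R) (p q : J) (u v : var) (S : seq var) (O U V B : set J).

(* Outside the parameters theta^0, ..., theta^n and w_{0,2} the value is that of [q0]. *)
Definition patch q0 (n : nat) (t : R) (r : 'rV[R]_n.+1) : J := fun v =>
  if isparam v then match v with
    | inl _ => r 0 (inord 0)
    | inr (0%N, _) => t
    | inr (k.+1, _) => if (k < n)%N then r 0 (inord k.+1) else q0 v
    end
  else q0 v.

Lemma patch_chart q0 n p v : isparam v ->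
  let x := patch q0 (w 0 2 p) (\row_(k < n.+1) theta k p) in
  x v = chart p v \/ v \notin vars n /\ x v = q0 v.
Proof.
rewrite /patch => pv; rewrite pv; move: v pv.
apply: var_ind => [||k|k|[|k]]; rewrite ?isparamE// => _.
- by left; rewrite mxE inordK.
- by left; rewrite /chart mkjetE.
- rewrite [chart p _](_ : _ = theta k.+1 p) ?[LHS]mkjetE//=; have [kn|nk] := ltnP k n; last first.
    by right; split=> //; rewrite mem_vars -leqNgt leqW.
  by left; rewrite mxE inordK.
Qed.

(** The support of [rho] bounds the number of theta's needed; every other coordinate can be filled
    from the centre without leaving the box. *)
Lemma rho_fun_param (S0 : seq var) (e0 : R) q0 rho : 0 < e0 -> let B := box S0 e0 q0 in
  B `<=` Dom' -> diff_fun B rho -> (forall q v, B q -> ~~ isparam v -> pd v rho q = 0) ->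
  diff_fun (Dom `&` chart @^-1` B) (fun p => rho (chart p)) ->
  rho_fun (Dom `&` chart @^-1` B) (fun p => rho (chart p)).
Proof.
move=> e00 B BD srho rho0 sm; split=> //.
have [T HT] := smooth_finsupp srho; have [n Tn] := vars_supp T.
exists n.+1, (fun (t : R) (r : 'rV_n.+1) => rho (patch q0 t r)) => p [Dp Bp].
(* Intermediate point: [chart p] and [m] share all parameters, so [rho] agrees there by
   independence; [m] and the patched jet agree on the finite support. *)
pose m : J := fun v => if isparam v then chart p v else q0 v.
have Bm : B m.
  move=> v vS; rewrite /m; case: ifP => _; first exact: Bp.
  by rewrite subrr normr0.
have np v : ~~ isparam v -> patch q0 (w 0 2 p) (\row_(k < n.+1) theta k p) v = q0 v.
  by rewrite /patch => /negbTE ->.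
have Bx : B (patch q0 (w 0 2 p) (\row_(k < n.+1) theta k p)).
  move=> v vS; have [/(patch_chart q0 n p)[->|[_ ->]]|/np->] := boolP (isparam v).
  - exact: Bp.
  - by rewrite subrr normr0.
  - by rewrite subrr normr0.
rewrite (box_indep (P := isparam) srho rho0 Bp Bm); last by move=> v pv; rewrite /m pv.
apply: HT => // v /Tn vn; rewrite /m.
have [pv|npv] := boolP (isparam v); last by rewrite np.
by have [->//|[/negP]] := patch_chart q0 n p pv.
Qed.

Lemma cosymmetry_push O B f F q : open O -> O `<=` Dom -> open B -> B `<=` Dom' ->
  (forall q, B q -> O (chart_inv q)) -> diff_fun B F -> (forall p, O p -> f p = F (chart p)) ->
  diff_fun O f -> cosymmetry O f -> B q -> Lie D2_chart (Lie D2_chart (Lie E_chart F)) q = 0.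
Proof.
move=> oO OD oB BD XO sF fE sf cf Bq; have Op := XO _ Bq.
have sdF := smooth_D2_chart oB BD.
have sE : diff_fun B (Lie E_chart F) by apply: smooth_Lie => //; exact: smooth_E_chart.
have sDE : diff_fun B (Lie D2_chart (Lie E_chart F)) by exact: smooth_Lie.
pose V : set J := O `&` (Dom `&` chart @^-1` B).
have oV : open V by apply: openI => //; exact: (open_preim (@open_Dom R) oB (@smooth_chart R)).
have Vp : V (chart_inv q) by split=> //; split; [exact: OD|rewrite /= chart_invK//; exact: BD].
have E1 p : V p -> Lie E_field f p = Lie E_chart F (chart p).
  move=> [Op' [Dp Bp]]; rewrite -(push_E oB sF Dp Bp).
  exact: (Lie_on E_field oO Op' fE).
have E2 p : V p -> Lie D2_field (Lie E_field f) p = Lie D2_chart (Lie E_chart F) (chart p).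
  move=> Vp'; have [Op' [Dp Bp]] := Vp'; rewrite -(push_D2 oB sE Dp Bp).
  exact: (Lie_on D2_field oV Vp' E1).
have := cf _ Op; rewrite (cosymE oO OD sf Op) (Lie_on D2_field oV Vp E2).
have [_ [Dp Bp]] := Vp; rewrite (push_D2 oB sDE Dp Bp) chart_invK//; exact: BD.
Qed.

Lemma z2_integral_push B G : open B -> diff_fun B G -> (forall q, B q -> Lie D2_chart G q = 0) ->
  z2_integral (Dom `&` chart @^-1` B) (fun p => G (chart p)).
Proof.
move=> oB sG G0; pose V : set J := Dom `&` chart @^-1` B.
have oV : open V := open_preim (@open_Dom R) oB (@smooth_chart R).
have sV : diff_fun V (fun p => G (chart p)).
  apply: (smooth_comp oV oB _ _ sG); first by move=> q [].
  by move=> v; apply: (smooth_sub (@open_Dom R) oV) (smooth_chart R v) => q [].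
split=> // p Vp; have [Dp Bp] := Vp.
by rewrite (D2E oV sV Vp) (push_D2 oB sG Dp Bp) G0.
Qed.

Lemma cosymmetry_lin_comb O f p : open O -> O `<=` Dom -> diff_fun O f ->
  cosymmetry O f -> O p ->
  exists V : set J, [/\ open V, V p, V `<=` O & lin_comb_on V f].
Proof.
move=> oO OD sf cf Op; have Dp := OD _ Op.
pose W : set J := Dom' `&` chart_inv @^-1` O.
have oW : open W := open_preim (@open_Dom' R) oO (@smooth_chart_inv R).
have Wq : W (chart p) by split; [exact: chart_Dom'|rewrite /= chartK].
have [S0 [e0 [e00 BW]]] := openP_box oW Wq.
set q0 := chart p in BW; pose B : set J := box S0 e0 q0.
have oB : open B by exact: box_open.
have BD : B `<=` Dom' by move=> q /BW[].
have XO q : B q -> O (chart_inv q) by move=> /BW[].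
have sF : diff_fun B (fun q => f (chart_inv q)).
  apply: (smooth_comp oB oO XO _ sf).
  by move=> v; apply: (smooth_sub (@open_Dom' R) oB BD) (smooth_chart_inv R v).
have fE r : O r -> f r = f (chart_inv (chart r)) by move=> /OD Dr; rewrite chartK.
have cF q : B q -> Lie D2_chart (Lie D2_chart (Lie E_chart (fun q => f (chart_inv q)))) q = 0.
  exact: (cosymmetry_push oO OD oB BD XO sF fE sf cf).
have [a [b [c [d [r [s [k0 [k1 [k2 [gam [sig [rho [[sg g0] [ss s0] [sr r0] FE]]]]]]]]]]]]] :=
  structure e00 BD sF cF.
pose V : set J := Dom `&` chart @^-1` B.
have oV : open V := open_preim (@open_Dom R) oB (@smooth_chart R).
have VO : V `<=` O by move=> x [Dx /XO]; rewrite chartK.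
have VD : V `<=` Dom by move=> x [].
(* The generator starting with [z2 p * cB p] equals z_2 [potential1] - w_{0,2} [potential0] plus
   w_{0,2}^2 (theta^0)^2 / 12. It will occur with factor d + r, so the surplus, a function of
   parameters, is taken out of [rho]. *)
pose rho' q := rho q - (d + r) / 12 * (w 0 2 q ^+ 2 * z2 q ^+ 2).
have sr' : diff_fun B rho' by rewrite /rho'; smooth_tac.
have r0' q v : B q -> ~~ isparam v -> pd v rho' q = 0.
  move=> Bq npv; have dr := der_pd v oB sr Bq.
  apply: (pd_der oB sr' Bq); apply: der_eq; first by rewrite /rho'; der_tac.
  have n1 : vw 0 2 != v by apply: contraNneq npv => <-; rewrite isparamE.
  have n2 : vz2 != v by apply: contraNneq npv => <-.
  by rewrite r0// !evE (negbTE n1) (negbTE n2) /=; ring.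
have smoothV (G : J -> R) : diff_fun B G -> diff_fun V (fun x => G (chart x)).
  move=> sG; apply: (smooth_comp oV oB _ _ sG); first by move=> q [].
  by move=> v; apply: (smooth_sub (@open_Dom R) oV) (smooth_chart R v) => q [].
have ig := z2_integral_push oB sg g0; have is' := z2_integral_push oB ss s0.
have ir := rho_fun_param e00 BD sr' r0' (smoothV _ sr').
exists V; split=> //; first by split=> //=; exact: box_center.
pose gs : seq (J -> R) := explicit_gens R ++
  [:: (fun x => w 0 2 x * gam (chart x) - z2 x * D1 (fun y => gam (chart y)) x);
      (fun x => sig (chart x)); (fun x => rho' (chart x))].
(* Each monomial of [polyT] is sent to z_2 E T - w_{0,2} T, and each of [polyS] to itself. The
   monomial with coefficient r gives -r times the seventh generator plus the same expression as the
   one with coefficient d, hence the entry d + r. The entry -1 reflects the sign of w_{0,2} gamma -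
   z_2 D_1 gamma. *)
pose cs : seq R := [:: k0; - b; a; - k1; k2; - c; - r; d + r; - s; -1; 1; 1].
exists 12%N, (fun i => nth 0 cs i), (fun i => nth (fun=> 0) gs i); split.
  move=> i; have [i9|i9] := ltnP i 9.
    by right; right; right; exists i; split=> //; rewrite nth_cat i9.
  rewrite nth_cat ltnNge i9 /=; case: i i9 => i /= i12 i9.
  have [E|[E|E]] : (i - 9 = 0 \/ i - 9 = 1 \/ i - 9 = 2)%N by lia.
  - by rewrite E /=; right; right; left; exists (fun x => gam (chart x)).
  - by rewrite E /=; right; left.
  - by rewrite E /=; left.
move=> x Vx; have [Dx Bx] := Vx.
rewrite fE; last exact: VO.
rewrite FE// !big_ord_recl big_ord0 /= /bump /=.
rewrite -(integral_E oV VD ig Vx) (push_E oB sg Dx Bx).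
rewrite /rho' /polyET /polyT /polyS /zz2 !chartE cCE theta0E /potential1 /potential0 /cB.
rewrite -[I1 x]/(zeta 1 0 x) -[I2 x]/(zeta 2 0 x) /cA.
by field.
Qed.

End Forward.

Theorem theorem24 (R : realType) (O : set (J R)) (f : J R -> R) :
  open O -> O `<=` @Dom R -> diff_fun O f ->
  (cosymmetry O f <->
   forall p, O p -> exists V : set (J R),
     [/\ open V, V p, V `<=` O & lin_comb_on V f]).
Proof.
move=> oO OD sf; split; first by move=> cf p; exact: cosymmetry_lin_comb.
move=> H p Op; have [V [oV Vp VO lc]] := H p Op.
apply: (lin_comb_cosymmetry oV _ (smooth_sub oO oV VO sf) lc Vp).
exact: subset_trans OD.
Qed.
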